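(* Let $m \geq 2$ and let $\phi$ be a formula of $\mathcal{FL}^m1\mathrm{T}$. If $\phi$ is satisfiable, then $\phi$ has a finite model whose size is at most $(m+1)$-tuply exponential in $\|\phi\|$. Hence the satisfiability problem for $\mathcal{FL}^m1\mathrm{T}$ is decidable in non-deterministic $(m+1)$-tuply exponential time.
   Context: Signatures are purely relational (no constants or function symbols; 0-ary predicates allowed) and formulas contain no equality. Fix variables $x_1, x_2, \ldots$. The sets $\mathcal{FL}^{[m]}$ ($m \geq 0$) are defined inductively: (i) every atom whose argument list is exactly $x_\ell, x_{\ell+1}, \ldots, x_m$ (in this order, a contiguous subsequence of $x_1,x_2,\ldots$; for a 0-ary predicate the list is empty) is in $\mathcal{FL}^{[m]}$; (ii) $\mathcal{FL}^{[m]}$ is closed under Boolean combinations; (iii) if $\psi \in \mathcal{FL}^{[m+1]}$ then $\exists x_{m+1}\psi$ and $\forall x_{m+1}\psi$ are in $\mathcal{FL}^{[m]}$. The fluted fragment is $\mathcal{FL} = \bigcup_{m \geq 0}\mathcal{FL}^{[m]}$; $\mathcal{FL}^m$ is the set of fluted formulas using at most $m$ variables (free or bound). $\mathcal{FL}^m1\mathrm{T}$ denotes $\mathcal{FL}^m$ over a signature containing one distinguished binary predicate $\mathfrak{t}$ that is required to be interpreted as a transitive relation (satisfiability is with respect to structures in which $\mathfrak{t}$ is transitive). $\|\phi\|$ denotes the number of symbols of $\phi$. *)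

(* Defs.v *)
From Corelib Require Import BinNums.
From HB Require Import structures.
From mathcomp Require Import all_boot all_order all_algebra.

Set Implicit Arguments.
Unset Strict Implicit.
Unset Printing Implicit Defensive.

(* The ordinary predicates of a signature; the distinguished binary predicate
   is adjoined to them by [predicate]. *)
Record signature := Signature { rel_sym : Type; rel_arity : rel_sym -> nat }.

Inductive predicate (S : signature) := Trans | Rel of rel_sym S.
Arguments Trans {S}.

Definition arity (S : signature) (P : predicate S) : nat :=
  if P is Rel R then rel_arity R else 2.

(* Equality-free first-order formulas; the variable x_i is represented by its
   subscript i. *)
Inductive formula (S : signature) :=
| Bot
| Top
| Atom (P : predicate S) of (arity P).-tuple nat
| Neg of formula S
| And of formula S & formula S
| Or of formula S & formula S
| Imp of formula S & formula S
| Iff of formula S & formula S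
| Ex of nat & formula S
| All of nat & formula S.
Arguments Bot {S}.
Arguments Top {S}.

(* [iota l (m.+1 - l)] is l, l+1, ..., m; it is empty when l = m+1. *)
Inductive fluted (S : signature) : nat -> formula S -> Prop :=
| fluted_atom m l (P : predicate S) (xs : (arity P).-tuple nat) of
    0 < l & val xs = iota l (m.+1 - l) : fluted m (Atom xs)
| fluted_bot m : fluted m Bot
| fluted_top m : fluted m Top
| fluted_neg m f of fluted m f : fluted m (Neg f)
| fluted_and m f g of fluted m f & fluted m g : fluted m (And f g)
| fluted_or m f g of fluted m f & fluted m g : fluted m (Or f g)
| fluted_imp m f g of fluted m f & fluted m g : fluted m (Imp f g)
| fluted_iff m f g of fluted m f & fluted m g : fluted m (Iff f g)
| fluted_ex m f of fluted m.+1 f : fluted m (Ex m.+1 f)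
| fluted_all m f of fluted m.+1 f : fluted m (All m.+1 f).

Fixpoint variables (S : signature) (f : formula S) : seq nat :=
  match f with
  | Bot | Top => [::]
  | Atom _ xs => xs
  | Neg g => variables g
  | And g h | Or g h | Imp g h | Iff g h => variables g ++ variables h
  | Ex x g | All x g => x :: variables g
  end.

Definition FL (m : nat) (S : signature) (f : formula S) : Prop :=
  (exists k, fluted k f) /\ size (undup (variables f)) <= m.

(* The number of symbols: every occurrence of a predicate, variable, connective
   or quantifier counts 1; no punctuation is needed in prefix notation. *)
Fixpoint fsize (S : signature) (f : formula S) : nat :=
  match f with
  | Bot | Top => 1
  | Atom P _ => (arity P).+1
  | Neg g => (fsize g).+1
  | And g h | Or g h | Imp g h | Iff g h => (fsize g + fsize h).+1
  | Ex _ g | All _ g => (fsize g).+2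
  end.

Definition structure (S : signature) (D : Type) : Type :=
  forall P : predicate S, (arity P).-tuple D -> Prop.

Definition trans_interp (S : signature) (D : Type) (A : structure S D) : Prop :=
  forall x y z : D,
    A Trans [tuple x; y] -> A Trans [tuple y; z] -> A Trans [tuple x; z].

Definition update (D : Type) (v : nat -> D) (x : nat) (d : D) : nat -> D :=
  fun y => if y == x then d else v y.

Fixpoint holds (S : signature) (D : Type) (A : structure S D) (v : nat -> D)
    (f : formula S) : Prop :=
  match f with
  | Bot => False
  | Top => True
  | Atom P xs => A P (map_tuple v xs)
  | Neg g => ~ holds A v g
  | And g h => holds A v g /\ holds A v h
  | Or g h => holds A v g \/ holds A v h
  | Imp g h => holds A v g -> holds A v h
  | Iff g h => holds A v g <-> holds A v h
  | Ex x g => exists d : D, holds A (update v x d) g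
  | All x g => forall d : D, holds A (update v x d) g
  end.

(* Free variables are interpreted by the assignment [v], whose existence also
   forces the domain to be nonempty. *)
Definition has_model_on (S : signature) (f : formula S) (D : Type) : Prop :=
  exists (A : structure S D) (v : nat -> D), trans_interp A /\ holds A v f.

Definition satisfiable (S : signature) (f : formula S) : Prop :=
  exists D : Type, has_model_on f D.

Definition has_model_of_size_le (S : signature) (f : formula S) (N : nat) : Prop :=
  exists D : finType, #|D| <= N /\ has_model_on f D.

(* A k-tuply exponential function of n is [tower k] of a polynomial in n. *)
Definition tower (k n : nat) : nat := iter k (fun a => 2 ^ a) n.

Inductive move := MoveL | Stay | MoveR.

(* Tape symbols: [None] is the blank, [inl] the input and [inr] the auxiliary
   alphabet.  A tape that is infinite in both directions is stored as (cells to
   the left of the head, nearest first; scanned cell; cells to its right); all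
   cells that are not stored are blank. *)
Definition tape_sym (X W : Type) : Type := option (X + W).
Definition tape (X W : Type) : Type :=
  (seq (tape_sym X W) * tape_sym X W * seq (tape_sym X W))%type.

Definition pop (X W : Type) (s : seq (tape_sym X W)) :=
  if s is a :: s' then (a, s') else (None, [::]).

Definition act (X W : Type) (a : tape_sym X W * move) (t : tape X W) : tape X W :=
  let: (l, _, r) := t in let: (b, d) := a in
  match d with
  | MoveL => let: (c, l') := pop l in (l', c, b :: r)
  | Stay => (l, b, r)
  | MoveR => let: (c, r') := pop r in (b :: l, c, r')
  end.

Definition input_tape (X W : Type) (w : seq X) : tape X W :=
  let: (c, r) := pop [seq Some (inl x) | x <- w] in ([::], c, r).

(* [delta q s q' a]: in state [q], scanning the symbols [s], the machine may go
   to state [q'], acting (write, then move) on the tapes according to [a]. *)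
Record ntm (X : finType) := NTM {
  state : finType;
  aux : finType;
  ntapes : nat;
  start : state;
  accepting : pred state;
  delta : state -> (ntapes.+1).-tuple (tape_sym X aux) ->
          state -> (ntapes.+1).-tuple (tape_sym X aux * move) -> bool }.

Record config (X : finType) (M : ntm X) := Config {
  cstate : state M;
  ctapes : ((ntapes M).+1).-tuple (tape X (aux M)) }.

Definition init (X : finType) (M : ntm X) (w : seq X) : config M :=
  Config (start M)
    [tuple input_tape (aux M) (if i == ord0 then w else [::])
      | i < (ntapes M).+1].

Definition step (X : finType) (M : ntm X) (c c' : config M) : Prop :=
  exists a : ((ntapes M).+1).-tuple (tape_sym X (aux M) * move),
    delta (cstate c) (map_tuple (fun t => t.1.2) (ctapes c)) (cstate c') a /\
    ctapes c' =
      [tuple act (tnth a i) (tnth (ctapes c) i) | i < (ntapes M).+1].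

Fixpoint reach (X : finType) (M : ntm X) (n : nat) (c c' : config M) : Prop :=
  if n is n'.+1 then exists2 d, step c d & reach n' d c' else c = c'.

Definition halted (X : finType) (M : ntm X) (c : config M) : Prop :=
  forall d, ~ step c d.

(* Every computation path halts within the time bound, and a word is accepted
   iff some path halts in an accepting state. *)
Definition decides_in_time (X : finType) (M : ntm X) (L : seq X -> Prop)
    (T : nat -> nat) : Prop :=
  forall w : seq X,
    (forall n c, reach n (init M w) c -> n <= T (size w)) /\
    (L w <-> exists n c,
        [/\ reach n (init M w) c, halted c & accepting (cstate c)]).

Definition NTIME (X : finType) (T : nat -> nat) (L : seq X -> Prop) : Prop :=
  exists M : ntm X, decides_in_time M L T.

Definition in_kNExpTime (X : finType) (k : nat) (L : seq X -> Prop) : Prop :=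
  exists p : {poly nat}, NTIME (fun n => tower k p.[n]%R) L.

(* The predicate (i, k) is the i-th ordinary predicate of arity k. *)
Definition std_sig : signature := @Signature (nat * nat) snd.

Inductive token :=
| tBot | tTop | tNeg | tAnd | tOr | tImp | tIff | tEx | tAll
| tTrans | tRel | tVar | tBit of bool.

Definition tokens : seq token :=
  [:: tBot; tTop; tNeg; tAnd; tOr; tImp; tIff; tEx; tAll; tTrans; tRel; tVar;
      tBit false; tBit true].

Definition token_code (t : token) : nat :=
  match t with
  | tBot => 0 | tTop => 1 | tNeg => 2 | tAnd => 3 | tOr => 4 | tImp => 5
  | tIff => 6 | tEx => 7 | tAll => 8 | tTrans => 9 | tRel => 10 | tVar => 11
  | tBit b => 12 + b
  end.

Fact token_codeK : pcancel token_code (onth tokens).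
Proof. by case=> // -[]. Qed.

HB.instance Definition _ := Countable.copy token (pcan_type token_codeK).

Fact tokens_enumP : Finite.axiom tokens.
Proof. by case=> // -[]. Qed.

HB.instance Definition _ := isFinite.Build token tokens_enumP.

Fixpoint pos_bits (p : positive) : seq bool :=
  match p with
  | xH => [:: true]
  | xO q => false :: pos_bits q
  | xI q => true :: pos_bits q
  end.

(* Binary notation, least significant bit first; 0 is the empty word. *)
Definition bits (n : nat) : seq token :=
  map tBit (if bin_of_nat n is Npos p then pos_bits p else [::]).

Definition enc_var (x : nat) : seq token := tVar :: bits x.

(* Prefix notation.  The arity of an ordinary predicate can be read off from the
   number of variables following it. *)
Definition enc_pred (P : predicate std_sig) : seq token :=
  if P is Rel R then tRel :: bits R.1 else [:: tTrans].

Fixpoint encode (f : formula std_sig) : seq token :=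
  match f with
  | Bot => [:: tBot]
  | Top => [:: tTop]
  | Atom P xs => enc_pred P ++ flatten (map enc_var xs)
  | Neg g => tNeg :: encode g
  | And g h => tAnd :: encode g ++ encode h
  | Or g h => tOr :: encode g ++ encode h
  | Imp g h => tImp :: encode g ++ encode h
  | Iff g h => tIff :: encode g ++ encode h
  | Ex x g => tEx :: enc_var x ++ encode g
  | All x g => tAll :: enc_var x ++ encode g
  end.

(* The satisfiability problem for the m-variable fluted fragment with one
   transitive relation, as a language; words that encode no such formula are
   not in it. *)
Definition FL1T_sat (m : nat) (w : seq token) : Prop :=
  exists f : formula std_sig, [/\ FL m f, satisfiable f & w = encode f].

(* Main.v *)
(** Finite models.  Number the classes of tuples that agree on all formulas of the
    remaining quantifier depth (their fluted types); there are tower_m(poly) of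
    them.  Since an atom only sees a final segment of the tuple, a finite model
    can be assembled by choosing for each tuple over the new domain, by recursion
    on its length, a representative tuple in the given model that extends the
    representative of its initial segment and has the type of the representative
    of its final segment; indexing elements by preferred types realizes all
    witnesses.  Only pairs interact with transitivity.  For them, merge the
    elements of the same 1-type that also have predecessors of the same colours,
    close the relation transitively, and take two copies: inside a copy the closed
    relation holds, across copies only what is forced, namely what lies above an
    element of a colour all of whose elements are successors.  Successors are
    then found inside a copy and non-successors in the other one.

    Decidability.  The bound leaves one exponential to spare, so that a subset of
    a set of size polynomial in that of the model is a number below the time
    bound V.  "The input encodes a formula true in some finite model" becomes a
    fixed formula of arithmetic with all quantifiers bounded by V, which a
    deterministic machine with unary registers evaluates by exhaustive search in
    time polynomial in V. *)

Require Import Defs.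
From mathcomp Require Import all_boot all_order all_algebra.
From mathcomp Require Import boolp zify.
From Stdlib Require Import Relation_Operators ClassicalEpsilon.

Set Implicit Arguments.
Unset Strict Implicit.
Unset Printing Implicit Defensive.

(** * Transitive quotients *)

(** A fluted 1-type only speaks of pairs with its element in first place: it fixes the colours of
    successors and of non-successors, and is silent about predecessors. That asymmetry is the
    obstacle, because the transitive closure after merging may turn a required non-successor into a
    successor. Once merging also respects predecessor colours, a closed edge from [d] to [b] yields
    an actual predecessor of [b] with the colour of [d]. If that colour is forced at [a], this
    predecessor lies above [a], and the original transitivity relates [a] to [b]; so edges that
    start from forced colours never hit a non-successor. In the recursive choice of representatives,
    one new element must serve as last entry of tuples of every length. It therefore carries one
    preferred type for each quantifier depth. Tuples of different lengths consult different depths,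
    so the preferences can be set independently of each other. They are followed only among choices
    that agree with the representative of the final segment, hence they cannot disturb the truth
    values of atoms. *)

Section TransitiveQuotient.

Variables (A X Q : Type) (t : A -> A -> Prop) (r : A -> Q) (e : A -> X).
Hypothesis t_tr : forall x y z, t x y -> t y z -> t x z.
Hypothesis e_color : forall a a', e a = e a' -> r a = r a'.
Hypothesis e_succ : forall a a' b, e a = e a' -> t a b ->
  exists2 b', t a' b' & r b' = r b.
Hypothesis e_nonsucc : forall a a' b, e a = e a' -> ~ t a b ->
  exists2 b', ~ t a' b' & r b' = r b.
Hypothesis e_pred : forall a a' b, e a = e a' -> t b a ->
  exists2 b', t b' a' & r b' = r b.

(* The elements of equal [e] are merged; [tq] is the transitive closure of the
   image of [t]. *)
Definition tq1 a b := exists a' b', [/\ e a' = e a, e b' = e b & t a' b'].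
Definition tq := clos_trans A tq1.

Lemma tq1_of a b c : t a b -> e c = e b -> tq1 a c.
Proof. by move=> tab ec; exists a, b; split. Qed.

Lemma tq_trans a b c : tq a b -> tq b c -> tq a c.
Proof. exact: t_trans. Qed.

Lemma tq_eql a a' b : e a = e a' -> tq a b -> tq a' b.
Proof.
move=> eaa ab; elim: ab a' eaa => {a b} [a b [x [y [ex ey xy]]]|a b c ab IH bc _] a' eaa.
  by apply: t_step; exists x, y; split; rewrite // ex.
by apply: tq_trans (IH _ eaa) bc.
Qed.

Lemma tq_eqr a b b' : e b = e b' -> tq a b -> tq a b'.
Proof.
move=> ebb ab; elim: ab b' ebb => {a b} [a b [x [y [ex ey xy]]]|a b c ab _ bc IH] b' ebb.
  by apply: t_step; exists x, y; split; rewrite // ey.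
by apply: tq_trans ab (IH _ ebb).
Qed.

(** Merging is bridged by [e_succ], original edges compose by [t_tr]. The second conjunct is the
    induction invariant: it pulls the successor found at the middle element back to [a]. *)
Lemma tq_succ a b : tq a b ->
  (exists2 b', t a b' & r b' = r b) /\
  (forall c, t b c -> exists2 c', t a c' & r c' = r c).
Proof.
elim=> {a b} [a b [x [y [ex ey xy]]]|a b c _ [IH1 IH2] _ [IH3 IH4]].
  split=> [|c tbc].
    by have [b' ? rb] := e_succ ex xy; exists b'; rewrite // rb (e_color ey).
  have [c' tyc <-] := e_succ (esym ey) tbc.
  by have [c'' ? <-] := e_succ ex (t_tr xy tyc); exists c''.
split=> [|d /IH4[d' /IH2[d'' ? <-] <-]]; last by exists d''.
by have [c' /IH2[c'' ? <-] <-] := IH3; exists c''.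
Qed.

(** The mirror image of [tq_succ], and the one place that calls on [e_pred]: the reason for
    recording predecessor colours when merging. *)
Lemma tq_pred a b : tq a b ->
  (exists2 a', t a' b & r a' = r a) /\
  (forall c, t c a -> exists2 c', t c' b & r c' = r c).
Proof.
elim=> {a b} [a b [x [y [ex ey xy]]]|a b c _ [IH1 IH2] _ [IH3 IH4]].
  split=> [|c tca].
    by have [b' ? rb] := e_pred ey xy; exists b'; rewrite // rb (e_color ex).
  have [c' tcx <-] := e_pred (esym ex) tca.
  by have [c'' ? <-] := e_pred ey (t_tr tcx xy); exists c''.
split=> [|d /IH2[d' /IH4[d'' ? <-] <-]]; last by exists d''.
by have [c' /IH4[c'' ? <-] <-] := IH1; exists c''.
Qed.

(** Non-successors travel forwards: if [t x y], every successor of [y] is one of [x].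
    Contrapositively, forced colours travel backwards, as [tq_cross_l] requires. *)
Lemma tq_nonsucc a b c : tq a b -> ~ t a c -> exists2 c', ~ t b c' & r c' = r c.
Proof.
move=> ab; elim: ab c => {a b} [a b [x [y [ex ey xy]]]|a b c _ IH1 _ IH2] d nad.
  have [c1 nxc <-] := e_nonsucc (esym ex) nad.
  have nyc: ~ t y c1 by move=> /(t_tr xy).
  by have [c2 ? <-] := e_nonsucc ey nyc; exists c2.
by have [d1 /IH2[d2 ? <-] <-] := IH1 _ nad; exists d2.
Qed.

(* The colour of [d] is forced at [a] when every element of that colour is a
   successor of [a]; only forced colours create edges between the two copies. *)
Definition forced a d := forall c, r c = r d -> t a c.
Definition tq_cross a b := exists2 d, forced a d & e d = e b \/ tq d b.

Definition tq_double (p q : A * bool) :=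
  if p.2 == q.2 then tq p.1 q.1 else tq_cross p.1 q.1.

Lemma tq_cross_sub a b : tq_cross a b -> tq a b.
Proof.
case=> d /(_ d erefl) tad ed; have tqad: tq a d.
  by apply: t_step; apply: tq1_of tad _.
by case: ed => [/tq_eqr|/(tq_trans tqad)//]; apply.
Qed.

Lemma tq_cross_r a b c : tq_cross a b -> tq b c -> tq_cross a c.
Proof.
move=> [d Fd [ed|db]] bc; exists d => //; right; last exact: tq_trans bc.
exact: tq_eql (esym ed) bc.
Qed.

Lemma tq_cross_l a b c : tq a b -> tq_cross b c -> tq_cross a c.
Proof.
move=> ab [d Fd dc]; exists d => // x rx; apply: contrapT => nax.
by have [c' nbc rc] := tq_nonsucc ab nax; apply/nbc/Fd; rewrite rc.
Qed.

Lemma tq_double_trans p q s : tq_double p q -> tq_double q s -> tq_double p s.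
Proof.
case: p q s => [a i] [b j] [c k]; rewrite /tq_double /=.
case: i j k => [] [] [] //=; try exact: tq_trans; try exact: tq_cross_l;
  try exact: tq_cross_r; move=> ? /tq_cross_sub; apply: tq_trans => //; exact: tq_cross_sub.
Qed.

Lemma tq_double_sound p q : tq_double p q -> exists2 b, t p.1 b & r b = r q.1.
Proof.
rewrite /tq_double; case: ifP => _; last move=> /tq_cross_sub.
  by case/tq_succ.
by case/tq_succ.
Qed.

(** Inside a copy [q.1] itself is a non-successor, since [tq] contains [t]. Across copies the colour
    of [q.1] is not forced (take [d := q.1] in [tq_cross]), so some element of that colour is a
    non-successor. *)
Lemma tq_double_soundN p q : ~ tq_double p q -> exists2 b, ~ t p.1 b & r b = r q.1.
Proof.
rewrite /tq_double; case: ifP => _ npq.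
  by exists q.1 => // pq; apply/npq/t_step/(tq1_of pq).
apply: contrapT => nex; apply: npq; exists q.1; last by left.
by move=> c rc; apply: contrapT => npc; apply: nex; exists c.
Qed.

Lemma tq_double_complete a b i : t a b ->
  exists j, forall b', e b' = e b -> tq_double (a, i) (b', j).
Proof.
by move=> tab; exists i => b' eb; rewrite /tq_double eqxx; apply/t_step/(tq1_of tab).
Qed.

(** The witness is placed in the other copy. A cross edge would start from a forced [d]; by
    [tq_pred] an actual predecessor of [b] has the colour of [d], so it is a successor of [a], and
    [t a b] would follow. *)
Lemma tq_double_completeN a b i : ~ t a b ->
  exists j, forall b', e b' = e b -> ~ tq_double (a, i) (b', j).
Proof.
move=> nab; exists (~~ i) => b' eb; rewrite /tq_double /=.
case: ifP => [|_ [d Fd]]; first by case: (i).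
case=> [ed|/(tq_eqr eb)/tq_pred[[d' td rd] _]].
  by apply/nab/Fd/e_color; rewrite ed.
by apply/nab/(t_tr (Fd _ rd)).
Qed.

End TransitiveQuotient.

(** * Fluted types *)

(** Variable names are forgotten: in a fluted formula an atom is determined by how many of the
    latest values it reads. Values are stored latest first, so a quantifier conses and an atom takes
    a prefix; it is false if the list is too short. *)
Fixpoint hs (S : signature) (D : Type) (A : structure S D) (s : seq D)
    (f : formula S) : Prop :=
  match f with
  | Bot => False
  | Top => True
  | Atom P _ => exists2 x, val x = rev (take (arity P) s) & A P x
  | Neg g => ~ hs A s g
  | And g h => hs A s g /\ hs A s h
  | Or g h => hs A s g \/ hs A s h
  | Imp g h => hs A s g -> hs A s h
  | Iff g h => hs A s g <-> hs A s h
  | Ex _ g => exists d, hs A (d :: s) g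
  | All _ g => forall d, hs A (d :: s) g
  end.

Fixpoint qdepth (S : signature) (f : formula S) : nat :=
  match f with
  | Bot | Top | Atom _ _ => 0
  | Neg g => qdepth g
  | And g h | Or g h | Imp g h | Iff g h => maxn (qdepth g) (qdepth h)
  | Ex _ g | All _ g => (qdepth g).+1
  end.

Fixpoint preds (S : signature) (f : formula S) : seq (predicate S) :=
  match f with
  | Bot | Top => [::]
  | Atom P _ => [:: P]
  | Neg g => preds g
  | And g h | Or g h | Imp g h | Iff g h => preds g ++ preds h
  | Ex _ g | All _ g => preds g
  end.

Definition AL (S : signature) (D : Type) (A : structure S D) P (l : seq D) :=
  exists2 x, val x = l & A P x.

Section FlutedTypes.

Variables (S : signature) (D : Type) (A : structure S D) (L : seq (predicate S)).

Local Notation p := (size L).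

(** The codes depend only on the number of predicates, so they can be counted without asking which
    types are realized. *)
Fixpoint ty (q d : nat) : finType :=
  if d is d'.+1 then ({ffun 'I_q -> bool} * {set ty q d'} : finType)%type
  else {ffun 'I_q -> bool}.

Definition atoms (s : seq D) : {ffun 'I_p -> bool} :=
  [ffun i : 'I_p => let P := nth Trans L i in `[< AL A P (rev (take (arity P) s)) >]].

Fixpoint tp (d : nat) (s : seq D) : ty p d :=
  match d with
  | 0 => atoms s
  | d'.+1 => (atoms s, [set c | `[< exists b, tp d' (b :: s) = c >]])
  end.

Lemma tp_atoms d s s' : tp d s = tp d s' -> atoms s = atoms s'.
Proof. by case: d => //= d []. Qed.

Lemma tp_succ d s s' b : tp d.+1 s = tp d.+1 s' ->
  exists b', tp d (b' :: s') = tp d (b :: s).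
Proof.
case=> _ /setP/(_ (tp d (b :: s))); rewrite !inE => eqs.
by apply/asboolP; rewrite -eqs; apply/asboolP; exists b.
Qed.

Lemma tp_eqS d s s' : atoms s = atoms s' ->
  (forall b, exists b', tp d (b' :: s') = tp d (b :: s)) ->
  (forall b, exists b', tp d (b' :: s) = tp d (b :: s')) ->
  tp d.+1 s = tp d.+1 s'.
Proof.
move=> eqa H1 H2 /=; rewrite eqa; congr pair; apply/setP=> c; rewrite !inE.
apply/asboolP/asboolP => -[b <-]; [exact: H1 | exact: H2].
Qed.

Lemma tp_dec d s s' : tp d.+1 s = tp d.+1 s' -> tp d s = tp d s'.
Proof.
elim: d s s' => [|d IH] s s' eqs; first exact: tp_atoms eqs.
apply: tp_eqS => [|b|b]; first exact: tp_atoms eqs.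
  by have [b' /IH ?] := tp_succ b eqs; exists b'.
by have [b' /IH ?] := tp_succ b (esym eqs); exists b'.
Qed.

Lemma tp_leq d d' s s' : d <= d' -> tp d' s = tp d' s' -> tp d s = tp d s'.
Proof.
move=> /subnK <-; elim: (d' - d) => [//|n IH]; rewrite addSn.
by move=> /tp_dec.
Qed.

Lemma AL_size P l : AL A P l -> size l = arity P.
Proof. by case=> x <- _; rewrite size_tuple. Qed.

Lemma atoms_AL i s s' : i < p -> atoms s = atoms s' -> let P := nth Trans L i in
  AL A P (rev (take (arity P) s)) <-> AL A P (rev (take (arity P) s')).
Proof.
move=> lip /ffunP/(_ (Ordinal lip)); rewrite !ffunE /=.
exact: asbool_eq_equiv.
Qed.

(** Shortening costs no depth: an extension of a final segment is itself the final segment, one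
    longer, of an extension of the whole tuple. Atoms too long for the segment are false on both
    sides. *)
Lemma tp_take d j s s' : tp d s = tp d s' -> tp d (take j s) = tp d (take j s').
Proof.
elim: d j s s' => [|d IH] j s s' eqs.
  rewrite /=; apply/ffunP=> i; rewrite !ffunE /=.
  set P := nth _ _ _; apply/asbool_equiv_eq; case: (leqP (arity P) j) => lej.
    by rewrite !take_takel //; exact: (atoms_AL _ (tp_atoms eqs)).
  by split=> /AL_size; rewrite size_rev !size_take_min => ?; exfalso; lia.
apply: tp_eqS => [|b|b].
- exact: tp_atoms (IH j _ _ (tp_dec eqs)).
- have [b' /(IH j.+1) ?] := tp_succ b eqs; by exists b'.
- have [b' /(IH j.+1) ?] := tp_succ b (esym eqs); by exists b'.
Qed.

(** [List.In] is used because the symbols of a signature carry no decidable equality. *)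
Definition covers (f : formula S) :=
  forall P, List.In P (preds f) -> exists2 i, i < p & nth Trans L i = P.

Lemma hs_tp f d s s' : covers f -> qdepth f <= d -> tp d s = tp d s' ->
  hs A s f <-> hs A s' f.
Proof.
elim: f d s s' => [|| P xs | g IHg
  | g IHg h IHh | g IHg h IHh | g IHg h IHh | g IHg h IHh | x g IHg | x g IHg]
  d s s' cov //= led eqs.
- have [i lip <-] := cov P (or_introl erefl).
  exact: (atoms_AL lip (tp_atoms eqs)).
- by have := IHg _ _ _ cov led eqs; tauto.
1-4: have {}IHg := IHg d s s' (fun P i => cov P (List.in_or_app _ _ _ (or_introl i)))
       _ eqs; have {}IHh := IHh d s s' (fun P i => cov P (List.in_or_app _ _ _ (or_intror i)))
       _ eqs; have ? := IHg ltac:(lia); have ? := IHh ltac:(lia); tauto.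
- case: d led eqs => [//|d] led eqs; split=> -[b hb].
    have [b' /(IHg _ _ _ cov led) e] := tp_succ b eqs; by exists b'; apply/e.
  have [b' /(IHg _ _ _ cov led) e] := tp_succ b (esym eqs); by exists b'; apply/e.
- case: d led eqs => [//|d] led eqs; split=> hb b.
    have [b' /(IHg _ _ _ cov led) e] := tp_succ b (esym eqs); by apply/e.
  have [b' /(IHg _ _ _ cov led) e] := tp_succ b eqs; by apply/e.
Qed.

End FlutedTypes.

(** * Representatives *)

Section Representatives.

Variables (S : signature) (D : Type) (A : structure S D) (L : seq (predicate S)).
Variables (m0 : nat) (U B : Type) (base : B -> U) (kap : U -> D).
Variables (u : U -> U -> Prop) (pref : B -> nat -> nat) (M : nat).

Local Notation m := m0.+2.
Local Notation tp := (tp A L).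

(** A tuple of length [n] is controlled up to depth [m - n]. The relation [u] stands in for [Trans]
    between base elements and has to agree with it only up to the type of depth [m0] of the second
    element. *)
Hypothesis tp_kap : forall e, exists x, tp m0.+1 [:: kap x] = tp m0.+1 [:: e].
Hypothesis u_sound : forall x y, exists e,
  tp m0 [:: e] = tp m0 [:: kap y] /\ (AL A Trans [:: kap x; e] <-> u x y).
Hypothesis u_complete : forall x e, exists y,
  tp m0 [:: kap y] = tp m0 [:: e] /\ (u x y <-> AL A Trans [:: kap x; e]).
Hypothesis pref_onto : forall x (c : nat -> nat), (forall i, c i < M) ->
  exists b, base b = x /\ forall i, i < m -> pref b i = c i.
Hypothesis M_big : forall d, d < m -> #|ty (size L) d| <= M.

Definition rank d s : nat := enum_rank (tp d s).

Lemma rank_inj d s s' : rank d s = rank d s' -> tp d s = tp d s'.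
Proof. by move=> /val_inj/enum_rank_inj. Qed.

(** Since lists are reversed, [take n.-1 r1] drops the first entry of the tuple: the extended final
    segment is compared with its own representative [r2]. The second clause concerns pairs only and
    makes their edges follow [u]. *)
Definition fits n b s (r1 r2 : seq D) e :=
  tp (m - n.+1) (e :: take n.-1 r1) = tp (m - n.+1) r2 /\
  forall b1, s = [:: b1] ->
    AL A Trans [:: kap (base b1); e] <-> u (base b1) (base b).

Definition preferred n b r1 e := rank (m - n.+1) (e :: r1) = pref b (m - n.+1).

Definition extend n b s r1 r2 : D :=
  if n is 0 then kap (base b) else
  epsilon (inhabits (kap (base b))) (fun e => fits n b s r1 r2 e /\
    ((exists2 e', fits n b s r1 r2 e' & preferred n b r1 e') -> preferred n b r1 e)).

(* Lists are stored last element first: [rho n s] represents the tuple [s] of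
   length [n] by a tuple of the given structure, extending the representative
   of the initial segment so as to agree with that of the final segment. *)
Fixpoint rho n (s : seq B) : seq D :=
  if n is n'.+1 then
    if s is b :: s' then
      extend n' b s' (rho n' s') (rho n' (b :: take n'.-1 s')) :: rho n' s'
    else [::]
  else [::].

Lemma size_rho n s : size s = n -> size (rho n s) = n.
Proof. by elim: n s => [//|n IH] [//|b s] /= [/IH ->]. Qed.

Definition coherent n := forall s, size s = n -> 0 < n ->
  tp (m - n) (take n.-1 (rho n s)) = tp (m - n) (rho n.-1 (take n.-1 s)).

(** A fitting element exists: for [n = 1] by [u_sound]; beyond that, coherence matches the part
    shared by the two segments one level deeper, so [tp_succ] can imitate the last entry of [r2]. *)
Lemma extendP n b s : 0 < n -> n < m -> coherent n -> size s = n ->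
  let r1 := rho n s in let r2 := rho n (b :: take n.-1 s) in
  let e := extend n b s r1 r2 in
  fits n b s r1 r2 e /\
  ((exists2 e', fits n b s r1 r2 e' & preferred n b r1 e') -> preferred n b r1 e).
Proof.
move=> n0 ltnm coh szs r1 r2 /=.
have [e fe]: exists e, fits n b s r1 r2 e.
  case: n n0 ltnm coh szs @r1 @r2 => [//|[|n]] _ ltnm coh szs r1 r2.
    case: s szs @r1 @r2 => [//|b1 [|//]] _ r1 r2.
    have [e [h1 h2]] := u_sound (base b1) (base b).
    exists e; split; first by rewrite /= subn2.
    by move=> b2 [<-].
  have := coh s szs isT; rewrite -/r1 /=.
  rewrite [m - n.+2](_ : _ = (m - n.+3).+1); last by lia.
  move=> /esym eqs; case: s szs @r1 @r2 eqs => [//|b1 s] /= [szs] eqs.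
  have [e he] := tp_succ (extend n.+1 b (b1 :: take n s) (rho n.+1 (b1 :: take n s))
        (rho n.+1 (b :: take n (b1 :: take n s)))) eqs.
  by exists e; split=> [|b2 [_ s0]]; [exact: he | rewrite s0 in szs].
rewrite /extend; case: n n0 {ltnm coh szs} @r1 @r2 fe => [//|n] _ r1 r2 fe.
apply: (epsilon_spec (inhabits _) (fun e => fits n.+1 b s r1 r2 e /\
    ((exists2 e', fits n.+1 b s r1 r2 e' & preferred n.+1 b r1 e') ->
     preferred n.+1 b r1 e))).
case: (pselect (exists2 e', fits n.+1 b s r1 r2 e' & preferred n.+1 b r1 e')).
  by case=> e' h1 h2; exists e'.
by move=> nex; exists e.
Qed.

Lemma coherentP n : n <= m -> coherent n.
Proof.
elim: n => [//|[|n] IH] lenm [//|b s] [szs] _.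
  by [].
have [[fe _] _] := extendP b (ltn0Sn n) lenm (IH (ltnW lenm)) szs.
by move: fe; rewrite [take n.+2.-1 _]/=.
Qed.

Lemma rho_take n j s : size s = n -> n <= m -> j <= n ->
  tp (m - n) (take j (rho n s)) = tp (m - n) (rho j (take j s)).
Proof.
elim: n s => [|n IH] s szs lenm lejn.
  by move: lejn; rewrite leqn0 => /eqP ->.
move: lejn; rewrite leq_eqVlt => /orP[/eqP ->|].
  by rewrite !take_oversize ?size_rho ?szs.
rewrite ltnS => lejn.
rewrite -(take_takel _ lejn) (tp_take _ (coherentP lenm szs isT)) /=.
have sz': size (take n s) = n by rewrite size_take_min szs; lia.
have /(tp_leq (_ : m - n.+1 <= m - n)) := IH _ sz' (ltnW lenm) lejn.
by rewrite take_takel //; apply; lia.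
Qed.

Definition rep_structure : structure S B :=
  fun P x => AL A P (rev (rho (arity P) (rev (val x)))).

(** The atom was evaluated on the representative of its own arguments. By [rho_take] the
    corresponding segment of the longer representative has the same type, hence the same atoms. *)
Lemma rep_AL P n s : size s = n -> n <= m ->
  (exists2 i, i < size L & nth Trans L i = P) ->
  AL rep_structure P (rev (take (arity P) s)) <-> AL A P (rev (take (arity P) (rho n s))).
Proof.
move=> szs lenm [i lip <-]; set P0 := nth _ _ _.
case: (leqP (arity P0) n) => len; last first.
  by split=> /AL_size; rewrite size_rev size_take_min ?size_rho ?szs; lia.
have := atoms_AL lip (tp_atoms (rho_take szs lenm len)); rewrite /= -/P0.
rewrite [take _ (take _ _)]take_oversize; last by rewrite size_take_min size_rho; lia.
rewrite [take _ (rho _ (take _ _))]take_oversize; last first.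
  by rewrite size_rho // size_take_min szs; lia.
move=> ->; split=> [[x ex]|h]; first by rewrite /rep_structure /= ex revK.
have szt: size (rev (take (arity P0) s)) == arity P0.
  by rewrite size_rev size_take_min szs; apply/eqP; lia.
by exists (Tuple szt) => //; rewrite /rep_structure /= revK.
Qed.

Lemma rep_trans b1 b2 :
  @rep_structure Trans [tuple b1; b2] <-> u (base b1) (base b2).
Proof.
have [[_ fe] _] := @extendP 1 b2 [:: b1] isT isT (coherentP (isT : 1 <= m)) erefl.
by have := fe _ erefl.
Qed.

Lemma rank_lt d s : d < m -> rank d s < M.
Proof. by move=> ltdm; apply: leq_trans (ltn_ord _) (M_big ltdm). Qed.

(** The base settles length one and the edge of a pair; after that one preference per length steers
    [extend]. The induction keeps the demands on [b] in the form of a base and of preferences at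
    depths at least [m - n.+1], so the preference for the next length is still free. *)
Lemma rho_onto n s e : size s = n -> n < m -> exists b,
  tp (m - n.+1) (rho n.+1 (b :: s)) = tp (m - n.+1) (e :: rho n s).
Proof.
move=> szs ltnm.
suff [x [c [cM H]]]: exists x c, (forall i, c i < M) /\
    forall b, base b = x -> (forall i, m - n.+1 <= i -> i < m -> pref b i = c i) ->
      tp (m - n.+1) (rho n.+1 (b :: s)) = tp (m - n.+1) (e :: rho n s).
  have [b [bx bc]] := pref_onto x cM; exists b; apply: H => // i _; exact: bc.
elim: n s e szs ltnm => [|n IH] s e szs ltnm.
  have [x hx] := tp_kap e; exists x, (fun=> rank 0 [::]); split.
    by move=> _; apply: rank_lt.
  by move=> b bx _; case: s szs => //= _; rewrite bx.
pose r1 := rho n.+1 s; pose c' := rank (m - n.+2) (e :: r1).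
suff [x [c [cM H]]]: exists x c, (forall i, c i < M) /\
    forall b, base b = x -> (forall i, m - n.+1 <= i -> i < m -> pref b i = c i) ->
      fits n.+1 b s r1 (rho n.+1 (b :: take n s)) e.
  (* The demands collected so far concern depths above [m - n.+2], so this preference can be added
     without affecting them. *)
  exists x, (fun i => if i == m - n.+2 then c' else c i); split=> [i|b bx bc].
    by case: ifP => // _; apply: rank_lt; lia.
  have fe: fits n.+1 b s r1 (rho n.+1 (b :: take n s)) e.
    apply: H => // i h1 h2; rewrite bc; try lia; case: eqP => //; lia.
  have [_ ] := extendP b (ltn0Sn n) ltnm (coherentP (ltnW ltnm)) szs.
  rewrite /preferred bc ?eqxx //; last by lia.
  by move=> pe; apply: rank_inj; apply: pe; exists e.
case: n IH szs ltnm @r1 @c' => [_|n IH] szs ltnm r1 c'.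
  case: s szs @r1 @c' => [//|b1 [|//]] _ r1 c'.
  have [x [h1 h2]] := u_complete (base b1) e.
  exists x, (fun=> rank 0 [::]); split=> [_|b bx _]; first exact: rank_lt.
  by split=> [|b2 [<-]]; rewrite /= ?subn2 bx //= -h2.
have szt: size (take n.+1 s) = n.+1 by rewrite size_take_min szs; lia.
have := coherentP (ltnW ltnm) szs isT; rewrite -/r1 [n.+2.-1]/= => eqs.
have eqm: m - n.+2 = (m - n.+3).+1 by lia.
rewrite eqm in eqs.
(* The induction hypothesis speaks about the representative of the final segment, so the target [e]
   is first moved there by coherence. *)
have [e0 he0] := tp_succ e eqs.
have [x [c [cM H]]] := IH (take n.+1 s) e0 szt (ltnW ltnm).
exists x, c; split=> // b bx bc; split=> [|b2 s2]; last by rewrite s2 in szs.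
have /(tp_leq (_ : m - n.+3 <= m - n.+2)) -> := H b bx bc; first by rewrite he0.
by lia.
Qed.

Lemma hs_rep f n s : covers L f -> size s = n -> n + qdepth f <= m ->
  hs rep_structure s f <-> hs A (rho n s) f.
Proof.
elim: f n s => [|| P xs | g IHg
  | g IHg h IHh | g IHg h IHh | g IHg h IHh | g IHg h IHh | x g IHg | x g IHg]
  n s cov szs //= len.
- by apply: rep_AL szs _ (cov P (or_introl erefl)); lia.
- by have := IHg _ _ cov szs len; tauto.
1-4: have {}IHg := IHg n s (fun P i => cov P (List.in_or_app _ _ _ (or_introl i)))
       szs; have {}IHh := IHh n s (fun P i => cov P (List.in_or_app _ _ _ (or_intror i)))
       szs; have ? := IHg ltac:(lia); have ? := IHh ltac:(lia); tauto.
- rewrite addnS -addSn in len.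
  have ltnm: n < m by lia.
  have covg: covers L g by [].
  have {}IHg b : hs rep_structure (b :: s) g <-> hs A (rho n.+1 (b :: s)) g.
    by apply: IHg => //=; rewrite szs.
  split=> [[b /IHg h]|[e h]]; first by eexists; exact: h.
  have [b hb] := rho_onto e szs ltnm; exists b; apply/IHg.
  by apply/(hs_tp covg _ hb) => //; lia.
- rewrite addnS -addSn in len.
  have ltnm: n < m by lia.
  have covg: covers L g by [].
  have {}IHg b : hs rep_structure (b :: s) g <-> hs A (rho n.+1 (b :: s)) g.
    by apply: IHg => //=; rewrite szs.
  split=> h e; last by apply/IHg/h.
  have [b hb] := rho_onto e szs ltnm.
  by apply/(hs_tp covg _ (esym hb)); [lia | apply/IHg].
Qed.

(** Provides the values of the free variables in the new structure. *)
Lemma rho_list l : size l <= m -> exists2 s, size s = size l &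
  tp (m - size l) (rho (size l) s) = tp (m - size l) l.
Proof.
elim: l => [|e l IH] lem; first by exists [::].
have [s szs] := IH (ltnW lem).
rewrite [m - size l](_ : _ = (m - (size l).+1).+1); last by move: lem => /=; lia.
move=> /esym/(tp_succ e)[e' he']; have [b hb] := rho_onto e' szs lem.
by exists (b :: s); rewrite /= ?szs // -he'.
Qed.

End Representatives.

(** * Small models *)

Section Tower.

Lemma towerS k x : tower k.+1 x = 2 ^ tower k x.
Proof. by []. Qed.

Lemma tower_mono k x y : x <= y -> tower k x <= tower k y.
Proof. by move=> lexy; elim: k => // k IH; rewrite !towerS leq_exp2l. Qed.

Lemma tower_leS k x : tower k x <= tower k.+1 x.
Proof. exact: ltnW (ltn_expl _ _). Qed.

Lemma tower_mono_l j k x : j <= k -> tower j x <= tower k x.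
Proof.
move=> /subnK <-; elim: (k - j) => // n IH; rewrite addSn.
by apply: leq_trans IH (tower_leS _ _).
Qed.

Lemma tower_ge k x : x <= tower k x.
Proof. exact: (tower_mono_l x (leq0n k)). Qed.

Lemma tower_add k x c : tower k x + c <= tower k (x + c).
Proof.
elim: k => // k IH; rewrite !towerS.
apply: leq_trans (_ : 2 ^ (tower k x + c) <= _); last by rewrite leq_exp2l.
rewrite expnD; have := ltn_expl c (ltnSn 1).
have : 0 < 2 ^ tower k x by rewrite expn_gt0.
nia.
Qed.

Lemma tower_mul k x c : 0 < x -> 0 < c -> c * tower k x <= tower k (c * x).
Proof.
move=> x0; case: c => [//|c] _; elim: k => // k IH; rewrite !towerS.
apply: leq_trans (_ : 2 ^ (c.+1 * tower k x) <= _); last by rewrite leq_exp2l.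
have : 0 < tower k x by apply: leq_trans x0 (tower_ge _ _).
case: (tower k x) => [//|y] _.
rewrite [c.+1 * y.+1]mulSn expnD mulnC leq_pmul2l ?expn_gt0 //.
by apply: leq_trans (ltn_expl c (ltnSn 1)) _; rewrite leq_exp2l // leq_pmulr.
Qed.

Lemma tower_exp k x c : 0 < x -> 0 < c -> tower k.+1 x ^ c <= tower k.+1 (c * x).
Proof. by move=> x0 c0; rewrite !towerS -expnM leq_exp2l // mulnC tower_mul. Qed.

End Tower.

(** * Variables of a fluted formula form an interval *)

Section Windows.

Variable S : signature.
Implicit Type f : formula S.

(** At level [k] the interval touches [k] or [k.+1] (the empty one being [lo = k.+1], [hi = k]), so
    the union of two such intervals is again an interval. *)
Lemma fluted_span k f : fluted k f -> exists lo hi,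
  [/\ 0 < lo, lo <= k.+1, k <= hi, {in variables f, forall x, lo <= x <= hi} &
      forall x, lo <= x <= hi -> x \in variables f].
Proof.
have base j : exists lo hi, [/\ 0 < lo, lo <= j.+1, j <= hi,
    {in [::], forall x, lo <= x <= hi} & forall x, lo <= x <= hi -> x \in [::]].
  by exists j.+1, j; split=> // x /andP[h1 h2]; have := leq_trans h1 h2; rewrite ltnn.
have bin j (s1 s2 : seq nat) :
    (exists lo hi, [/\ 0 < lo, lo <= j.+1, j <= hi,
      {in s1, forall x, lo <= x <= hi} & forall x, lo <= x <= hi -> x \in s1]) ->
    (exists lo hi, [/\ 0 < lo, lo <= j.+1, j <= hi,
      {in s2, forall x, lo <= x <= hi} & forall x, lo <= x <= hi -> x \in s2]) ->
    exists lo hi, [/\ 0 < lo, lo <= j.+1, j <= hi,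
      {in s1 ++ s2, forall x, lo <= x <= hi} & forall x, lo <= x <= hi -> x \in s1 ++ s2].
  move=> [l1 [h1 [a1 b1 c1 d1 e1]]] [l2 [h2 [a2 b2 c2 d2 e2]]].
  exists (minn l1 l2), (maxn h1 h2); split; try lia.
    by move=> x; rewrite mem_cat => /orP[/d1|/d2]; lia.
  move=> x hx; rewrite mem_cat; apply/orP.
  have [?|?] : l1 <= x <= h1 \/ l2 <= x <= h2 by lia.
    by left; apply: e1.
  by right; apply: e2.
have quant j (s : seq nat) :
    (exists lo hi, [/\ 0 < lo, lo <= j.+2, j.+1 <= hi,
      {in s, forall x, lo <= x <= hi} & forall x, lo <= x <= hi -> x \in s]) ->
    exists lo hi, [/\ 0 < lo, lo <= j.+1, j <= hi,
      {in j.+1 :: s, forall x, lo <= x <= hi} & forall x, lo <= x <= hi -> x \in j.+1 :: s].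
  move=> [lo [hi [a1 b1 c1 d1 e1]]]; exists (minn lo j.+1), hi; split; try lia.
    by move=> x; rewrite inE => /orP[/eqP ->|/d1]; lia.
  move=> x hx; rewrite inE; case: eqP => //= nx; apply: e1; lia.
elim=> {k f} /=; auto.
move=> k l P xs l0 ->; case: (leqP l k.+1) => lk; last first.
  rewrite (_ : k.+1 - l = 0); [exact: base | lia].
exists l, k; split=> // x; rewrite mem_iota; lia.
Qed.

Lemma fluted_closed k j f : fluted k f -> variables f = [::] -> fluted j f.
Proof.
have cat0 (s1 s2 : seq nat) : s1 ++ s2 = [::] -> s1 = [::] /\ s2 = [::].
  by case: s1 s2 => [|? ?] [].
elim=> {k f} /=; try by move=> *; constructor; auto.
- move=> k l P xs l0 e e0; apply: (@fluted_atom _ _ j.+1) => //.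
  by rewrite subnn /= -e0.
1-4: by move=> k f g _ IHf _ IHg /cat0[/IHf ? /IHg ?]; constructor.
1-2: by [].
Qed.

Definition in_window a b f := all (fun x => a < x <= b) (variables f).

(** An interval with at most [m] elements turns the count of variables into a bound on indices
    relative to [a], whatever the indices themselves are. The last clause ties the level to a
    variable written in the formula, so that the length of the input bounds it. *)
Lemma FL_window m f : FL m f -> exists k a,
  [/\ fluted k f, in_window a (a + m) f, a <= k <= a + m &
      k = 0 \/ k \in variables f \/ k.+1 \in variables f].
Proof.
move=> [[k fl] szm]; have [lo [hi [l0 lok khi vin inv]]] := fluted_span fl.
case: (eqVneq (variables f) [::]) => [v0|vn0].
  (* A formula without variables is fluted at every level, and its given level is not bounded by
     anything; level 0 is chosen. *)
  exists 0, 0; split; [exact: fluted_closed fl v0 | by rewrite /in_window v0 | lia | by left].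
have lohi: lo <= hi.
  by case: (variables f) vn0 vin => [//|x s] _ /(_ x); rewrite mem_head => /(_ isT); lia.
have szv: hi.+1 - lo <= size (undup (variables f)).
  rewrite -(size_iota lo (hi.+1 - lo)); apply: uniq_leq_size (iota_uniq _ _) _ => x.
  by rewrite mem_iota mem_undup => hx; apply: inv; lia.
exists k, lo.-1; split=> //.
- by apply/allP=> x /vin; lia.
- by lia.
right; case: (leqP lo k) => ?; [left|right]; apply: inv; lia.
Qed.

Lemma FL_of_window m k a f : fluted k f -> in_window a (a + m) f -> FL m f.
Proof.
move=> fl /allP win; split; first by exists k.
rewrite -(size_iota a.+1 m); apply: uniq_leq_size (undup_uniq _) _ => x.
by rewrite mem_undup => /win; rewrite mem_iota; lia.
Qed.

Lemma qdepth_window k b f : fluted k f -> all (fun x => x <= b) (variables f) ->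
  k <= b -> k + qdepth f <= b.
Proof.
elim=> {k f} /=; try by move=> *; rewrite ?addn0; auto.
1-4: by move=> k f g _ IHf _ IHg; rewrite all_cat => /andP[/IHf {}IHf /IHg {}IHg] kb;
  have := IHf kb; have := IHg kb; lia.
1-2: by move=> k f _ IHf /andP[kb /IHf /(_ kb)]; lia.
Qed.

End Windows.

Definition recent (D : Type) (v : nat -> D) k j := [seq v (k - i) | i <- iota 0 j].

Lemma recent_update D (v : nat -> D) k j d :
  recent (update v k.+1 d) k.+1 j.+1 = d :: recent v k j.
Proof.
rewrite /recent /= /update subn0 eqxx; congr cons.
rewrite (iotaDl 1 0) -map_comp; apply: eq_map => i /=.
by rewrite add1n subSS; case: eqP => //; lia.
Qed.

Lemma rev_take_recent D (v : nat -> D) k j l : 0 < l -> k.+1 - l <= j ->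
  rev (take (k.+1 - l) (recent v k j)) = map v (iota l (k.+1 - l)).
Proof.
move=> l0 lej; rewrite -map_take take_iota (minn_idPl lej) -map_rev.
case: (leqP l k.+1) => lk; last by rewrite (_ : k.+1 - l = 0) //; lia.
apply: (@eq_from_nth _ (v 0)) => [|i]; first by rewrite !size_map size_rev !size_iota.
rewrite size_map size_rev size_iota => lti.
rewrite !(nth_map 0) ?size_rev ?size_iota // nth_rev ?size_iota //.
by rewrite !nth_iota; try lia; congr v; lia.
Qed.

Lemma holds_hs (S : signature) (D : Type) (A : structure S D) k a f v :
  fluted k f -> all (fun x => a < x) (variables f) -> a <= k ->
  holds A v f <-> hs A (recent v k (k - a)) f.
Proof.
move=> fl; elim: fl v => {k f} /=.
- move=> k l P xs l0 exs v /allP win lak.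
  have szP: k.+1 - l = arity P by rewrite -(size_tuple xs) exs size_iota.
  have lej: k.+1 - l <= k - a.
    case: (posnP (k.+1 - l)) => [->//|pos].
    by have := win l; rewrite exs mem_iota => h; have := h ltac:(lia); lia.
  have -> : rev (take (arity P) (recent v k (k - a))) = map v xs.
    by have := rev_take_recent v l0 lej; rewrite -exs szP.
  split=> [?|[x ex]]; first by exists (map_tuple v xs).
  by rewrite (_ : x = map_tuple v xs) //; apply: val_inj.
- by [].
- by [].
- by move=> k f _ IH v win lak; have := IH v win lak; tauto.
1-4: by move=> k f g _ IHf _ IHg v; rewrite all_cat => /andP[/(IHf v) {}IHf /(IHg v) {}IHg] lak;
  have := IHf lak; have := IHg lak; tauto.
- move=> k f _ IH v /andP[_ win] lak.
  have {}IH d : holds A (update v k.+1 d) f <-> hs A (d :: recent v k (k - a)) f.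
    by rewrite (IH _ win (leqW lak)) subSn // recent_update.
  by split=> -[d /IH]; exists d.
- move=> k f _ IH v /andP[_ win] lak.
  have {}IH d : holds A (update v k.+1 d) f <-> hs A (d :: recent v k (k - a)) f.
    by rewrite (IH _ win (leqW lak)) subSn // recent_update.
  by split=> h d; apply/IH.
Qed.

Lemma recent_onto D (d0 : D) k (s : seq D) : size s <= k ->
  exists v, recent v k (size s) = s.
Proof.
move=> sk; exists (fun x => nth d0 s (k - x)); rewrite /recent.
rewrite -[RHS](mkseq_nth d0); apply/eq_in_map => i; rewrite mem_iota => hi.
by congr nth; lia.
Qed.

(** * Assembling and counting the finite model *)

Section SmallModel.

Variables (S : signature) (D : Type) (A : structure S D) (f : formula S) (m0 : nat).
Hypothesis A_trans : trans_interp A.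
Variable d0 : D.

Local Notation m := m0.+2.
Local Notation L := (Trans :: preds f).
Local Notation p := (size L).
Local Notation tp := (tp A L).

Definition related (a b : D) := AL A Trans [:: a; b].

Lemma relatedE a b : related a b <-> @A Trans [tuple a; b].
Proof.
split=> [[x ex]|h]; last by exists [tuple a; b].
by rewrite (_ : x = [tuple a; b]) //; apply: val_inj.
Qed.

Lemma related_trans a b c : related a b -> related b c -> related a c.
Proof. by rewrite !relatedE; apply: A_trans. Qed.

Definition color a := tp m0 [:: a].
Definition extype a := (tp m0.+1 [:: a],
  [set c | `[< exists2 b, related b a & color b = c >]]).

Lemma related_tp d a b a' b' : tp d [:: b; a] = tp d [:: b'; a'] ->
  related a b <-> related a' b'.
Proof. by move/tp_atoms => e; have := @atoms_AL _ _ A L 0 _ _ isT e. Qed.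

Lemma extype_color a a' : extype a = extype a' -> color a = color a'.
Proof. by move/(congr1 fst)/tp_dec. Qed.

Lemma extype_step a a' b : extype a = extype a' ->
  exists b', (related a b <-> related a' b') /\ color b' = color b.
Proof.
move/(congr1 fst)/(tp_succ b) => [b' eb]; exists b'; split; first exact: related_tp (esym eb).
exact: (tp_take 1 eb).
Qed.

Lemma extype_pred a a' b : extype a = extype a' -> related b a ->
  exists2 b', related b' a' & color b' = color b.
Proof.
move/(congr1 snd)/setP/(_ (color b)); rewrite !inE => eqs hb; apply/asboolP.
by rewrite -eqs; apply/asboolP; exists b.
Qed.

Local Notation X := (ty p m0.+1 * {set ty p m0})%type.
Local Notation M := (tower m (m * p)).

(** One more level turns a count [x] into [2 ^ (q + x)], and [tower_add] moves the summand [q] to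
    the bottom of the tower. *)
Lemma card_ty q d : #|ty q d| <= tower d.+1 (d.+1 * q).
Proof.
elim: d => [|d IH]; first by rewrite /= card_ffun card_bool card_ord mul1n.
rewrite [ty _ _]/= card_prod card_ffun card_bool card_ord -cardsT -powersetT card_powerset.
rewrite cardsT -expnD [tower _ _]/= leq_exp2l // mulSn addnC [q + _]addnC.
by apply: leq_trans (tower_add d.+1 _ _); rewrite leq_add2r.
Qed.

Lemma card_ty_m d : d < m -> #|ty p d| <= M.
Proof.
move=> ltdm; apply: leq_trans (card_ty _ _) _.
apply: leq_trans (tower_mono_l _ ltdm); apply: tower_mono.
by rewrite leq_mul2r ltdm orbT.
Qed.

Lemma M_gt1 : 1 < M.
Proof.
rewrite [M]/=; apply: leq_trans (ltn_expl _ (ltnSn 1)).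
by rewrite ltnS expn_gt0.
Qed.

(** The factor [m + 3]: the two components of an extended type have at most [M] values each, the
    copy bit at most [M], and the preferences [M ^ m]. *)
Lemma small_model_hs s : size s + qdepth f <= m -> hs A s f ->
  exists (B : finType) (_ : B) (C : structure S B) (s' : seq B),
    [/\ #|B| <= tower m ((m + 3) * (m * p)), trans_interp C, size s' = size s & hs C s' f].
Proof.
move=> szs hsf; have lem: size s <= m by lia.
(* Unrealized codes become elements as well; they stand for an arbitrary element of [D]. *)
pose kap (x : X * bool) := epsilon (inhabits d0) (fun a => extype a = x.1).
have kapE a i : extype (kap (extype a, i)) = extype a.
  by apply: (epsilon_spec (inhabits d0) (fun b => extype b = extype a)); exists a.
pose u (x y : X * bool) := tq_double related color extype (kap x, x.2) (kap y, y.2).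
pose B : finType := ((X * bool) * {ffun 'I_m -> 'I_M})%type.
pose base (b : B) := b.1; pose pref (b : B) i : nat := b.2 (inord i).
have e_nonsucc a a' b : extype a = extype a' -> ~ related a b ->
    exists2 b', ~ related a' b' & color b' = color b.
  by move=> /(extype_step b)[b' [h ?]] nab; exists b' => //; rewrite -h.
have e_succ a a' b : extype a = extype a' -> related a b ->
    exists2 b', related a' b' & color b' = color b.
  by move=> /(extype_step b)[b' [h ?]] nab; exists b' => //; rewrite -h.
have tp_kap e : exists x, tp m0.+1 [:: kap x] = tp m0.+1 [:: e].
  by exists (extype e, true); apply: (congr1 fst (kapE e true)).
have u_sound x y : exists e,
    tp m0 [:: e] = tp m0 [:: kap y] /\ (AL A Trans [:: kap x; e] <-> u x y).
  case: (pselect (u x y)) => uxy.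
    have [b hb cb] := tq_double_sound related_trans extype_color e_succ uxy.
    by exists b; split.
  have [b hb cb] := tq_double_soundN uxy.
  by exists b; split.
have u_complete x e : exists y,
    tp m0 [:: kap y] = tp m0 [:: e] /\ (u x y <-> AL A Trans [:: kap x; e]).
  case: (pselect (related (kap x) e)) => rxe.
    have [j hj] := tq_double_complete color extype x.2 rxe.
    exists (extype e, j); split; first exact: (extype_color (kapE e j)).
    by split=> // _; apply: hj; rewrite kapE.
  have [j hj] := tq_double_completeN related_trans extype_color extype_pred x.2 rxe.
  exists (extype e, j); split; first exact: (extype_color (kapE e j)).
  by split=> // h; exfalso; move: h; apply: hj; rewrite kapE.
have pref_onto x (c : nat -> nat) : (forall i, c i < M) ->
    exists b, base b = x /\ forall i, i < m -> pref b i = c i.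
  move=> cM; exists (x, [ffun i : 'I_m => Ordinal (cM i)]); split=> // i lti.
  by rewrite /pref ffunE /= inordK.
have covf: covers L f.
  move=> P /(@List.In_nth _ _ _ Trans)[i [lti ei]]; exists i.+1.
    by rewrite /= ltnS; apply/ltP.
  by rewrite /= -ei; elim: (preds f) i {lti ei} => [|Q l IH] [|i] //=.
have [s' szs' hs'] := rho_list tp_kap u_sound u_complete pref_onto card_ty_m lem.
have [b0 _] := pref_onto (extype d0, true) (fun=> 0) (fun=> ltnW M_gt1).
exists B, b0, (rep_structure A L m0 base kap u pref), s'; split.
- have cardB (T1 T2 T3 : finType) x y : #|T1| <= x -> #|T2| <= x -> #|T3| <= y ->
      #|{: (T1 * T2) * bool * T3}| <= x * x * 2 * y.
    by move=> h1 h2 h3; rewrite !card_prod card_bool !leq_mul.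
  have l1 : #|ty p m0.+1| <= M by exact: card_ty_m.
  have l2 : #|{set ty p m0}| <= M.
    apply: leq_trans l1; rewrite [X in _ <= X]card_prod.
    by rewrite leq_pmull // card_ffun expn_gt0 card_bool.
  have l3 : #|{ffun 'I_m -> 'I_M}| <= M ^ m by rewrite card_ffun !card_ord.
  apply: leq_trans (cardB _ _ _ _ _ l1 l2 l3) _.
  apply: leq_trans (tower_exp _ _ _); rewrite ?muln_gt0 //.
  by rewrite mulnC expnD leq_mul // !expnS expn0 muln1 mulnA leq_mul // M_gt1.
- move=> x y z; rewrite !rep_trans.
  exact: (tq_double_trans related_trans e_nonsucc).
1-4: by [].
- have H := hs_rep tp_kap u_sound u_complete pref_onto card_ty_m covf szs' szs.
  apply/H.
  by apply/(hs_tp covf _ hs') => //; lia.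
Qed.

End SmallModel.

Lemma size_preds (S : signature) (f : formula S) : size (preds f) <= fsize f.
Proof. by elim: f => //= *; rewrite ?size_cat; lia. Qed.

Lemma small_model m (S : signature) (f : formula S) : 2 <= m ->
  FL m f -> satisfiable f ->
  has_model_of_size_le f (tower m ((m + 3) * m * (fsize f).+1)).
Proof.
case: m => [|[|m0]] // _ /FL_window[k [a [fl win ak _]]] [D [A [v [trA hv]]]].
have wina: all (fun x => a < x) (variables f).
  by apply: sub_all win => x /andP[].
have winb: all (fun x => x <= a + m0.+2) (variables f).
  by apply: sub_all win => x /andP[].
have ak1: a <= k by lia.
have szr: size (recent v k (k - a)) = k - a by rewrite size_map size_iota.
have qd: size (recent v k (k - a)) + qdepth f <= m0.+2.
  by have := qdepth_window fl winb ltac:(lia); rewrite szr; lia.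
have [B [b0 [C [s [cB trC szs hss]]]]] :=
  small_model_hs trA (v 0) qd (proj1 (holds_hs A v fl wina ak1) hv).
rewrite szr in szs; exists B; split.
  apply: leq_trans cB _; apply: tower_mono.
  by rewrite -mulnA leq_mul // leq_mul //= ltnS size_preds.
have [w hw] := recent_onto b0 (s := s) (k := k) ltac:(lia).
exists C, w; split=> //; apply/(holds_hs C w fl wina ak1).
by rewrite -szs hw.
Qed.

(** * Machine programs *)

Section Fragments.

Variable K : nat.

Local Notation sym := (tape_sym token unit).
Local Notation tapes := ((K.+1).-tuple (tape token unit)).
Local Notation syms := ((K.+1).-tuple sym).
Local Notation acts := ((K.+1).-tuple (sym * move)).

Definition heads (T : tapes) : syms := map_tuple (fun t => t.1.2) T.
Definition perform (a : acts) (T : tapes) : tapes :=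
  [tuple act (tnth a i) (tnth T i) | i < K.+1].
Definition idle (h : syms) : acts := map_tuple (fun x => (x, Stay)) h.

(* [None] as the next state stands for the unique exit of the program. *)
Record frag := Frag {
  fstate : finType;
  entry : fstate;
  trans : fstate -> syms -> option fstate * acts }.

Inductive frun (F : frag) : fstate F -> tapes -> tapes -> nat -> Prop :=
| frun_exit x T of (trans x (heads T)).1 = None :
    frun x T (perform (trans x (heads T)).2 T) 1
| frun_step x y T T' t of (trans x (heads T)).1 = Some y &
    frun y (perform (trans x (heads T)).2 T) T' t : frun x T T' t.+1.

Definition fact (f : syms -> acts) : frag :=
  @Frag unit tt (fun _ h => (None, f h)).

Definition fseq (F G : frag) : frag :=
  @Frag (fstate F + fstate G)%type (inl (entry F)) (fun x h =>
    match x with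
    | inl x => let: (o, a) := trans x h in
               (Some (if o is Some y then inl y else inr (entry G)), a)
    | inr x => let: (o, a) := trans x h in (omap inr o, a)
    end).

(** The test is an idle step of its own in state [None], here and in [fwhile]; it accounts for the
    successors in the running times. *)
Definition fif (b : syms -> bool) (F G : frag) : frag :=
  @Frag (option (fstate F + fstate G)) None (fun x h =>
    match x with
    | None => (Some (Some (if b h then inl (entry F) else inr (entry G))), idle h)
    | Some (inl x) => let: (o, a) := trans x h in (omap (fun y => Some (inl y)) o, a)
    | Some (inr x) => let: (o, a) := trans x h in (omap (fun y => Some (inr y)) o, a)
    end).

Definition fwhile (b : syms -> bool) (F : frag) : frag :=
  @Frag (option (fstate F)) None (fun x h =>
    match x with
    | None => (if b h then Some (Some (entry F)) else None, idle h)
    | Some x => let: (o, a) := trans x h in (Some o, a)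
    end).

Lemma perform_idle T : perform (idle (heads T)) T = T.
Proof.
apply: eq_from_tnth => i; rewrite tnth_mktuple !tnth_map.
by case: (tnth T i) => [[]].
Qed.

Lemma frun_fact f T : frun (entry (fact f)) T (perform (f (heads T)) T) 1.
Proof. exact: (@frun_exit (fact f)). Qed.

Lemma frun_seq F G T T1 T2 t1 t2 : frun (entry F) T T1 t1 ->
  frun (entry G) T1 T2 t2 -> frun (entry (fseq F G)) T T2 (t1 + t2).
Proof.
move=> rF rG; have {}rG: @frun (fseq F G) (inr (entry G)) T1 T2 t2.
  elim: rG => {T1 T2 t2 rF} [x T0 e|x y T0 T0' t0 e _ IH].
    have e1 : (@trans (fseq F G) (inr x) (heads T0)).2 = (trans x (heads T0)).2.
      by rewrite /=; case: (trans _ _).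
    rewrite -e1; apply: frun_exit; move: e => /=; by case: (trans _ _) => o a /= ->.
  apply: (@frun_step (fseq F G) _ (inr y)).
    by move: e => /=; case: (trans _ _) => o a /= ->.
  by move: IH; rewrite /=; case: (trans _ _).
rewrite [entry _]/=; elim: rF rG => {T T1 t1} [x T0 e|x y T0 T0' t0 e _ IH] rG.
  apply: (@frun_step (fseq F G) _ (inr (entry G))).
    by move: e => /=; case: (trans _ _) => o a /= ->.
  by move: rG; rewrite /=; case: (trans _ _).
rewrite addSn; apply: (@frun_step (fseq F G) _ (inl y)).
  by move: e => /=; case: (trans _ _) => o a /= ->.
by move: (IH rG); rewrite /=; case: (trans _ _).
Qed.

Lemma frun_if b F G T T' t :
  frun (entry (if b (heads T) then F else G)) T T' t ->
  frun (entry (fif b F G)) T T' t.+1.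
Proof.
have liftF x T0 T0' t0 : frun x T0 T0' t0 -> @frun (fif b F G) (Some (inl x)) T0 T0' t0.
  elim=> {x T0 T0' t0} [x T0 e|x y T0 T0' t0 e _ IH].
    have e1 : (@trans (fif b F G) (Some (inl x)) (heads T0)).2 = (trans x (heads T0)).2.
      by rewrite /=; case: (trans _ _).
    rewrite -e1; apply: frun_exit; move: e => /=; by case: (trans _ _) => o a /= ->.
  apply: (@frun_step (fif b F G) _ (Some (inl y))).
    by move: e => /=; case: (trans _ _) => o a /= ->.
  by move: IH; rewrite /=; case: (trans _ _).
have liftG x T0 T0' t0 : frun x T0 T0' t0 -> @frun (fif b F G) (Some (inr x)) T0 T0' t0.
  elim=> {x T0 T0' t0} [x T0 e|x y T0 T0' t0 e _ IH].
    have e1 : (@trans (fif b F G) (Some (inr x)) (heads T0)).2 = (trans x (heads T0)).2.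
      by rewrite /=; case: (trans _ _).
    rewrite -e1; apply: frun_exit; move: e => /=; by case: (trans _ _) => o a /= ->.
  apply: (@frun_step (fif b F G) _ (Some (inr y))).
    by move: e => /=; case: (trans _ _) => o a /= ->.
  by move: IH; rewrite /=; case: (trans _ _).
move=> rFG; apply: frun_step; first by [].
rewrite [_.2]/= perform_idle; case: (b _) rFG; [exact: liftF | exact: liftG].
Qed.

Lemma frun_while_false (b : syms -> bool) F T : ~~ b (heads T) -> frun (entry (fwhile b F)) T T 1.
Proof.
move=> /negbTE nb; rewrite -{2}(perform_idle T).
by apply: (@frun_exit (fwhile b F) None); rewrite /= nb.
Qed.

Lemma frun_while_true (b : syms -> bool) F T T1 T2 t1 t2 : b (heads T) -> frun (entry F) T T1 t1 ->
  frun (entry (fwhile b F)) T1 T2 t2 -> frun (entry (fwhile b F)) T T2 (t1 + t2).+1.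
Proof.
move=> bT rF rW.
have {}rF: @frun (fwhile b F) (Some (entry F)) T T2 (t1 + t2).
  elim: rF rW {bT} => {T T1 t1} [x T0 e|x y T0 T0' t0 e _ IH] rG.
    apply: (@frun_step (fwhile b F) _ None).
      by move: e => /=; case: (trans _ _) => o a /= ->.
    by move: rG; rewrite /=; case: (trans _ _).
  rewrite addSn; apply: (@frun_step (fwhile b F) _ (Some y)).
    by move: e => /=; case: (trans _ _) => o a /= ->.
  by move: (IH rG); rewrite /=; case: (trans _ _).
by apply: (@frun_step (fwhile b F) _ (Some (entry F))); rewrite /= ?bT ?perform_idle.
Qed.

(* After the exit of the fragment the answer is read off the scanned symbols. *)
Definition machine (F : frag) (ans : syms -> bool) : ntm token :=
  @NTM token (fstate F + option bool)%type unit K (inl (entry F))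
    (fun q => q == inr (Some true))
    (fun q h q' a =>
       match q with
       | inl x => let: (o, b) := trans x h in
           `[< a = b /\ q' = (if o is Some y then inl y else inr None) >]
       | inr None => `[< a = idle h /\ q' = inr (Some (ans h)) >]
       | inr (Some _) => false
       end).

Lemma machine_det F ans (c c1 c2 : config (machine F ans)) :
  step c c1 -> step c c2 -> c1 = c2.
Proof.
case: c c1 c2 => [q T] [q1 T1] [q2 T2] [a1 [/= d1 ->]] [a2 [/= d2 ->]].
suff [-> ->] : a1 = a2 /\ q1 = q2 by [].
case: q d1 d2 => [x|[b|]] //; last by move=> /asboolP[-> ->] /asboolP[-> ->].
by case: (trans _ _) => o b /asboolP[-> ->] /asboolP[-> ->].
Qed.

Lemma reach_cat (X : finType) (M : ntm X) n1 n2 (c d e : config M) :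
  reach n1 c d -> reach n2 d e -> reach (n1 + n2) c e.
Proof.
elim: n1 c => [|n IH] c /= => [-> //|[c' s r1] r2].
by exists c' => //; apply: IH r2.
Qed.

Lemma machine_run F ans x T T' t : frun x T T' t ->
  reach t (@Config _ (machine F ans) (inl x) T) (@Config _ (machine F ans) (inr None) T').
Proof.
elim=> {x T T' t} [x T e|x y T T' t e _ IH].
  eexists; last by [].
  exists (trans x (heads T)).2; split=> //=.
  by move: e; rewrite -/(heads T); case: (trans _ _) => o a /= ->; apply/asboolP.
eexists; last exact: IH.
exists (trans x (heads T)).2; split=> //=.
by move: e; rewrite -/(heads T); case: (trans _ _) => o a /= ->; apply/asboolP.
Qed.

(** Steps are deterministic, so every path is an initial part of the run to [c1]; the time bound and
    acceptance are both read off this run. The extra step is the one that computes the answer. *)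
Lemma machine_halts F ans w T t :
  frun (entry F) (ctapes (init (machine F ans) w)) T t ->
  (forall n c, reach n (init (machine F ans) w) c -> n <= t.+1) /\
  (ans (heads T) <-> exists n c,
     [/\ reach n (init (machine F ans) w) c, halted c & accepting (cstate c)]).
Proof.
move=> r0; have r1 : reach t (init (machine F ans) w)
  (@Config _ (machine F ans) (inr None) T) := machine_run ans r0.
pose c1 := @Config _ (machine F ans) (inr (Some (ans (heads T)))) T.
have r2 : reach t.+1 (init (machine F ans) w) c1.
  rewrite -addn1; apply: reach_cat r1 _; exists c1 => //; exists (idle (heads T)).
  split; first by apply/asboolP.
  by rewrite -[LHS](perform_idle T).
have h1 : halted c1 by move=> d [a []].
have det n c : reach n (init (machine F ans) w) c -> n <= t.+1 /\ (halted c -> c = c1).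
  elim: t.+1 n {r0 r1} (init _ w) r2 => [|k IH] [|n] d /=.
  - by move=> -> ->.
  - by move=> -> [c' /h1].
  - by move=> [d' sd _] <-; split=> // /(_ _ sd).
  - by move=> [d' sd rd] [d2 sd2] rn; apply: (IH n d') => //; rewrite (machine_det sd sd2).
split=> [n c /det[]//|]; split=> [hT|[n [c [/det[_ hc] /hc ->]]]].
  by exists t.+1, c1; split=> //; apply/eqP; rewrite /= hT.
by move=> /eqP[].
Qed.

End Fragments.

(** * Unary counters and timed total correctness *)

Section Registers.

Variable K : nat.

Local Notation mark := (Some (inr tt) : tape_sym token unit).
Local Notation blank := (None : tape_sym token unit).
Local Notation tapes := ((K.+1).-tuple (tape token unit)).

(* Tape [r.+1] holds register [r] in unary, with the head on the last mark. *)
Definition counter (c : nat) (T : tape token unit) :=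
  exists a b, T.1.2 :: T.1.1 = nseq c mark ++ nseq a.+1 blank /\ T.2 = nseq b blank.

(** [w] is the unread rest of the input; the cells to the left of the head are left unspecified. *)
Definition intape (w : seq token) (T : tape token unit) :=
  (T.1.2, T.2) = pop [seq Some (inl x) | x <- w].

Definition rep (T : tapes) w (s : nat -> nat) :=
  intape w (tnth T ord0) /\ forall r, r < K -> counter (s r) (tnth T (inord r.+1)).

(** A timed Hoare triple. It ranges over all tapes representing the store, because the number of
    stored blanks around a counter depends on its history. *)
Definition comp (F : frag K) w s w' s' B := forall T, rep T w s ->
  exists T' t, [/\ frun (entry F) T T' t, rep T' w' s' & t <= B].

Definition upd (s : nat -> nat) (x v : nat) : nat -> nat :=
  fun y => if Nat.eqb y x then v else s y.

Definition onf (r : nat) f (h : (K.+1).-tuple (tape_sym token unit)) :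
    (K.+1).-tuple (tape_sym token unit * move) :=
  [tuple if i == r :> nat then f (tnth h i) else (tnth h i, Stay) | i < K.+1].
Definition on (r : nat) f : frag K := fact (onf r f).

Definition fskip : frag K := fact (@idle K).
Definition finc r := fseq (on r.+1 (fun x => (x, MoveR))) (on r.+1 (fun=> (mark, Stay))).
Definition fdec r := on r.+1 (fun=> (blank, MoveL)).
Definition fnext := on 0 (fun x => (x, MoveR)).
Definition nz r : (K.+1).-tuple (tape_sym token unit) -> bool :=
  fun h => tnth h (inord r.+1) != None.
Definition reads (a : token) : (K.+1).-tuple (tape_sym token unit) -> bool :=
  fun h => tnth h ord0 == Some (inl a).
Definition nonblank : (K.+1).-tuple (tape_sym token unit) -> bool :=
  fun h => tnth h ord0 != None.

Lemma comp_le F w s w' s' B B' : B <= B' -> comp F w s w' s' B -> comp F w s w' s' B'.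
Proof.
by move=> le C T /C[T' [t [h1 h2 h3]]]; exists T', t; split=> //; apply: leq_trans le.
Qed.

Lemma comp_skip w s : comp fskip w s w s 1.
Proof.
move=> T r; exists T, 1; split=> //; rewrite -{2}(perform_idle T); exact: frun_fact.
Qed.

Lemma comp_seq F G w s w1 s1 w2 s2 B1 B2 : comp F w s w1 s1 B1 ->
  comp G w1 s1 w2 s2 B2 -> comp (fseq F G) w s w2 s2 (B1 + B2).
Proof.
move=> cF cG T /cF[T1 [t1 [r1 /cG[T2 [t2 [r2 R2 l2]]] l1]]].
by exists T2, (t1 + t2); split; [exact: frun_seq r1 r2 | | exact: leq_add].
Qed.

Lemma on_tapes r f (T : tapes) (i : 'I_K.+1) :
  tnth (perform (onf r f (heads T)) T) i =
  if i == r :> nat then act (f (tnth T i).1.2) (tnth T i) else tnth T i.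
Proof.
rewrite !tnth_mktuple !tnth_map; case: ifP => // _.
by case: (tnth T i) => [[]].
Qed.

Lemma updE s x v y : upd s x v y = if y == x then v else s y.
Proof.
by rewrite /upd; case: eqP => [->|/PeanoNat.Nat.eqb_neq ->//]; rewrite PeanoNat.Nat.eqb_refl.
Qed.

Lemma comp_on r f w s c : r < K ->
  (forall T, counter (s r) T -> counter c (act (f T.1.2) T)) ->
  comp (on r.+1 f) w s w (upd s r c) 1.
Proof.
move=> rK H T [Rw Rs]; eexists; exists 1; split; [exact: frun_fact| |by []].
split=> [|q qK]; rewrite on_tapes //= inordK // eqSS updE.
by case: eqP => [->|_]; [apply/H/Rs | apply: Rs].
Qed.

Lemma pop_nseq b : exists b', pop (nseq b blank) = (blank, nseq b' blank).
Proof. by case: b => [|b]; [exists 0 | exists b]. Qed.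

Lemma comp_inc r w s : r < K -> comp (finc r) w s w (upd s r (s r).+1) 2.
Proof.
move=> rK T [Rw Rs]; eexists; exists 2; split.
- exact: frun_seq (frun_fact _ _) (frun_fact _ _).
- split=> [|q qK]; rewrite !on_tapes //= inordK // eqSS updE.
  case: eqP => [->|_]; last exact: Rs.
  have [a [b]] := Rs r rK; case: (tnth T _) => [[l x] r0] /= [e ->].
  have [b' ->] := pop_nseq b; exists a, b'; split=> //=.
  by rewrite e.
- by [].
Qed.

Lemma comp_dec r w s : r < K -> 0 < s r -> comp (fdec r) w s w (upd s r (s r).-1) 1.
Proof.
move=> rK; move e: (s r) => c c0; apply: comp_on => // T; rewrite e.
case: c c0 {e} => [//|c] _ [a [b]].
case: T => [[l x] r0] /= [[_ ->] ->].
case: c => [|c] /=; first by exists a, b.+1; split=> //; case: a.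
by exists a, b.+1.
Qed.

Lemma comp_next a w s : comp fnext (a :: w) s w s 1.
Proof.
move=> T [Rw Rs]; eexists; exists 1; split; [exact: frun_fact| |by []].
split=> [|q qK]; rewrite on_tapes /=; last by rewrite inordK //; apply: Rs.
by move: Rw; rewrite /intape; case: (tnth T ord0) => [[l x] r] /= [-> ->]; case: (map _ w).
Qed.

Lemma nz_rep T w s r : rep T w s -> r < K -> nz r (heads T) = (s r != 0).
Proof.
move=> [_ Rs] /Rs[a [b]]; rewrite /nz tnth_map.
by case: (tnth T _) => [[l x] r0] /= []; case: (s r) => [|c] [-> _].
Qed.

Lemma reads_rep T w s a : rep T w s -> reads a (heads T) = (ohead w == Some a).
Proof.
move=> [Rw _]; move: Rw; rewrite /intape /reads tnth_map.
by case: w => [|b w] /= [-> _].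
Qed.

Lemma nonblank_rep T w s : rep T w s -> nonblank (heads T) = (w != [::]).
Proof.
move=> [Rw _]; move: Rw; rewrite /intape /nonblank tnth_map.
by case: w => [|b w] /= [-> _].
Qed.

Lemma comp_if b c F G w s w' s' B : (forall T, rep T w s -> b (heads T) = c) ->
  comp (if c then F else G) w s w' s' B -> comp (fif b F G) w s w' s' B.+1.
Proof.
move=> bc C T R; have [T' [t [h1 h2 h3]]] := C T R.
by exists T', t.+1; split=> //; apply: frun_if; rewrite (bc T R).
Qed.

Lemma comp_ifnz r F G w s w' s' B : r < K ->
  comp (if s r != 0 then F else G) w s w' s' B -> comp (fif (nz r) F G) w s w' s' B.+1.
Proof. by move=> rK; apply: comp_if => T R; apply: nz_rep R rK. Qed.

(** [st i] is the store when [i] rounds remain; every counting loop is verified by writing down this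
    family. *)
Lemma comp_for r F (st : nat -> nat -> nat) v w B : r < K ->
  (forall i, i < v -> st i.+1 r != 0 /\ comp F w (st i.+1) w (st i) B) -> st 0 r = 0 ->
  comp (fwhile (nz r) F) w (st v) w (st 0) (v * B.+1 + 1).
Proof.
move=> rK H st0; elim: v H => [|v IH] H T R.
  by exists T, 1; split=> //; apply: frun_while_false; rewrite (nz_rep R rK) st0.
have [nzv /(_ T R)[T1 [t1 [h1 R1 l1]]]] := H v (ltnSn v).
have [T2 [t2 [h2 R2 l2]]] := IH (fun i l => H i (leqW l)) T1 R1.
exists T2, (t1 + t2).+1; split=> //; last by rewrite mulSn; lia.
by apply: frun_while_true h1 h2; rewrite (nz_rep R rK).
Qed.

End Registers.

(** * Arithmetic on registers *)

Lemma upd_same s x v : upd s x v x = v.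
Proof. by rewrite updE eqxx. Qed.

Lemma comp_to K (F : frag K) w s w' s1 s2 B B' : comp F w s w' s1 B -> s1 = s2 -> B <= B' ->
  comp F w s w' s2 B'.
Proof. by move=> C <- le; apply: comp_le C. Qed.

Ltac split_ifs := rewrite ?updE;
  repeat match goal with |- context [if ?a == ?b then _ else _] => case: (a =P b) => ? end.
Ltac regs := split_ifs; subst; try congruence; try lia.
Ltac store := apply: funext => ?; regs.

Section Arithmetic.

Variable K : nat.
Implicit Types (s : nat -> nat) (w : seq token).

Definition fmove r d : frag K := fwhile (nz r) (fseq (fdec K r) (finc K d)).

Lemma comp_fmove r d w s : r < K -> d < K -> r != d ->
  comp (fmove r d) w s w (upd (upd s r 0) d (s d + s r)) (s r * 4 + 1).
Proof.
move=> rK dK /eqP nrd.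
pose st i := upd (upd s r i) d (s d + (s r - i)).
have e0: st (s r) = s by rewrite /st; store.
rewrite -{1}e0; apply: comp_to (comp_for (st := st) rK _ _) _ _ => [i lti||//|//].
- split; first by rewrite /st; regs.
  apply: comp_to (comp_seq (comp_dec rK _) (comp_inc dK)) _ _ => //.
    by rewrite /st; regs.
  by rewrite /st; store.
- by rewrite /st; regs.
- by rewrite /st; store.
Qed.

Definition clear r : frag K := fwhile (nz r) (fdec K r).

Lemma comp_clear r w s : r < K -> comp (clear r) w s w (upd s r 0) (s r * 2 + 1).
Proof.
move=> rK; pose st i := upd s r i.
have e0: st (s r) = s by rewrite /st; store.
rewrite -{1}e0; apply: comp_to (comp_for (st := st) rK _ _) _ _ => [i lti||//|//].
- split; first by rewrite /st; regs.
  by apply: comp_to (comp_dec rK _) _ _ => //; rewrite /st; [regs | store].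
- by rewrite /st; regs.
Qed.

(** Reading a unary register destroys it, so the value goes both to [d] and to the scratch register
    [e], and from there back to [r]. *)
Definition copy r d e : frag K :=
  fseq (fwhile (nz r) (fseq (fdec K r) (fseq (finc K d) (finc K e)))) (fmove e r).

Lemma comp_copy r d e w s : r < K -> d < K -> e < K -> r != d -> r != e -> d != e ->
  s e = 0 -> comp (copy r d e) w s w (upd s d (s d + s r)) (s r * 10 + 2).
Proof.
move=> rK dK eK /eqP nrd /eqP nre /eqP nde se.
pose st i := upd (upd (upd s r i) d (s d + (s r - i))) e (s r - i).
have e0: st (s r) = s by rewrite /st; store.
rewrite -{1}e0; apply: comp_to (comp_seq
  (comp_for (st := st) (w := w) (B := 5) rK _ _) (comp_fmove eK rK _)) _ _.
- move=> i lti; split; first by rewrite /st; regs.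
  apply: comp_to (comp_seq (comp_dec rK _) (comp_seq (comp_inc dK) (comp_inc eK))) _ _ => //.
    by rewrite /st; regs.
  by rewrite /st; store.
- by rewrite /st; regs.
- by apply/eqP => ?; apply: nre.
- by rewrite /st; store.
- rewrite /st; regs.
Qed.

End Arithmetic.

(** [TShr] serves to test a bit of a coded set. It is computed by repeated halving: the power of 2
    itself may be exponential in the bound on the registers and is never formed. *)
Inductive term :=
| TVar of nat
| TConst of nat
| TAdd of term & term
| TMul of term & term
| TShr of term & term.

Fixpoint tval (s : nat -> nat) (t : term) : nat :=
  match t with
  | TVar x => s x
  | TConst c => c
  | TAdd a b => tval s a + tval s b
  | TMul a b => tval s a * tval s b
  | TShr a b => tval s a %/ 2 ^ tval s b
  end.

Fixpoint tvars (t : term) : seq nat :=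
  match t with
  | TVar x => [:: x]
  | TConst _ => [::]
  | TAdd a b | TMul a b | TShr a b => tvars a ++ tvars b
  end.

Lemma tval_agree s s' t : {in tvars t, s =1 s'} -> tval s t = tval s' t.
Proof.
elim: t => //= [x|a IHa b IHb|a IHa b IHb|a IHa b IHb] H;
  try by apply: H; rewrite inE.
1-3: by rewrite IHa ?IHb // => x hx; apply: H; rewrite mem_cat hx ?orbT.
Qed.

Lemma tval_upd s t x v : x \notin tvars t -> tval (upd s x v) t = tval s t.
Proof.
move=> nx; apply: tval_agree => y hy; rewrite updE.
by case: eqP => // e; rewrite -e hy in nx.
Qed.

Definition below d (l : seq nat) := all (fun x => x < d) l.

Lemma below_notin d e l : below d l -> d <= e -> e \notin l.
Proof. by move=> /allP H le; apply/negP => /H; lia. Qed.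

Section Terms.

Variable K : nat.
Implicit Types (s : nat -> nat) (w : seq token).

(** [g] holds the parity of the number of rounds made, so every second decrement of [d] increments
    [e]. *)
Definition half d e g : frag K :=
  fseq (fwhile (nz d) (fseq (fdec K d)
     (fif (nz g) (fseq (fdec K g) (finc K e)) (finc K g))))
   (fseq (clear K g) (fmove K e d)).

Lemma comp_half d e g w s : d < K -> e < K -> g < K -> d != e -> d != g -> e != g ->
  s e = 0 -> s g = 0 ->
  comp (half d e g) w s w (upd s d (s d %/ 2)) (s d * 10 + 10).
Proof.
move=> dK eK gK /eqP nde /eqP ndg /eqP neg se sg.
pose st i := upd (upd (upd s d i) e ((s d - i) %/ 2)) g ((s d - i) %% 2).
have e0: st (s d) = s by rewrite /st; store.
rewrite -{1}e0; apply: comp_to (comp_seq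
  (comp_for (st := st) (w := w) (B := 5) dK _ _)
  (comp_seq (comp_clear gK) (comp_fmove eK dK _))) _ _.
- move=> i lti; split; first by rewrite /st; regs.
  apply: comp_to (comp_seq (comp_dec dK _) (comp_ifnz (B := 3) gK _)) (erefl (st i)) _ => //.
    by rewrite /st; regs.
  case: ifP; rewrite /st; regs => nzp.
    apply: comp_to (comp_seq (comp_dec gK _) (comp_inc eK)) _ _ => //.
      by regs.
    by store.
  apply: comp_to (comp_inc gK) _ _ => //.
  by store.
- by rewrite /st; regs.
- by apply/eqP => ?; apply: nde.
- by rewrite /st; store.
- rewrite /st; regs.
Qed.

Fixpoint iseq (n : nat) (F : frag K) : frag K :=
  if n is n'.+1 then fseq F (iseq n' F) else fskip K.

(** A stack discipline: registers from [d] on are zero at the start, and only [d] is changed at the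
    end. For [TMul], [d] is the accumulator, hence the factors go to [d.+1] and [d.+2]. *)
Fixpoint cterm d (t : term) : frag K :=
  match t with
  | TVar x => copy K x d d.+1
  | TConst c => iseq c (finc K d)
  | TAdd a b => fseq (cterm d a) (fseq (cterm d.+1 b) (fmove K d.+1 d))
  | TMul a b => fseq (cterm d.+1 a) (fseq (cterm d.+2 b)
      (fseq (fwhile (nz d.+1) (fseq (fdec K d.+1) (copy K d.+2 d d.+3))) (clear K d.+2)))
  | TShr a b => fseq (cterm d a) (fseq (cterm d.+1 b)
      (fwhile (nz d.+1) (fseq (fdec K d.+1) (half d d.+2 d.+3))))
  end.

End Terms.

Fixpoint twidth (t : term) : nat :=
  match t with
  | TVar _ | TConst _ => 2
  | TAdd a b | TMul a b | TShr a b => (maxn (twidth a) (twidth b)).+4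
  end.

Fixpoint tbound (t : term) (V : nat) : nat :=
  match t with
  | TVar _ => V
  | TConst c => c
  | TAdd a b => tbound a V + tbound b V
  | TMul a b => tbound a V * tbound b V
  | TShr a _ => tbound a V
  end.

Fixpoint tcost (t : term) (V : nat) : nat :=
  match t with
  | TVar _ => V * 10 + 2
  | TConst c => c * 2 + 1
  | TAdd a b => tcost a V + (tcost b V + (tbound b V * 4 + 1))
  | TMul a b => tcost a V + (tcost b V +
      ((tbound a V * (tbound b V * 10 + 4) + 1) + (tbound b V * 2 + 1)))
  | TShr a b => tcost a V + (tcost b V + (tbound b V * (tbound a V * 10 + 12) + 1))
  end.

Definition zero_from d (s : nat -> nat) := forall r, d <= r -> s r = 0.
Definition bounded V d (s : nat -> nat) := forall r, r < d -> s r <= V.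

Lemma zero_upd d s v : zero_from d s -> zero_from d.+1 (upd s d v).
Proof. by move=> z r lr; rewrite updE; case: eqP => [e|_]; [lia | apply: z; lia]. Qed.

Lemma tval_bound V d s t : bounded V d s -> below d (tvars t) -> tval s t <= tbound t V.
Proof.
move=> bd; elim: t => //= [x|a IHa b IHb|a IHa b IHb|a IHa b IHb].
- by rewrite /below /= andbT; apply: bd.
- by rewrite /below all_cat => /andP[/IHa ? /IHb ?]; apply: leq_add.
- by rewrite /below all_cat => /andP[/IHa ? /IHb ?]; apply: leq_mul.
- rewrite /below all_cat => /andP[/IHa ? /IHb ?].
  by apply: leq_trans (leq_div _ _) _.
Qed.

Lemma comp_term K t d d0 V w s : d0 <= d -> below d0 (tvars t) -> d + twidth t <= K ->
  zero_from d s -> bounded V d0 s ->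
  comp (cterm K d t) w s w (upd s d (tval s t)) (tcost t V).
Proof.
elim: t d s => [x|c|a IHa b IHb|a IHa b IHb|a IHa b IHb] d s led bl dK z bd;
  rewrite /= in dK *.
- move: bl; rewrite /below /= andbT => lx.
  have sx := bd x lx.
  apply: comp_to (comp_copy _ _ _ _ _ _ _) _ _; try lia.
  + by apply: z.
  + by rewrite (z d).
- have -> : upd s d c = upd s d (s d + c) by rewrite (z d).
  elim: c {bl} s {z bd} => [|c IH] s /=.
    by apply: (@comp_to _ _ _ _ _ _ _ _ _ (@comp_skip K w s)) => //; store.
  apply: comp_to (comp_seq (comp_inc _) (IH _)) _ _; try lia.
  by store.
- move: bl; rewrite /below all_cat => /andP[bla blb].
  have nb: d \notin tvars b by apply: below_notin blb led.
  have sz: bounded V d0 (upd s d (tval s a)).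
    by move=> r lr; rewrite updE; case: eqP => [?|_]; [lia | apply: bd].
  have vb := tval_bound bd blb.
  apply: comp_to (comp_seq (IHa d s led bla _ z bd) (comp_seq
    (IHb d.+1 _ (leqW led) blb _ (zero_upd _ z) sz) (comp_fmove _ _ _))) _ _; try lia.
  + have ? := z d.+1 (leqW (leqnn d)).
    by rewrite tval_upd //; store.
  + by rewrite upd_same tval_upd //; lia.
- move: bl; rewrite /below all_cat => /andP[bla blb].
  have nb: d.+1 \notin tvars b by apply: below_notin blb (leqW led).
  have z1: zero_from d.+1 s by move=> r lr; apply: z; lia.
  have sz: bounded V d0 (upd s d.+1 (tval s a)).
    by move=> r lr; rewrite updE; case: eqP => [?|_]; [lia | apply: bd].
  have va := tval_bound bd bla.
  have vb := tval_bound bd blb.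
  have zd := z d (leqnn d).
  have zd1 := z d.+1 (leqW (leqnn d)).
  have zd2 := z d.+2 (leqW (leqW (leqnn d))).
  have zd3 := z d.+3 (leqW (leqW (leqW (leqnn d)))).
  pose st i := upd (upd (upd s d.+1 i) d.+2 (tval s b)) d ((tval s a - i) * tval s b).
  have loop : comp (fwhile (nz d.+1) (fseq (fdec K d.+1) (copy K d.+2 d d.+3)))
      w (st (tval s a)) w (st 0) (tval s a * (tval s b * 10 + 3).+1 + 1).
    apply: comp_for; [lia | move=> i lti; split | by rewrite /st; regs];
      first by rewrite /st; regs.
    apply: comp_to (comp_seq (comp_dec _ _) (comp_copy _ _ _ _ _ _ _)) _ _; try lia;
      rewrite /st ?updE; repeat (case: eqP => ?); try lia.
    by store; nia.
  have e1 : upd (upd s d.+1 (tval s a)) d.+2 (tval (upd s d.+1 (tval s a)) b) = st (tval s a).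
    by rewrite tval_upd // /st; store.
  have cb := IHb d.+2 (upd s d.+1 (tval s a)) (leqW (leqW led)) blb ltac:(lia)
    (zero_upd _ z1) sz.
  rewrite e1 in cb.
  apply: comp_to (comp_seq (IHa d.+1 s (leqW led) bla _ z1 bd)
    (comp_seq cb (comp_seq loop (comp_clear _)))) _ _; try lia.
  + by rewrite /st; store.
  + rewrite (_ : st 0 d.+2 = tval s b); last by rewrite /st; regs.
    nia.
- move: bl; rewrite /below all_cat => /andP[bla blb].
  have nb: d \notin tvars b by apply: below_notin blb led.
  have sz: bounded V d0 (upd s d (tval s a)).
    by move=> r lr; rewrite updE; case: eqP => [?|_]; [lia | apply: bd].
  have va := tval_bound bd bla.
  have vb := tval_bound bd blb.
  have zd := z d (leqnn d).
  have zd1 := z d.+1 (leqW (leqnn d)).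
  have zd2 := z d.+2 (leqW (leqW (leqnn d))).
  have zd3 := z d.+3 (leqW (leqW (leqW (leqnn d)))).
  pose st i := upd (upd s d.+1 i) d (tval s a %/ 2 ^ (tval s b - i)).
  have loop : comp (fwhile (nz d.+1) (fseq (fdec K d.+1) (half K d d.+2 d.+3)))
      w (st (tval s b)) w (st 0) (tval s b * (tbound a V * 10 + 11).+1 + 1).
    apply: comp_for; [lia | move=> i lti; split | by rewrite /st; regs];
      first by rewrite /st; regs.
    have le : tval s a %/ 2 ^ (tval s b - i.+1) <= tbound a V by apply: leq_trans (leq_div _ _) va.
    apply: comp_to (comp_seq (comp_dec _ _) (comp_half _ _ _ _ _ _ _ _)) _ _; try lia;
      rewrite /st ?updE; repeat (case: eqP => ?); try lia.
    by store; rewrite -divnMA -expnSr; congr (_ %/ 2 ^ _); lia.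
  have e1 : upd (upd s d (tval s a)) d.+1 (tval (upd s d (tval s a)) b) = st (tval s b).
    by rewrite tval_upd // /st subnn divn1; store.
  have cb := IHb d.+1 (upd s d (tval s a)) (leqW led) blb ltac:(lia) (zero_upd _ z) sz.
  rewrite e1 in cb.
  apply: comp_to (comp_seq (IHa d s led bla _ z bd) (comp_seq cb loop)) _ _; try lia.
  + by rewrite /st subn0; store.
  + nia.
Qed.

(** * Bounded arithmetic *)

Inductive fo :=
| FLt of term & term
| FOdd of term
| FNot of fo
| FAnd of fo & fo
| FOr of fo & fo
| FImp of fo & fo
| FEx of nat & fo
| FAll of nat & fo.

(* Quantifiers are bounded by the variable 0. *)
Fixpoint den (s : nat -> nat) (f : fo) : Prop :=
  match f with
  | FLt a b => tval s a < tval s b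
  | FOdd a => odd (tval s a)
  | FNot g => ~ den s g
  | FAnd g h => den s g /\ den s h
  | FOr g h => den s g \/ den s h
  | FImp g h => den s g -> den s h
  | FEx x g => exists a, a <= s 0 /\ den (upd s x a) g
  | FAll x g => forall a, a <= s 0 -> den (upd s x a) g
  end.

Fixpoint fvars (f : fo) : seq nat :=
  match f with
  | FLt a b => tvars a ++ tvars b
  | FOdd a => tvars a
  | FNot g => fvars g
  | FAnd g h | FOr g h | FImp g h => fvars g ++ fvars h
  | FEx x g | FAll x g => x :: fvars g
  end.

Fixpoint bvars (f : fo) : seq nat :=
  match f with
  | FLt _ _ | FOdd _ => [::]
  | FNot g => bvars g
  | FAnd g h | FOr g h | FImp g h => bvars g ++ bvars h
  | FEx x g | FAll x g => x :: bvars g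
  end.

(** A bound variable is the loop counter of its search and must be zero when the search starts, so
    it is not bound again in its scope; register 0 keeps the quantifier bound. *)
Fixpoint wf (f : fo) : bool :=
  match f with
  | FLt _ _ | FOdd _ => true
  | FNot g => wf g
  | FAnd g h | FOr g h | FImp g h => wf g && wf h
  | FEx x g | FAll x g => [&& x != 0, x \notin bvars g & wf g]
  end.

Lemma upd_swap s x y a b : x != y -> upd (upd s x a) y b = upd (upd s y b) x a.
Proof. by move=> /eqP nxy; store. Qed.

(** Needed because an enclosing search keeps its partial result in [d] while the body is
    evaluated. *)
Lemma den_upd f s d v : d != 0 -> d \notin fvars f -> den (upd s d v) f <-> den s f.
Proof.
move=> d0; have e0 s' : upd s' d v 0 = s' 0 by regs.
elim: f s => //= [a b|a|g IH|g IHg h IHh|g IHg h IHh|g IHg h IHh|x g IH|x g IH] s.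
- by rewrite mem_cat negb_or => /andP[? ?]; rewrite !tval_upd.
- by move=> ?; rewrite tval_upd.
- by move=> /(IH s); tauto.
1-3: by rewrite mem_cat negb_or => /andP[/(IHg s) ? /(IHh s) ?]; tauto.
- rewrite inE negb_or => /andP[ndx ng]; rewrite e0.
  have sw a : den (upd (upd s d v) x a) g <-> den (upd s x a) g by rewrite upd_swap // IH.
  by split=> -[a [la /sw ?]]; exists a.
- rewrite inE negb_or => /andP[ndx ng]; rewrite e0.
  have sw a : den (upd (upd s d v) x a) g <-> den (upd s x a) g by rewrite upd_swap // IH.
  by split=> h a /h /sw.
Qed.

Section FormulaPrograms.

Variable K : nat.
Implicit Types (s : nat -> nat) (w : seq token).

Definition cnot d : frag K := fif (nz d) (fdec K d) (finc K d).

Lemma comp_not d w s (b : bool) : d < K -> s d = b ->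
  comp (cnot d) w s w (upd s d (~~ b)) 3.
Proof.
move=> dK sd; apply: comp_ifnz => //; rewrite sd; case: b sd => /= sd.
  by apply: comp_to (comp_dec dK _) _ _ => //; [lia | store].
by apply: comp_to (comp_inc dK) _ _ => //; store.
Qed.

Definition cand d (F G : frag K) : frag K :=
  fseq F (fif (nz d) (fseq (fdec K d) G) (fskip K)).

Lemma comp_and d F G w s (p q : bool) B1 B2 : d < K -> s d = 0 ->
  comp F w s w (upd s d p) B1 -> comp G w s w (upd s d q) B2 ->
  comp (cand d F G) w s w (upd s d (p && q)) (B1 + B2 + 2).
Proof.
move=> dK sd cF cG; rewrite -addnA; apply: comp_seq cF _.
rewrite addn2; apply: comp_ifnz => //; rewrite upd_same; case: p => /=; last first.
  by apply: comp_le (@comp_skip K w _); lia.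
rewrite -add1n; apply: comp_seq (comp_dec dK _) _; first by rewrite upd_same.
by rewrite (_ : upd (upd s d 1) d _ = s) //; store.
Qed.

(** The quantified register is itself the loop counter: it starts one above the bound and is
    decremented before the body runs, so the values from the bound down to 0 are tried. [d]
    accumulates the disjunction. *)
Definition cex d x (F : frag K) : frag K :=
  fseq (copy K 0 x d) (fseq (finc K x) (fwhile (nz x) (fseq (fdec K x) (fseq F
    (fif (nz d.+1) (fseq (fdec K d.+1) (fif (nz d) (fskip K) (finc K d))) (fskip K)))))).

Lemma comp_ex d x F w s (p : pred nat) B : d.+1 < K -> 0 < x -> x < d ->
  zero_from d s -> s x = 0 ->
  (forall a (b : bool), a <= s 0 ->
    comp F w (upd (upd s x a) d b) w (upd (upd (upd s x a) d b) d.+1 (p a)) B) ->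
  comp (cex d x F) w s w (upd s d (has p (iota 0 (s 0).+1)))
    ((s 0 * 10 + 2) + (2 + ((s 0).+1 * (B + 6).+1 + 1))).
Proof.
move=> dK x0 xd z sx cF; have sd := z d (leqnn d); have sd1 := z d.+1 (leqW (leqnn d)).
pose st i := upd (upd s x i) d (has p (iota i ((s 0).+1 - i))).
have loop : comp (fwhile (nz x) (fseq (fdec K x) (fseq F
    (fif (nz d.+1) (fseq (fdec K d.+1) (fif (nz d) (fskip K) (finc K d))) (fskip K)))))
    w (st (s 0).+1) w (st 0) ((s 0).+1 * (B + 6).+1 + 1).
  apply: comp_for; [lia | move=> i lti; split | by rewrite /st; regs].
    by rewrite /st; regs.
  set b := has p (iota i.+1 ((s 0).+1 - i.+1)).
  have e1 : upd (st i.+1) x i = upd (upd s x i) d b by rewrite /st -/b; store.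
  have e2 : st i = upd (upd s x i) d (p i || b).
    by rewrite /st /b subSS -{1}(subnSK (lti : i < (s 0).+1)) /= subSS.
  have xK: x < K by lia.
  have pos: 0 < st i.+1 x by rewrite /st; regs.
  apply: (@comp_le _ _ _ _ _ _ (1 + (B + 5))); first by lia.
  apply: comp_seq (comp_dec xK pos) _.
    rewrite (_ : (st i.+1 x).-1 = i) ?e1; last by rewrite /st; regs.
    apply: comp_seq (cF i b lti) _.
    apply: (@comp_ifnz _ _ _ _ _ _ _ _ 4) => //; rewrite upd_same.
    case: (p i) e2 => /= ->; last first.
      by apply: comp_to (@comp_skip K w _) _ _ => //; store.
    apply: comp_to (comp_seq (comp_dec dK _) (@comp_ifnz _ d _ _ _ _ _ _ 2 _ _)) (erefl _) _ => //.
    + by rewrite upd_same.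
    + lia.
    have -> : upd (upd (upd (upd s x i) d b) d.+1 true) d.+1
        (upd (upd (upd s x i) d b) d.+1 true d.+1).-1 = upd (upd s x i) d b by store.
    rewrite upd_same; case: (b) => /=.
      by apply: comp_to (@comp_skip K w _) _ _ => //; store.
    by apply: comp_to (comp_inc _) _ _ => //; [lia | store].
have e0 : upd (upd s x (s x + s 0)) x (upd s x (s x + s 0) x).+1 = st (s 0).+1.
  by rewrite /st subnn /=; store.
have einc := comp_inc (s := upd s x (s x + s 0)) (w := w) (ltac:(lia) : x < K).
rewrite e0 in einc.
apply: comp_to (comp_seq (comp_copy _ _ _ _ _ _ _) (comp_seq einc loop)) _ _; try lia.
by rewrite /st subn0; store.
Qed.

Fixpoint cform d (f : fo) : frag K :=
  match f with
  | FLt a b => fseq (cterm K d.+1 a) (fseq (cterm K d.+2 b)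
      (fseq (fwhile (nz d.+1) (fseq (fdec K d.+1) (fif (nz d.+2) (fdec K d.+2) (fskip K))))
        (fif (nz d.+2) (fseq (finc K d) (clear K d.+2)) (fskip K))))
  | FOdd a => fseq (cterm K d.+1 a) (fwhile (nz d.+1) (fseq (fdec K d.+1) (cnot d)))
  | FNot g => fseq (cform d g) (cnot d)
  | FAnd g h => cand d (cform d g) (cform d h)
  | FOr g h => fseq (cand d (fseq (cform d g) (cnot d)) (fseq (cform d h) (cnot d))) (cnot d)
  | FImp g h => fseq (cand d (cform d g) (fseq (cform d h) (cnot d))) (cnot d)
  | FEx x g => cex d x (cform d.+1 g)
  | FAll x g => fseq (cex d x (fseq (cform d.+1 g) (cnot d.+1))) (cnot d)
  end.

End FormulaPrograms.

Fixpoint fwidth (f : fo) : nat :=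
  match f with
  | FLt a b => (maxn (twidth a) (twidth b)).+4
  | FOdd a => (twidth a).+4
  | FNot g => fwidth g
  | FAnd g h | FOr g h | FImp g h => maxn (fwidth g) (fwidth h)
  | FEx _ g | FAll _ g => (fwidth g).+2
  end.

Lemma fwidth_gt0 f : 0 < fwidth f.
Proof. by elim: f => //= *; rewrite ?leq_max; lia. Qed.

Fixpoint fcost (f : fo) (V : nat) : nat :=
  match f with
  | FLt a b => tcost a V + (tcost b V + ((tbound a V * 4 + 1) + (tbound b V * 2 + 4)))
  | FOdd a => tcost a V + (tbound a V * 5 + 1)
  | FNot g => fcost g V + 3
  | FAnd g h => fcost g V + fcost h V + 2
  | FOr g h => (fcost g V + 3) + (fcost h V + 3) + 2 + 3
  | FImp g h => fcost g V + (fcost h V + 3) + 2 + 3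
  | FEx _ g => (V * 10 + 2) + (2 + (V.+1 * (fcost g V + 6).+1 + 1))
  | FAll _ g => (V * 10 + 2) + (2 + (V.+1 * (fcost g V + 3 + 6).+1 + 1)) + 3
  end.

Lemma asbool_ex_has (P : nat -> Prop) n :
  has (fun a => `[< P a >]) (iota 0 n.+1) = `[< exists a, a <= n /\ P a >].
Proof.
apply/hasP/asboolP => [[a]|[a [la Pa]]].
  by rewrite mem_iota => la /asboolP Pa; exists a; split=> //; lia.
by exists a; [rewrite mem_iota; lia | apply/asboolP].
Qed.

Lemma den_not s g : `[< den s (FNot g) >] = ~~ `[< den s g >].
Proof. exact: asbool_neg. Qed.

Lemma den_and s g h : `[< den s (FAnd g h) >] = `[< den s g >] && `[< den s h >].
Proof. exact: asbool_and. Qed.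

Lemma den_or s g h : `[< den s (FOr g h) >] = `[< den s g >] || `[< den s h >].
Proof. exact: asbool_or. Qed.

Lemma den_imp s g h : `[< den s (FImp g h) >] = (`[< den s g >] ==> `[< den s h >]).
Proof. exact: asbool_imply. Qed.

Lemma den_ex s x g : `[< den s (FEx x g) >] =
  has (fun a => `[< den (upd s x a) g >]) (iota 0 (s 0).+1).
Proof. by rewrite (asbool_ex_has (fun a => den (upd s x a) g)). Qed.

Lemma den_all s x g : `[< den s (FAll x g) >] =
  ~~ has (fun a => ~~ `[< den (upd s x a) g >]) (iota 0 (s 0).+1).
Proof.
rewrite -all_predC; apply/asboolP/allP => [H a|H a la].
  by rewrite mem_iota => la; rewrite [predC _ _]negbK; apply/asboolP/H; lia.
by apply/asboolP; rewrite -[`[< _ >]]negbK; apply: H; rewrite mem_iota; lia.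
Qed.

Lemma comp_not_of K d (F : frag K) w s (b : bool) B : d < K -> s d = 0 ->
  comp F w s w (upd s d b) B -> comp (fseq F (cnot K d)) w s w (upd s d (~~ b)) (B + 3).
Proof.
move=> dK sd c; apply: comp_to (comp_seq c (comp_not dK (upd_same _ _ _))) _ _ => //.
by store.
Qed.

Lemma quant_body d0 d x g V s (Q : (nat -> nat) -> Prop) : d0 <= d -> below d0 (x :: fvars g) ->
  x != 0 -> x \notin bvars g -> zero_from d s -> bounded V d0 s -> s 0 = V ->
  {in x :: bvars g, forall y, s y = 0} -> {subset bvars g <= fvars g} ->
  (forall t, zero_from d.+1 t -> bounded V d0 t -> t 0 = V ->
    {in bvars g, forall y, t y = 0} -> Q t) ->
  forall a (b : bool), a <= V -> Q (upd (upd s x a) d b).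
Proof.
move=> led /andP[xd0 bl] /eqP x0 xb z bd s0 bz sub H a b la; apply: H => [r lr|r lr||y yb].
- by regs; apply: z; lia.
- by regs; apply: bd.
- by regs.
rewrite !updE; case: eqP => [e|_].
  by have := allP bl _ (sub _ yb); lia.
case: eqP => [e|_]; first by rewrite -e yb in xb.
by apply: bz; rewrite inE yb orbT.
Qed.

Lemma bvars_sub g : {subset bvars g <= fvars g}.
Proof.
elim: g => //= [g IHg h IHh|g IHg h IHh|g IHg h IHh|x g IH|x g IH] y;
  rewrite ?mem_cat ?inE.
1-3: by move=> /orP[/IHg|/IHh] ->; rewrite ?orbT.
1-2: by move=> /orP[->|/IH ->]; rewrite ?orbT.
Qed.

Lemma comp_form K f d d0 V w s : 0 < d0 -> d0 <= d -> below d0 (fvars f) -> wf f ->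
  d + fwidth f <= K -> zero_from d s -> bounded V d0 s -> s 0 = V ->
  {in bvars f, forall x, s x = 0} ->
  comp (cform K d f) w s w (upd s d `[< den s f >]) (fcost f V).
Proof.
move=> d00; elim: f d s => [a b|a|g IH|g IHg h IHh|g IHg h IHh|g IHg h IHh|x g IH|x g IH]
  d s led bl wff dK z bd s0 bz; rewrite /= in bl wff dK bz; rewrite [cform _ _ _]/= [fcost _ _]/=;
  have sd := z d (leqnn d); have fw := fwidth_gt0.
- move: bl; rewrite /below all_cat => /andP[bla blb].
  have nb: d.+1 \notin tvars b by apply: below_notin blb (leqW led).
  have z1: zero_from d.+1 s by move=> r lr; apply: z; lia.
  have sz: bounded V d0 (upd s d.+1 (tval s a)).
    by move=> r lr; rewrite updE; case: eqP => [?|_]; [lia | apply: bd].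
  have va := tval_bound bd bla; have vb := tval_bound bd blb.
  have zd1 := z d.+1 (leqW (leqnn d)).
  have zd2 := z d.+2 (leqW (leqW (leqnn d))).
  (* Comparison by truncated subtraction: the loop ends with [tval s b - tval s a] in [d.+2],
     nonzero exactly when the inequality holds. *)
  pose st i := upd (upd s d.+1 i) d.+2 (tval s b - (tval s a - i)).
  have loop : comp (fwhile (nz d.+1) (fseq (fdec K d.+1) (fif (nz d.+2) (fdec K d.+2) (fskip K))))
      w (st (tval s a)) w (st 0) (tval s a * 4 + 1).
    apply: (@comp_for K d.+1 _ st _ w 3); [lia | move=> i lti; split | by rewrite /st; regs].
      by rewrite /st; regs.
    apply: comp_to (comp_seq (comp_dec _ _) (@comp_ifnz _ d.+2 _ _ _ _ _ _ 1 _ _)) (erefl _) _ => //;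
      try lia; first by rewrite /st; regs.
    rewrite /st !updE; split_ifs; try lia; case: eqP => /= ?.
      by apply: comp_to (@comp_skip K w _) _ _ => //; store.
    by apply: comp_to (comp_dec _ _) _ _; try lia; [regs | store].
  have e1 : upd (upd s d.+1 (tval s a)) d.+2 (tval (upd s d.+1 (tval s a)) b) = st (tval s a).
    by rewrite tval_upd // /st; store.
  have cb := comp_term (w := w) (leqW (leqW led)) blb (ltac:(lia) : d.+2 + twidth b <= K) (zero_upd _ z1) sz.
  rewrite e1 in cb.
  have ca := comp_term (w := w) (leqW led) bla (ltac:(lia) : d.+1 + twidth a <= K) z1 bd.
  apply: comp_to (comp_seq ca (comp_seq cb (comp_seq loop
    (@comp_ifnz _ d.+2 _ _ _ _ _ _ (tval s b * 2 + 3) _ _)))) (erefl _) _; try lia.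
  rewrite (_ : st 0 d.+2 = tval s b - tval s a); last by rewrite /st; regs.
  case: asboolP => /= lt; case: eqP => /= ?; try lia.
    apply: comp_to (comp_seq (comp_inc _) (comp_clear _)) _ _; try lia.
      by rewrite /st; store.
    by rewrite /st; regs.
  apply: comp_to (@comp_skip K w _) _ _; try lia.
  by rewrite /st; store.
- have z1: zero_from d.+1 s by move=> r lr; apply: z; lia.
  have va := tval_bound bd bl.
  have zd1 := z d.+1 (leqW (leqnn d)).
  pose st i := upd (upd s d.+1 i) d (odd (tval s a - i)).
  have loop : comp (fwhile (nz d.+1) (fseq (fdec K d.+1) (cnot K d)))
      w (st (tval s a)) w (st 0) (tval s a * 5 + 1).
    apply: (@comp_for K d.+1 _ st _ w 4); [lia | move=> i lti; split | by rewrite /st; regs].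
      by rewrite /st; regs.
    apply: comp_to (comp_seq (comp_dec _ _) (@comp_not _ _ _ _ (odd (tval s a - i.+1)) _ _)) _ _;
      try lia; rewrite /st; try by regs.
    by store; rewrite -(subnSK lti) /=.
  have ca := comp_term (w := w) (leqW led) bl (ltac:(lia) : d.+1 + twidth a <= K) z1 bd.
  have e1 : upd s d.+1 (tval s a) = st (tval s a) by rewrite /st subnn; store.
  rewrite e1 in ca.
  apply: comp_to (comp_seq ca loop) _ _; last by lia.
  have -> : `[< den s (FOdd a) >] = odd (tval s a) by apply/asboolP/idP.
  by rewrite /st subn0; store.
- have c := IH d s led bl wff dK z bd s0 bz.
  rewrite den_not; have := fw g => ?; apply: comp_not_of c => //; lia.
- move: bl wff; rewrite /below all_cat => /andP[blg blh] /andP[wfg wfh].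
  have cg := IHg d s led blg wfg ltac:(lia) z bd s0 (fun x i => bz x ltac:(by rewrite mem_cat i)).
  have ch := IHh d s led blh wfh ltac:(lia) z bd s0 (fun x i => bz x ltac:(by rewrite mem_cat i orbT)).
  rewrite den_and; have := fw g => ?; apply: comp_and cg ch => //; lia.
- move: bl wff; rewrite /below all_cat => /andP[blg blh] /andP[wfg wfh].
  have cg := IHg d s led blg wfg ltac:(lia) z bd s0 (fun x i => bz x ltac:(by rewrite mem_cat i)).
  have ch := IHh d s led blh wfh ltac:(lia) z bd s0 (fun x i => bz x ltac:(by rewrite mem_cat i orbT)).
  have dK' : d < K by have := fw g; lia.
  have ng := comp_not_of dK' sd cg; have nh := comp_not_of dK' sd ch.
  rewrite den_or -[_ || _]negbK negb_or.
  exact: comp_not_of dK' sd (comp_and dK' sd ng nh).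
- move: bl wff; rewrite /below all_cat => /andP[blg blh] /andP[wfg wfh].
  have cg := IHg d s led blg wfg ltac:(lia) z bd s0 (fun x i => bz x ltac:(by rewrite mem_cat i)).
  have ch := IHh d s led blh wfh ltac:(lia) z bd s0 (fun x i => bz x ltac:(by rewrite mem_cat i orbT)).
  have dK' : d < K by have := fw g; lia.
  have nh := comp_not_of dK' sd ch.
  rewrite den_imp -[_ ==> _]negbK negb_imply.
  exact: comp_not_of dK' sd (comp_and dK' sd cg nh).
- have [nx0 xd0] := andP bl.
  move: wff => /and3P[x0 xb wfg].
  have body a (b : bool) : a <= V -> comp (cform K d.+1 g) w (upd (upd s x a) d b) w
      (upd (upd (upd s x a) d b) d.+1 `[< den (upd s x a) g >]) (fcost g V).
    move=> la; rewrite -(asbool_equiv_eq (@den_upd g (upd s x a) d b _ _)); try lia;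
      last by apply: below_notin xd0 led.
    apply: (quant_body (Q := fun t => comp (cform K d.+1 g) w t w
      (upd t d.+1 `[< den t g >]) (fcost g V)) led bl x0 xb z bd s0 bz (@bvars_sub g)) => // t ? ? ? ?.
    by apply: IH => //; lia.
  have := fw g => ?; rewrite den_ex.
  apply: comp_to (@comp_ex K d x _ w s (fun a => `[< den (upd s x a) g >]) (fcost g V)
    _ _ _ z _ _) (erefl _) _; [lia | lia | lia | by apply: bz; rewrite mem_head | |by rewrite s0].
  by move=> a b la; apply: body; rewrite -s0.
- have [nx0 xd0] := andP bl.
  move: wff => /and3P[x0 xb wfg]; have dK' : d < K by have := fw g; lia.
  have body a (b : bool) : a <= V -> comp (cform K d.+1 g) w (upd (upd s x a) d b) w
      (upd (upd (upd s x a) d b) d.+1 `[< den (upd s x a) g >]) (fcost g V).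
    move=> la; rewrite -(asbool_equiv_eq (@den_upd g (upd s x a) d b _ _)); try lia;
      last by apply: below_notin xd0 led.
    apply: (quant_body (Q := fun t => comp (cform K d.+1 g) w t w
      (upd t d.+1 `[< den t g >]) (fcost g V)) led bl x0 xb z bd s0 bz (@bvars_sub g)) => // t ? ? ? ?.
    by apply: IH => //; lia.
  rewrite den_all; apply: (comp_not_of dK' sd); have := fw g => ?.
  apply: comp_to (@comp_ex K d x _ w s (fun a => ~~ `[< den (upd s x a) g >]) (fcost g V + 3)
    _ _ _ z _ _) (erefl _) _; [lia | lia | lia | by apply: bz; rewrite mem_head | |by rewrite s0].
  move=> a b la; apply: comp_not_of; [lia | by regs; apply: z; lia |].
  by apply: body; rewrite -s0.
Qed.

(** * Reading the input *)

Section Bits.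

Definition bit (c i : nat) : bool := odd (c %/ 2 ^ i).

Lemma bit_small c k i : c < 2 ^ k -> k <= i -> bit c i = false.
Proof.
move=> lt le; rewrite /bit divn_small //.
by apply: leq_trans lt _; rewrite leq_exp2l.
Qed.

Lemma bit_add c k i : c < 2 ^ k -> bit (c + 2 ^ k) i = (i == k) || bit c i.
Proof.
move=> lt; case: (ltngtP i k) => [lti|lti|->] /=.
- have e : 2 ^ k = 2 ^ (k - i) * 2 ^ i by rewrite -expnD subnK // ltnW.
  rewrite /bit e addnC divnMDl ?expn_gt0 // oddD oddX /= subn_eq0 leqNgt lti.
  by [].
- rewrite !(@bit_small _ k.+1) //; last by rewrite expnS; lia.
  by rewrite expnS; lia.
- by rewrite /bit addnC -{1}[2 ^ k]mul1n divnMDl ?expn_gt0 // divn_small.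
Qed.

Lemma set_code (P : nat -> Prop) M : exists2 c, c < 2 ^ M &
  forall x, x < M -> bit c x <-> P x.
Proof.
elim: M => [|M [c lt H]]; first by exists 0.
case: (pselect (P M)) => PM.
  exists (c + 2 ^ M) => [|x]; first by rewrite expnS; lia.
  rewrite ltnS leq_eqVlt => /orP[/eqP ->|lx]; rewrite bit_add //.
    by rewrite eqxx; split.
  by rewrite (ltn_eqF lx); apply: H.
exists c => [|x]; first by rewrite expnS; lia.
rewrite ltnS leq_eqVlt => /orP[/eqP ->|]; last exact: H.
by rewrite (bit_small lt (leqnn M)).
Qed.

End Bits.

(** * Costs are polynomial in the quantifier bound *)

Section PolynomialCost.

Definition pbd (f : nat -> nat) := exists k, forall V, f V <= (V + 2) ^ k.

Lemma pbd_le f g : (forall V, f V <= g V) -> pbd g -> pbd f.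
Proof. by move=> le [k H]; exists k => V; apply: leq_trans (le V) (H V). Qed.

Lemma pbd_const c : pbd (fun=> c).
Proof.
exists c => V; apply: leq_trans (ltnW (ltn_expl c (ltnSn 1))) _.
by case: c => // c; rewrite leq_exp2r //; lia.
Qed.

Lemma pbd_id : pbd id.
Proof. by exists 1 => V; rewrite expn1; lia. Qed.

Lemma pbd_mul f g : pbd f -> pbd g -> pbd (fun V => f V * g V).
Proof. by move=> [j Hj] [k Hk]; exists (j + k) => V; rewrite expnD leq_mul. Qed.

Lemma pbd_add f g : pbd f -> pbd g -> pbd (fun V => f V + g V).
Proof.
move=> [j Hj] [k Hk]; exists (j + k).+1 => V.
have := Hj V; have := Hk V; have : 0 < (V + 2) ^ j by rewrite expn_gt0; lia.
have : 0 < (V + 2) ^ k by rewrite expn_gt0; lia.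
rewrite expnS expnD; nia.
Qed.

Lemma pbd_tbound t : pbd (tbound t).
Proof.
elim: t => [x|c|a IHa b IHb|a IHa b IHb|a IHa b IHb] /=.
- exact: pbd_id.
- exact: pbd_const.
- exact: pbd_add.
- exact: pbd_mul.
- exact: IHa.
Qed.

Ltac poly_bound := repeat first [exact: pbd_const | exact: pbd_id | assumption | exact: pbd_tbound
  | apply: pbd_add | apply: pbd_mul].

Lemma pbd_tcost t : pbd (tcost t).
Proof. by elim: t => [x|c|a IHa b IHb|a IHa b IHb|a IHa b IHb] /=; poly_bound. Qed.

Lemma pbd_fcost f : pbd (fcost f).
Proof.
elim: f => [a b|a|g IH|g IHg h IHh|g IHg h IHh|g IHg h IHh|x g IH|x g IH] /=;
  try (by poly_bound);
  try (have ? := pbd_tcost a; try have ? := pbd_tcost b; by poly_bound).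
- apply: (@pbd_le _ (fun V => (V * 10 + 2) + (2 + ((V + 1) * (fcost g V + 7) + 1)))); last by poly_bound.
  by move=> V; nia.
- apply: (@pbd_le _ (fun V => (V * 10 + 2) + (2 + ((V + 1) * (fcost g V + 10) + 1)) + 3)); last by poly_bound.
  by move=> V; nia.
Qed.

End PolynomialCost.

Lemma onth_rcons (T : Type) (w : seq T) b i :
  onth (rcons w b) i = if i == size w then Some b else onth w i.
Proof.
rewrite -cats1 onth_cat; case: ltngtP => [//|lt|->]; last by rewrite subnn.
by rewrite !onth_default //= ?subn_gt0 // ltnW.
Qed.

Definition wreg (a : token) := 2 + token_code a.

Lemma wreg_bound a : 1 < wreg a < 16.
Proof. by case: a => // -[]. Qed.

Lemma wreg_inj a b : wreg a = wreg b -> a = b.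
Proof. by move=> /(@addnI 2)/(pcan_inj token_codeK). Qed.

(** Register 16 starts at 1 and doubles, so it is the power of 2 belonging to the current position;
    adding it to [wreg a] sets that bit. *)
Definition record_sym (s : nat -> nat) (a : token) :=
  upd (upd (upd s 1 (s 1).+1) (wreg a) (s (wreg a) + s 16)) 16 (s 16 + s 16).

Lemma record_inv w : let s := foldl record_sym (upd (fun=> 0) 16 1) w in
  [/\ s 16 = 2 ^ size w, s 1 = size w,
    forall a, s (wreg a) < 2 ^ size w /\ forall i, bit (s (wreg a)) i = (onth w i == Some a) &
    forall r, r != 1 -> r != 16 -> (forall a, r != wreg a) -> s r = 0].
Proof.
elim/last_ind: w => [|w b [s16 s1 sW sO]] /=.
  split=> // [a|r r1 r16 _]; last by regs.
  have ? := wreg_bound a; rewrite (_ : upd _ 16 1 (wreg a) = 0); last by regs.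
  by split=> // i; rewrite /bit div0n onth0n.
rewrite foldl_rcons size_rcons; set s := foldl _ _ _ in s16 s1 sW sO *.
have wb a := wreg_bound a.
split; rewrite /record_sym.
- by rewrite upd_same s16 expnS; lia.
- by have ? := wb b; regs.
- move=> a; have ? := wb a; have [lt bits_a] := sW a.
  have -> : upd (upd (upd s 1 (s 1).+1) (wreg b) (s (wreg b) + s 16)) 16 (s 16 + s 16) (wreg a)
      = if a == b then s (wreg a) + 2 ^ size w else s (wreg a).
    rewrite -s16; case: (a =P b) => [->|nab]; have ? := wb b; first by regs.
    have ? : wreg a <> wreg b by move/wreg_inj.
    by regs.
  split=> [|i]; first by rewrite expnS; case: ifP; lia.
  rewrite onth_rcons; case: (a =P b) lt bits_a => [->|nab] lt bits_a.
    by rewrite bit_add // bits_a; case: (i =P size w) => //= _; rewrite eqxx.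
  case: (i =P size w) => [->|_]; last exact: bits_a.
  by rewrite (bit_small lt) //; apply/esym/eqP => -[]; congruence.
- move=> r r1 r16 rW; rewrite !updE.
  by rewrite (negbTE r16) (negbTE r1) (negbTE (rW b)); apply: sO.
Qed.

Section Reading.

Variable (K d : nat).
Hypothesis (d17 : 16 < d) (dK : d + 3 <= K).
Implicit Types (s : nat -> nat) (w : seq token).

Fixpoint select (l : seq token) : frag K :=
  if l is a :: l' then
    fif (reads a) (copy K 16 (wreg a) d) (select l')
  else fskip K.

Lemma comp_select l a w s : a \in l -> s d = 0 ->
  comp (select l) (a :: w) s (a :: w) (upd s (wreg a) (s (wreg a) + s 16))
    (s 16 * 10 + 2 + size l).
Proof.
move=> al sd; elim: l al => //= b l IH; rewrite inE => al.
have ? := wreg_bound b; rewrite addnS.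
apply: (comp_if (c := a == b)) => [T R|]; first by rewrite (reads_rep _ R) /=.
case: (a =P b) al => [-> _|_ /= /IH //].
by apply: comp_le (comp_copy _ _ _ _ _ _ _) => //; lia.
Qed.

Definition read : frag K :=
  fwhile (@nonblank K) (fseq (finc K 1) (fseq (select tokens)
    (fseq (fseq (copy K 16 d d.+1) (fmove K d 16)) (fnext K)))).

Lemma comp_read w s N : s d = 0 -> s d.+1 = 0 -> s 16 * 2 ^ size w <= N ->
  comp read w s [::] (foldl record_sym s w) (size w * (N * 24 + 30) + 1).
Proof.
elim: w s => [|a w IH] s sd sd1 leN T R.
  by exists T, 1; split=> //; apply: frun_while_false; rewrite (nonblank_rep R).
have ? := wreg_bound a.
have sz: size tokens = 14 by [].
have sN : s 16 <= N.
  by apply: leq_trans leN; rewrite leq_pmulr // expn_gt0.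
have at_tok : a \in tokens by case: (a) => // -[].
have cbody : comp (fseq (finc K 1) (fseq (select tokens)
    (fseq (fseq (copy K 16 d d.+1) (fmove K d 16)) (fnext K)))) (a :: w) s w (record_sym s a)
    (N * 24 + 29).
  apply: comp_to (comp_seq (comp_inc _) (comp_seq (comp_select at_tok _)
    (comp_seq (comp_seq (comp_copy _ _ _ _ _ _ _) (comp_fmove _ _ _)) (@comp_next K a w _)))) _ _;
    try lia; try (by regs).
    by rewrite /record_sym; store.
  by rewrite sz; regs.
have [T1 [t1 [h1 R1 l1]]] := cbody T R.
have [] := IH (record_sym s a) _ _ _ T1 R1; try by rewrite /record_sym; regs.
  move: leN; rewrite /record_sym upd_same [size _]/= expnS; nia.
move=> T2 [t2 [h2 R2 l2]]; exists T2, (t1 + t2).+1; split=> //.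
  by apply: frun_while_true h1 h2; rewrite (nonblank_rep R).
by rewrite [size _]/= mulSn; lia.
Qed.

End Reading.

(** * The clock and the decision procedure *)

Import GRing.Theory.

Section TowerProgram.

Variable K : nat.
Implicit Types (s : nat -> nat) (w : seq token).

Definition fpow2 d : frag K :=
  fseq (finc K d.+1) (fseq (fwhile (nz d) (fseq (fdec K d)
    (fseq (copy K d.+1 d.+2 d.+3) (fmove K d.+2 d.+1)))) (fmove K d.+1 d)).

Definition pow2_cost V := 2 + ((V * (V * 14 + 5) + 1) + (V * 4 + 1)).

Lemma comp_pow2 d w s V : d + 4 <= K -> zero_from d.+1 s -> 2 ^ s d <= V ->
  comp (fpow2 d) w s w (upd s d (2 ^ s d)) (pow2_cost V).
Proof.
move=> dK z leV; pose st i := upd (upd s d i) d.+1 (2 ^ (s d - i)).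
have sd1 := z d.+1 (leqnn _); have sd2 := z d.+2 (leqnSn _).
have sd3 := z d.+3 (leqW (leqnSn _)).
have loop : comp (fwhile (nz d) (fseq (fdec K d)
    (fseq (copy K d.+1 d.+2 d.+3) (fmove K d.+2 d.+1))))
    w (st (s d)) w (st 0) (s d * (V * 14 + 4).+1 + 1).
  apply: comp_for; [lia | move=> i lti; split | by rewrite /st; regs].
    by rewrite /st; regs.
  have le : 2 ^ (s d - i.+1) <= V by apply: leq_trans leV; rewrite leq_exp2l // leq_subr.
  have e2 : 2 ^ (s d - i) = 2 ^ (s d - i.+1) + 2 ^ (s d - i.+1).
    by rewrite -(subnSK lti) expnS; lia.
  apply: comp_to (comp_seq (comp_dec _ _) (comp_seq (comp_copy _ _ _ _ _ _ _)
    (comp_fmove _ _ _))) _ _; try lia; rewrite /st ?updE; split_ifs; try lia.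
  by store.
have e0 : upd s d.+1 (s d.+1).+1 = st (s d) by rewrite /st sd1 subnn; store.
have ci := comp_inc (s := s) (w := w) (ltac:(lia) : d.+1 < K); rewrite e0 in ci.
have lts := ltn_expl (s d) (ltnSn 1).
apply: comp_to (comp_seq ci (comp_seq loop (comp_fmove _ _ _))) _ _; try lia.
  by rewrite /st subn0; store.
rewrite (_ : st 0 d.+1 = 2 ^ s d) /pow2_cost; last by rewrite /st subn0; regs.
apply: leq_add => //; apply: leq_add; last by lia.
by rewrite leq_add2r leq_mul //; lia.
Qed.

Lemma comp_tower k d w s V : d + 4 <= K -> zero_from d.+1 s -> tower k (s d) <= V ->
  comp (iseq k (fpow2 d)) w s w (upd s d (tower k (s d))) (k * pow2_cost V + 1).
Proof.
move=> dK; elim: k s => [|k IH] s z.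
  by move=> _; apply: comp_to (@comp_skip K w s) _ _ => //=; store.
rewrite /tower iterSr -/(tower k _) => leV.
have le1 : 2 ^ s d <= V by apply: leq_trans leV; apply: tower_ge.
have z' : zero_from d.+1 (upd s d (2 ^ s d)).
  by move=> r lr; regs; apply: z.
apply: comp_to (comp_seq (comp_pow2 dK z le1) (IH _ z' _)) _ _.
- by rewrite upd_same.
- by rewrite upd_same; store.
- by rewrite mulSn addnA.
Qed.

End TowerProgram.

Fixpoint tpow (t : term) (c : nat) : term := if c is c'.+1 then TMul t (tpow t c') else TConst 1.

Lemma tval_tpow s t c : tval s (tpow t c) = tval s t ^ c.
Proof. by elim: c => //= c ->; rewrite expnS. Qed.

Lemma tvars_tpow t c : {subset tvars (tpow t c) <= tvars t}.
Proof. by elim: c => //= c IH x; rewrite mem_cat => /orP[|/IH]. Qed.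

Definition input_store (w : seq token) V :=
  upd (foldl record_sym (upd (fun=> 0) 16 1) w) 0 V.

Lemma init_rep K F ans w : rep (ctapes (init (@machine K F ans) w)) w (fun=> 0).
Proof.
split=> [|r rK]; rewrite tnth_mktuple ?eqxx.
  by rewrite /intape /input_tape; case: (pop _).
rewrite ifN; first by exists 0, 0.
by apply/eqP => /(congr1 val); rewrite /= inordK.
Qed.

Section Decision.

Variables (f : fo) (d c k : nat).
Hypotheses (d17 : 16 < d) (wff : wf f) (fd : below d (fvars f))
  (fb : all (fun x => 16 < x) (bvars f)) (k0 : 0 < k) (c0 : 0 < c).

Local Notation clock := (tpow (TAdd (TVar 1) (TConst 2)) c).
Local Notation K := (d + (4 + twidth clock + fwidth f)).

Definition prog : frag K :=
  fseq (finc K 16) (fseq (read K d) (fseq (cterm K d clock)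
    (fseq (iseq k (fpow2 K d)) (fseq (fmove K d 0) (cform K d f))))).

Definition prog_cost V := 2 + ((V * (V * 24 + 30) + 1) + (tcost clock V +
  ((k * pow2_cost V + 1) + ((V * 4 + 1) + fcost f V)))).

Lemma comp_prog w : let V := tower k ((size w + 2) ^ c) in
  comp prog w (fun=> 0) [::]
    (upd (input_store w V) d `[< den (input_store w V) f >]) (prog_cost V).
Proof.
move=> V; set s := foldl record_sym (upd (fun=> 0) 16 1) w.
have [s16 s1 sW sO] := record_inv w; rewrite -/s in s16 s1 sW sO.
(* The position sets are filled before the clock is computed; this keeps them below [V] too, so one
   bound serves for all costs. *)
have V2 : 2 ^ size w <= V.
  apply: leq_trans (tower_mono_l _ k0); rewrite [tower 1 _]/= leq_exp2l //.
  by case: (c) c0 => // c' _; rewrite expnS; have : 0 < (size w + 2) ^ c'; rewrite ?expn_gt0; nia.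
have Vn : size w <= V by apply: leq_trans (ltnW (ltn_expl _ (ltnSn 1))) V2.
have bd r : s r <= V.
  case: (r =P 1) => [->|/eqP r1]; first by rewrite s1.
  case: (r =P 16) => [->|/eqP r16]; first by rewrite s16.
  case: (pselect (exists a, r = wreg a)) => [[a ->]|nw].
    by have [lt _] := sW a; apply: leq_trans (ltnW lt) V2.
  by rewrite sO // => a; apply/eqP => e; apply: nw; exists a.
have z : zero_from d s.
  move=> r lr; apply: sO => [| |a]; try lia.
  by have := wreg_bound a; lia.
have s0 : s 0 = 0.
  by apply: sO => // a; have := wreg_bound a; lia.
have cread := @comp_read K d d17 ltac:(lia) w (upd (fun=> 0) 16 1) V
  ltac:(by regs) ltac:(by regs) ltac:(by rewrite upd_same mul1n).
have bc : below d (tvars clock).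
  by apply/allP => x /tvars_tpow /=; rewrite inE => /eqP ->; lia.
have cc := @comp_term K clock d d V [::] s (leqnn d) bc ltac:(lia) z (fun r _ => bd r).
have ec : tval s clock = (size w + 2) ^ c by rewrite tval_tpow /= s1.
rewrite ec in cc.
have ct := @comp_tower K k d [::] (upd s d ((size w + 2) ^ c)) V ltac:(lia)
  (zero_upd _ z) ltac:(by rewrite upd_same).
rewrite upd_same -/V in ct.
have e1 : upd (upd (upd (upd s d ((size w + 2) ^ c)) d V) d 0) 0
    (upd (upd s d ((size w + 2) ^ c)) d V 0 + upd (upd s d ((size w + 2) ^ c)) d V d)
    = input_store w V.
  by have zd := z d (leqnn d); rewrite /input_store -/s; store.
have cm := @comp_fmove K d 0 [::] (upd (upd s d ((size w + 2) ^ c)) d V)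
  ltac:(lia) ltac:(lia) ltac:(lia).
rewrite e1 upd_same in cm.
have cf := @comp_form K f d d V [::] (input_store w V) ltac:(lia) (leqnn d) fd wff ltac:(lia).
apply: comp_to (comp_seq (comp_inc _) (comp_seq cread (comp_seq cc (comp_seq ct
  (comp_seq cm (cf _ _ _ _)))))) (erefl _) _.
- by lia.
- by move=> r lr; rewrite /input_store -/s; regs; apply: z.
- by move=> r lr; rewrite /input_store -/s; regs; apply: bd.
- by rewrite /input_store; regs.
- move=> x /(allP fb) lx; rewrite /input_store -/s; regs.
  by apply: sO => [| |a]; try lia; have := wreg_bound a; lia.
rewrite /prog_cost !leq_add2l; apply: leq_add => //.
by rewrite leq_add2r leq_mul.
Qed.

(** The formula is fixed, so the cost is at most [(V + 2) ^ q], hence at most [V ^ (q * 2)] as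
    [V >= 2]. By [tower_exp] the power becomes a factor at the bottom of the tower; the exponent is
    raised by one to make that factor positive. *)
Lemma decided_by_formula (L : seq token -> Prop) :
  (forall w, L w <-> den (input_store w (tower k ((size w + 2) ^ c))) f) ->
  in_kNExpTime k L.
Proof.
move=> HL; have [q Hq] : pbd (fun V => prog_cost V + 1).
  have ? := pbd_tcost clock; have ? := pbd_fcost f.
  rewrite /prog_cost /pow2_cost.
  by repeat first [exact: pbd_const | exact: pbd_id | assumption | apply: pbd_add | apply: pbd_mul].
exists ((q * 2).+1%:P * ('X + 2%:P) ^+ c)%R, (machine prog (nz d)) => w.
have R0 := init_rep prog (nz d) w.
have [T [t [r R lt]]] := comp_prog R0.
have [h1 h2] := machine_halts r.
split=> [n c' /h1 ln|].
  have -> : (((q * 2).+1%:P * ('X + 2%:P) ^+ c : {poly nat})%R.[size w]%R =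
      (q * 2).+1 * (size w + 2) ^ c)%N.
    by rewrite hornerM horner_exp hornerD hornerX !hornerC natrXE.
  set V := tower k ((size w + 2) ^ c) in lt.
  have x0 : 0 < (size w + 2) ^ c by rewrite expn_gt0 addn2.
  have V2 : 2 <= V.
    apply: leq_trans (tower_mono_l _ k0).
    by rewrite [tower 1 _]/= -{1}(expn1 2) leq_exp2l.
  apply: leq_trans ln _; rewrite -addn1.
  apply: leq_trans (leq_add lt (leqnn 1)) _; apply: leq_trans (Hq V) _.
  apply: leq_trans (_ : V ^ (q * 2).+1 <= _).
    apply: leq_trans (_ : V ^ (q * 2) <= _); last by rewrite leq_exp2l.
    by rewrite mulnC expnM; case: (q) => // q'; rewrite leq_exp2r // expnS expn1; nia.
  by rewrite /V; case: (k) k0 => // k' _; exact: (tower_exp k' x0 (ltn0Sn _)).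
rewrite HL -h2 (nz_rep R) ?upd_same; last by lia.
by case: asboolP => h; split.
Qed.

End Decision.

(** * The certificate formula *)

(* Register 0 holds the quantifier bound, 1 the length of the input, [wreg a] the
   set of positions of the token [a] and 16 a power of 2.  From 17 on: the radix
   [Q] of codes of tuples, the size [N] of the model, [C = N ^ m], and codes of
   finite sets, namely the transitive relation, the other relations, the segments
   of the input denoting numbers and lists of variables, the parse tree, the truth
   table and the powers of [N]; 27 holds the index preceding the window of the
   variables in use.  An environment is the number whose base-[N] digits are the
   values of the variables, last one first. *)
Section CertificateFormula.

Local Notation Q := (TVar 17).
Local Notation N := (TVar 18).
Local Notation C := (TVar 19).
Local Notation At := (TVar 20).
Local Notation As := (TVar 21).
Local Notation Bt := (TVar 22).
Local Notation Vt := (TVar 23).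
Local Notation Pt := (TVar 24).
Local Notation Ht := (TVar 25).
Local Notation Pw := (TVar 26).
Local Notation win := (TVar 27).
Local Notation v := TVar.

Definition FEq a b := FAnd (FNot (FLt a b)) (FNot (FLt b a)).
Definition FLe a b := FNot (FLt b a).
Definition FIff f g := FAnd (FImp f g) (FImp g f).
Definition FExQ x f := FEx x (FAnd (FLt (v x) Q) f).
Definition FAllQ x f := FAll x (FImp (FLt (v x) Q) f).
Definition FMem t c := FOdd (TShr c t).
Definition FTok (a : token) t := FMem t (v (wreg a)).
Definition T2 a b := TAdd a (TMul Q b).
Definition T3 a b c := T2 a (T2 b c).
Definition T4 a b c d := T2 a (T3 b c d).
Definition TS t := TAdd t (TConst 1).

(** Terms have no exponentiation, so the pairs of [r] and [N ^ r] are guessed. As for the segments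
    and the parse tree, each member must be justified by another, while nothing forces members to be
    present; this suffices because the justifications descend. *)
Definition FPowers := FAllQ 30 (FAll 31 (FImp (FMem (T2 (v 30) (v 31)) Pw)
  (FOr (FAnd (FEq (v 30) (TConst 0)) (FEq (v 31) (TConst 1)))
       (FExQ 32 (FEx 33 (FAnd (FEq (v 30) (TS (v 32)))
          (FAnd (FEq (v 31) (TMul (v 33) N)) (FMem (T2 (v 32) (v 33)) Pw)))))))).

Definition FTrans := FAll 30 (FAll 31 (FAll 32
  (FImp (FLt (v 30) N) (FImp (FLt (v 31) N) (FImp (FLt (v 32) N)
  (FImp (FMem (TAdd (v 31) (TMul N (v 30))) At)
  (FImp (FMem (TAdd (v 32) (TMul N (v 31))) At)
        (FMem (TAdd (v 32) (TMul N (v 30))) At)))))))).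

(** Requiring a positive number at each digit excludes a most significant digit 0, so only canonical
    notation is recognized. *)
Definition FBits := FAllQ 30 (FAllQ 31 (FAllQ 32 (FImp (FMem (T3 (v 30) (v 31) (v 32)) Bt)
  (FOr (FAnd (FEq (v 30) (v 31)) (FEq (v 32) (TConst 0)))
    (FExQ 33 (FAnd
      (FOr (FAnd (FTok (tBit false) (v 30)) (FEq (v 32) (TAdd (v 33) (v 33))))
           (FAnd (FTok (tBit true) (v 30)) (FEq (v 32) (TS (TAdd (v 33) (v 33))))))
      (FAnd (FLt (TConst 0) (v 32)) (FMem (T3 (TS (v 30)) (v 31) (v 33)) Bt)))))))).

Definition FVars := FAllQ 30 (FAllQ 31 (FAllQ 32 (FAllQ 33
  (FImp (FMem (T4 (v 30) (v 31) (v 32) (v 33)) Vt)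
  (FOr (FAnd (FEq (v 30) (v 31)) (FEq (v 32) (TS (v 33))))
    (FAnd (FLe (v 32) (v 33)) (FAnd (FTok tVar (v 30))
    (FExQ 34 (FAnd (FLt (v 30) (v 34)) (FAnd (FLt (TS (v 32)) Q)
       (FAnd (FMem (T3 (TS (v 30)) (v 34) (v 32)) Bt)
       (FMem (T4 (v 34) (v 31) (TS (v 32)) (v 33)) Vt)))))))))))).

(* Variables 30, 31 and 32 hold the start, the end and the level of a node of the
   parse tree, and 33 an environment. *)
Definition FTruth f := FAll 33 (FImp (FLt (v 33) C)
  (FIff (FMem (T4 (v 30) (v 31) (v 32) (v 33)) Ht) f)).

Definition FConst (a : token) f :=
  FAnd (FTok a (v 30)) (FAnd (FEq (v 31) (TS (v 30))) (FTruth f)).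

(* Variable 37 is the code of the last [r] values of the environment 33, [p]
   being [N ^ r]. *)
Definition FLast p f := FEx 36 (FEx 37 (FAnd (FEq (v 33) (TAdd (TMul (v 36) p) (v 37)))
  (FAnd (FLt (v 37) p) f))).

Definition FTransAtom := FAnd (FTok tTrans (v 30)) (FExQ 34 (FAnd (FLt win (v 34))
  (FAnd (FEq (v 32) (TS (v 34))) (FAnd (FMem (T4 (TS (v 30)) (v 31) (v 34) (v 32)) Vt)
    (FTruth (FLast (TMul N N) (FMem (v 37) At))))))).

Definition FRelAtom := FAnd (FTok tRel (v 30)) (FExQ 34 (FExQ 35 (FExQ 38 (FExQ 39 (FEx 40
  (FAnd (FLt (v 30) (v 34)) (FAnd (FMem (T3 (TS (v 30)) (v 34) (v 35)) Bt)
  (FAnd (FMem (T4 (v 34) (v 31) (v 38) (v 32)) Vt) (FAnd (FLt win (v 38))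
  (FAnd (FEq (TS (v 32)) (TAdd (v 38) (v 39))) (FAnd (FMem (T2 (v 39) (v 40)) Pw)
    (FTruth (FLast (v 40) (FMem (T3 (v 35) (v 39) (v 37)) As)))))))))))))).

Definition FNegNode := FAnd (FTok tNeg (v 30)) (FAnd (FMem (T3 (TS (v 30)) (v 31) (v 32)) Pt)
  (FTruth (FNot (FMem (T4 (TS (v 30)) (v 31) (v 32) (v 33)) Ht)))).

Definition FBinNode (a : token) (op : fo -> fo -> fo) := FAnd (FTok a (v 30)) (FExQ 34
  (FAnd (FLt (v 30) (v 34)) (FAnd (FMem (T3 (TS (v 30)) (v 34) (v 32)) Pt)
  (FAnd (FMem (T3 (v 34) (v 31) (v 32)) Pt)
  (FTruth (op (FMem (T4 (TS (v 30)) (v 34) (v 32) (v 33)) Ht)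
              (FMem (T4 (v 34) (v 31) (v 32) (v 33)) Ht))))))).

Definition FQuantNode m (a : token) (quant : fo -> fo) := FAnd (FTok a (v 30))
  (FAnd (FTok tVar (TS (v 30))) (FAnd (FLt (v 32) (TAdd win (TConst m))) (FExQ 34
  (FAnd (FLt (v 30) (v 34)) (FAnd (FLt (TS (v 32)) Q)
  (FAnd (FMem (T3 (TS (TS (v 30))) (v 34) (TS (v 32))) Bt)
  (FAnd (FMem (T3 (v 34) (v 31) (TS (v 32))) Pt)
  (FTruth (quant (FMem (T4 (v 34) (v 31) (TS (v 32)) (TAdd (v 36) (TMul N (v 33)))) Ht)))))))))).

Definition FParse m := FAllQ 30 (FAllQ 31 (FAllQ 32 (FImp (FMem (T3 (v 30) (v 31) (v 32)) Pt)
  (FOr (FConst tBot (FLt (TConst 0) (TConst 0)))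
  (FOr (FConst tTop (FLt (TConst 0) (TConst 1)))
  (FOr FTransAtom (FOr FRelAtom (FOr FNegNode
  (FOr (FBinNode tAnd FAnd) (FOr (FBinNode tOr FOr) (FOr (FBinNode tImp FImp)
  (FOr (FBinNode tIff FIff)
  (FOr (FQuantNode m tEx (fun f => FEx 36 (FAnd (FLt (v 36) N) f)))
       (FQuantNode m tAll (fun f => FAll 36 (FImp (FLt (v 36) N) f)))))))))))))))).

Definition FRoot m := FExQ 30 (FExQ 31 (FEx 32 (FEx 33
  (FAnd (FEq (v 30) (TAdd win (v 31))) (FAnd (FLe (v 31) (TConst m))
  (FAnd (FMem (T2 (v 31) (v 32)) Pw) (FAnd (FLt (v 33) (v 32))
  (FAnd (FMem (T3 (TConst 0) (v 1) (v 30)) Pt)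
        (FMem (T4 (TConst 0) (v 1) (v 30) (v 33)) Ht))))))))).

Definition FCert m := FEx 17 (FEx 18 (FEx 19 (FEx 20 (FEx 21 (FEx 22 (FEx 23 (FEx 24 (FEx 25
  (FEx 26 (FEx 27 (FAnd (FLt (v 1) Q) (FAnd (FLt (TConst 0) N) (FAnd (FLt (TConst m) Q)
  (FAnd (FMem (T2 (TConst m) C) Pw) (FAnd FPowers (FAnd FTrans (FAnd FBits (FAnd FVars
  (FAnd (FParse m) (FRoot m)))))))))))))))))))).

Lemma FCert_wf m : wf (FCert m) && all (fun x => 16 < x) (bvars (FCert m)).
Proof. by []. Qed.

Lemma FCert_below m : below 41 (fvars (FCert m)).
Proof. by []. Qed.

End CertificateFormula.

(* The denotation of [FCert], written so that the two agree by computation;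
   this is why equality and [<=] are spelled with negations. *)
Section Certificate.

Variables (V n m : nat) (W : token -> nat).

Definition eqp (x y : nat) : Prop := ~ x < y /\ ~ y < x.
Definition lep (x y : nat) : Prop := ~ y < x.
Definition iffp (A B : Prop) := (A -> B) /\ (B -> A).
Definition exb (P : nat -> Prop) := exists a, a <= V /\ P a.
Definition allb (P : nat -> Prop) := forall a, a <= V -> P a.
Definition tok a i : Prop := bit (W a) i.

Variables (Q N C At As Bt Vt Pt Ht Pw win : nat).

Definition exq (P : nat -> Prop) := exb (fun a => a < Q /\ P a).
Definition allq (P : nat -> Prop) := allb (fun a => a < Q -> P a).
Definition t2 a b := a + Q * b.
Definition t3 a b c := t2 a (t2 b c).
Definition t4 a b c d := t2 a (t3 b c d).

Definition cpowers := allq (fun r => allb (fun p => bit Pw (t2 r p) ->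
  eqp r 0 /\ eqp p 1 \/ exq (fun r' => exb (fun p' =>
    eqp r (r' + 1) /\ eqp p (p' * N) /\ bit Pw (t2 r' p'))))).

Definition ctrans := allb (fun x => allb (fun y => allb (fun z => x < N -> y < N -> z < N ->
  bit At (y + N * x) -> bit At (z + N * y) -> bit At (z + N * x)))).

Definition cbits := allq (fun i => allq (fun j => allq (fun x => bit Bt (t3 i j x) ->
  eqp i j /\ eqp x 0 \/ exq (fun y =>
    (tok (tBit false) i /\ eqp x (y + y) \/ tok (tBit true) i /\ eqp x (y + y + 1)) /\
    (0 < x /\ bit Bt (t3 (i + 1) j y)))))).

Definition cvars := allq (fun i => allq (fun j => allq (fun l => allq (fun k =>
  bit Vt (t4 i j l k) -> eqp i j /\ eqp l (k + 1) \/
    (lep l k /\ tok tVar i /\ exq (fun i' => i < i' /\ l + 1 < Q /\ bit Bt (t3 (i + 1) i' l) /\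
      bit Vt (t4 i' j (l + 1) k))))))).

(** An equivalence, in contrast to the one-sided conditions on the other sets: under a negation,
    absent entries of the table count as well. *)
Definition ctruth i j k (P : nat -> Prop) :=
  allb (fun c => c < C -> iffp (bit Ht (t4 i j k c)) (P c)).

Definition cconst a i j k P := tok a i /\ eqp j (i + 1) /\ ctruth i j k P.

Definition clast p c (P : nat -> Prop) := exb (fun q => exb (fun e =>
  eqp c (q * p + e) /\ e < p /\ P e)).

Definition ctransatom i j k := tok tTrans i /\ exq (fun l => win < l /\ eqp k (l + 1) /\
  bit Vt (t4 (i + 1) j l k) /\
  ctruth i j k (fun c => clast (N * N) c (fun e => bit At e))).

Definition crelatom i j k := tok tRel i /\ exq (fun i' => exq (fun x => exq (fun l =>
  exq (fun r => exb (fun p => i < i' /\ bit Bt (t3 (i + 1) i' x) /\ bit Vt (t4 i' j l k) /\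
  win < l /\ eqp (k + 1) (l + r) /\ bit Pw (t2 r p) /\
  ctruth i j k (fun c => clast p c (fun e => bit As (t3 x r e)))))))).

Definition cneg i j k := tok tNeg i /\ bit Pt (t3 (i + 1) j k) /\
  ctruth i j k (fun c => ~ bit Ht (t4 (i + 1) j k c)).

Definition cbin a (op : Prop -> Prop -> Prop) i j k := tok a i /\ exq (fun i' => i < i' /\
  bit Pt (t3 (i + 1) i' k) /\ bit Pt (t3 i' j k) /\
  ctruth i j k (fun c => op (bit Ht (t4 (i + 1) i' k c)) (bit Ht (t4 i' j k c)))).

Definition cquant a (quant : (nat -> Prop) -> Prop) i j k := tok a i /\ tok tVar (i + 1) /\
  k < win + m /\ exq (fun i' => i < i' /\ k + 1 < Q /\ bit Bt (t3 (i + 1 + 1) i' (k + 1)) /\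
  bit Pt (t3 i' j (k + 1)) /\
  ctruth i j k (fun c => quant (fun d => bit Ht (t4 i' j (k + 1) (d + N * c))))).

Definition cnode i j k :=
  cconst tBot i j k (fun=> 0 < 0) \/ cconst tTop i j k (fun=> 0 < 1) \/
  ctransatom i j k \/ crelatom i j k \/ cneg i j k \/
  cbin tAnd and i j k \/ cbin tOr or i j k \/ cbin tImp (fun A B => A -> B) i j k \/
  cbin tIff iffp i j k \/
  cquant tEx (fun P => exb (fun d => d < N /\ P d)) i j k \/
  cquant tAll (fun P => allb (fun d => d < N -> P d)) i j k.

Definition cparse := allq (fun i => allq (fun j => allq (fun k =>
  bit Pt (t3 i j k) -> cnode i j k))).

Definition croot := exq (fun k => exq (fun r => exb (fun p => exb (fun c =>
  eqp k (win + r) /\ lep r m /\ bit Pw (t2 r p) /\ c < p /\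
  bit Pt (t3 0 n k) /\ bit Ht (t4 0 n k c))))).

Definition cert_body := n < Q /\ 0 < N /\ m < Q /\ bit Pw (t2 m C) /\ cpowers /\ ctrans /\
  cbits /\ cvars /\ cparse /\ croot.

End Certificate.

Definition cert V n m W := exb V (fun Q => exb V (fun N => exb V (fun C => exb V (fun At =>
  exb V (fun As => exb V (fun Bt => exb V (fun Vt => exb V (fun Pt => exb V (fun Ht =>
  exb V (fun Pw => exb V (fun win =>
    cert_body V n m W Q N C At As Bt Vt Pt Ht Pw win))))))))))).

Lemma den_FCert s m : den s (FCert m) = cert (s 0) (s 1) m (fun a => s (wreg a)).
Proof. reflexivity. Qed.

(** * Soundness of certificates *)

Section Digits.

Variables (D : Type) (nu : nat -> D) (N : nat).
Hypothesis N0 : 0 < N.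

Fixpoint digs j c : seq D :=
  if j is j'.+1 then nu (c %% N) :: digs j' (c %/ N) else [::].

Lemma size_digs j c : size (digs j c) = j.
Proof. by elim: j c => //= j IH c; rewrite IH. Qed.

Lemma take_digs i j c : i <= j -> take i (digs j c) = digs i c.
Proof. by elim: i j c => [|i IH] [|j] c //=; rewrite ?take0 // ltnS => /IH ->. Qed.

Lemma digs_push j d c : d < N -> digs j.+1 (d + N * c) = nu d :: digs j c.
Proof.
move=> dN; rewrite /= [d + _]addnC [N * c]mulnC modnMDl modn_small //.
by rewrite divnMDl // divn_small // addn0.
Qed.

Lemma modn_digit c p : c %% (N * p) = c %% N + N * (c %/ N %% p).
Proof.
case: (posnP p) => [->|p0]; first by rewrite muln0 !modn0 addnC mulnC -divn_eq.
have lt1 := ltn_pmod c N0; have lt2 := ltn_pmod (c %/ N) p0.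
rewrite {1}(divn_eq c N) {1}(divn_eq (c %/ N) p).
set q := c %/ N %/ p; set r := c %/ N %% p in lt2 *; set e := c %% N in lt1 *.
rewrite (_ : (q * p + r) * N + e = q * (N * p) + (e + N * r)); last by nia.
by rewrite modnMDl modn_small //; nia.
Qed.

Lemma digs_mod j c : digs j (c %% N ^ j) = digs j c.
Proof.
elim: j c => //= j IH c; rewrite expnS modn_digit.
by rewrite [c %% N + _]addnC [N * _]mulnC modnMDl modn_mod divnMDl // (divn_small (ltn_pmod c N0)) addn0 IH.
Qed.

Lemma digs_onto (s : seq D) : (forall d, exists2 x, x < N & nu x = d) ->
  exists2 c, c < N ^ size s & digs (size s) c = s.
Proof.
move=> onto; elim: s => [|d s [c lt e]]; first by exists 0.
have [x xN xd] := onto d; exists (x + N * c); first by rewrite /= expnS; nia.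
by rewrite [size _]/= digs_push // e xd.
Qed.

End Digits.

Definition dcode N (s : seq 'I_N) := foldr (fun (a : 'I_N) acc => a + N * acc) 0 s.

Lemma dcode_digs N' j c : dcode (digs (@inord N') N'.+1 j c) = c %% N'.+1 ^ j.
Proof.
elim: j c => [|j IH] c; first by rewrite expn0 modn1.
by rewrite /= -/(dcode _) IH inordK ?ltn_pmod // expnS modn_digit.
Qed.

Section Encoding.

Lemma bits0 : bits 0 = [::]. Proof. by []. Qed.

Lemma bits_of_pos p : bits (nat_of_pos p) = map tBit (pos_bits p).
Proof. by rewrite /bits -[nat_of_pos p]/(nat_of_bin (BinNums.Npos p)) nat_of_binK. Qed.

Lemma pos_of n : 0 < n -> exists p, n = nat_of_pos p.
Proof. by rewrite -[n]bin_of_natK; case: (bin_of_nat n) => [|p] // _; exists p. Qed.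

Lemma bits_double y : 0 < y -> bits (y + y) = tBit false :: bits y.
Proof.
move=> /pos_of[p ->]; have -> : nat_of_pos p + nat_of_pos p = nat_of_pos (BinNums.xO p).
  by rewrite /= natTrecE addnn.
by rewrite !bits_of_pos.
Qed.

Lemma bits_doubleS y : bits (y + y + 1) = tBit true :: bits y.
Proof.
case: (posnP y) => [->//|/pos_of[p ->]].
have -> : nat_of_pos p + nat_of_pos p + 1 = nat_of_pos (BinNums.xI p).
  by rewrite /= natTrecE addnn addn1.
by rewrite !bits_of_pos.
Qed.

End Encoding.

Lemma eqpE x y : eqp x y <-> x = y.
Proof. rewrite /eqp; split; lia. Qed.

Lemma lepE x y : lep x y <-> x <= y.
Proof. rewrite /lep; split; lia. Qed.

Lemma lep_leq x y : lep x y -> x <= y.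
Proof. by rewrite lepE. Qed.

Lemma onth_drop (T : Type) (w : seq T) i a : onth w i = Some a -> drop i w = a :: drop i.+1 w.
Proof. by elim: w i => [|b w IH] [|i] //= => [[->]|/IH //]; rewrite drop0. Qed.

Section Soundness.

Variables (V m : nat) (w : seq token) (W : token -> nat).
Hypothesis W_w : forall a i, bit (W a) i = (onth w i == Some a).

Variables (Q N' C At As Bt Vt Pt Ht Pw win : nat).
Local Notation N := N'.+1.
Local Notation n := (size w).
Hypotheses (QV : Q <= V) (CV : C <= V) (NV : N <= V).
Hypothesis body : cert_body V n m W Q N C At As Bt Vt Pt Ht Pw win.

Lemma tok_drop a i : tok W a i -> i < n /\ drop i w = a :: drop i.+1 w.
Proof.
rewrite /tok W_w => /eqP e; split; last exact: onth_drop.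
by have := onthTE w i; rewrite e => <-.
Qed.

Lemma allqE P : allq V Q P -> forall a, a < Q -> P a.
Proof. by move=> H a lt; apply: H => //; lia. Qed.

Lemma powers_sound r p : r < Q -> p <= V -> bit Pw (t2 Q r p) -> p = N ^ r.
Proof.
have [_ [_ [_ [_ [H _]]]]] := body.
elim: r p => [|r IH] p rQ pV /(allqE H rQ p pV) [[]|[r' [_ [r'Q [p' [p'V [/eqpE e [/eqpE -> h]]]]]]]].
- by move=> _ /eqpE.
- by move: e; rewrite addn1.
- by move=> /eqpE.
- move: e h r'Q; rewrite addn1 => -[<-] h r'Q.
  by rewrite (IH _ r'Q p'V h) expnSr.
Qed.

(** Induction on [n - i]: every justification other than the empty segment reads a token at [i], so
    justifications move towards the end of the input and cannot be circular. *)
Lemma bits_sound i j x : i < Q -> j < Q -> x < Q -> bit Bt (t3 Q i j x) ->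
  drop i w = bits x ++ drop j w.
Proof.
have [_ [_ [_ [_ [_ [_ [H _]]]]]]] := body.
have [k] := ubnP (n - i); elim: k i x => // k IH i x lek iQ jQ xQ /(allqE (allqE (allqE H iQ) jQ) xQ).
case=> [[/eqpE -> /eqpE ->]//|[y [_ [yQ [xy [x0 h]]]]]].
have step b : tok W (tBit b) i -> drop i w = tBit b :: bits y ++ drop j w.
  move=> /tok_drop[lti ->]; congr cons; rewrite addn1 in h.
  case: (ltnP i.+1 Q) => [iQ'|?]; first by apply: IH => //; lia.
  by have [nQ _] := body; lia.
case: xy => -[/step -> /eqpE ex]; rewrite ex.
  by rewrite bits_double //; lia.
by rewrite bits_doubleS.
Qed.

Lemma vars_sound i j l k : i < Q -> j < Q -> l < Q -> k < Q -> bit Vt (t4 Q i j l k) ->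
  drop i w = flatten (map enc_var (iota l (k.+1 - l))) ++ drop j w.
Proof.
have [nQ [_ [_ [_ [_ [_ [_ [H _]]]]]]]] := body.
have [b] := ubnP (n - i); elim: b i l => // b IH i l leb iQ jQ lQ kQ.
move=> /(allqE (allqE (allqE (allqE H iQ) jQ) lQ) kQ).
case=> [[/eqpE -> /eqpE ->]|[/lep_leq lk [/tok_drop[lti ->] [i' [_ [i'Q [lti' [lQ' [hb hv]]]]]]]]].
  by rewrite addn1 subnn.
rewrite subSn //; set F := flatten (map enc_var (iota l.+1 (k - l))).
rewrite -[RHS]/(tVar :: (bits l ++ F) ++ drop j w) -catA; congr cons; rewrite {}/F.
rewrite !addn1 in hb hv lQ'; rewrite (bits_sound _ i'Q lQ hb); last by lia.
by rewrite (IH i' l.+1) ?subSS //; lia.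
Qed.

(** The reversal makes the last argument the least significant digit, as in environments; an atom of
    arity [r] then reads the environment modulo [N ^ r]. *)
Definition decoded : structure std_sig 'I_N := fun P xs =>
  match P with
  | Trans => bit At (dcode (rev xs))
  | Rel R => bit As (t3 Q R.1 R.2 (dcode (rev xs)))
  end.

Local Notation env j c := (digs (@inord N') N j c).

Lemma decoded_trans : trans_interp decoded.
Proof.
have [_ [_ [_ [_ [_ [H _]]]]]] := body.
move=> x y z; rewrite /decoded /= !muln0 !addn0.
have lt (u : 'I_N) : u <= V by apply: leq_trans NV; apply: ltnW.
exact: (H x (lt x) y (lt y) z (lt z)).
Qed.

Lemma clastE p c P : 0 < p -> c <= V -> clast V p c P <-> P (c %% p).
Proof.
move=> p0 cV; split=> [[q [_ [e [_ [/eqpE -> [ep Pe]]]]]]|Pc].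
  by rewrite modnMDl modn_small.
exists (c %/ p); split; first by apply: leq_trans (leq_div _ _) cV.
exists (c %% p); split; first by apply: leq_trans (leq_mod _ _) cV.
by split; [apply/eqpE/divn_eq | rewrite ltn_pmod].
Qed.

Lemma decoded_AL P j c : arity P <= j ->
  AL decoded P (rev (take (arity P) (env j c))) <->
  match P with
  | Trans => bit At (c %% N ^ 2)
  | Rel R => bit As (t3 Q R.1 R.2 (c %% N ^ R.2))
  end.
Proof.
move=> le; rewrite take_digs // -/(AL _ _ _).
have e : dcode (rev (rev (env (arity P) c))) = c %% N ^ arity P by rewrite revK dcode_digs.
have sz : size (rev (env (arity P) c)) == arity P by rewrite size_rev size_digs.
case: P {le} e sz => [|R] e sz.
  split=> [[xs exs]|h]; first by rewrite /= exs e.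
  by rewrite -e in h; exists (Tuple sz).
split=> [[xs exs]|h]; first by rewrite /= exs e.
by rewrite -[R.2]/(arity (Rel R)) -e in h; exists (Tuple sz).
Qed.

Lemma C_pow : C = N ^ m.
Proof. by have [_ [_ [mQ [h _]]]] := body; apply: powers_sound mQ CV h. Qed.

Lemma ctruthE i j k P : ctruth V Q C Ht i j k P -> win <= k <= win + m ->
  forall c, c < N ^ (k - win) -> (bit Ht (t4 Q i j k c) <-> P c) /\ c <= V.
Proof.
move=> H kw c lt; have ltC : c < C.
  by apply: leq_trans lt _; rewrite C_pow leq_pexp2l //; lia.
have cV : c <= V by lia.
by have [h1 h2] := H c cV ltC; split.
Qed.

Definition node_ok i j k f := [/\ drop i w = encode f ++ drop j w, fluted k f,
  in_window win (win + m) f &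
  forall c, c < N ^ (k - win) -> bit Ht (t4 Q i j k c) <-> hs decoded (env (k - win) c) f].

Lemma atom_ok i j k (P : predicate std_sig) l : win <= k <= win + m ->
  win < l -> l <= k.+1 -> k.+1 - l = arity P ->
  drop i w = enc_pred P ++ flatten (map enc_var (iota l (k.+1 - l))) ++ drop j w ->
  (forall c, c < N ^ (k - win) -> bit Ht (t4 Q i j k c) <->
     match P with
     | Trans => bit At (c %% N ^ 2)
     | Rel R => bit As (t3 Q R.1 R.2 (c %% N ^ R.2))
     end) ->
  exists f, node_ok i j k f.
Proof.
move=> kw wl lk ar dr H.
have sz : size (iota l (k.+1 - l)) == arity P by rewrite size_iota ar.
exists (Atom (Tuple sz)); split.
- by rewrite /= -catA.
- by apply: (@fluted_atom _ k l) => //; lia.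
- by apply/allP => x; rewrite mem_iota; lia.
- move=> c lt; rewrite H // [hs _ _ _]/= -/(AL _ _ _) decoded_AL //; lia.
Qed.

(** Children of a node start strictly to its right, so induction on [n - i] rebuilds the formula
    together with its level, its window and the correctness of its row of the truth table. *)
Lemma parse_sound i j k : i < Q -> j < Q -> k < Q -> win <= k <= win + m ->
  bit Pt (t3 Q i j k) -> exists f, node_ok i j k f.
Proof.
have [nQ [_ [_ [_ [_ [_ [_ [_ [H _]]]]]]]]] := body.
have [b] := ubnP (n - i); elim: b i j k => // b IH i j k leb iQ jQ kQ kw.
move=> /(allqE (allqE (allqE H iQ) jQ) kQ); rewrite /cnode.
case=> [[/tok_drop[lti dr] [/eqpE ej tr]]|].
  exists Bot; split=> //.
  - by rewrite dr ej addn1.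
  - exact: fluted_bot.
  - by move=> c /(ctruthE tr kw)[-> _].
case=> [[/tok_drop[lti dr] [/eqpE ej tr]]|].
  exists Top; split=> //.
  - by rewrite dr ej addn1.
  - exact: fluted_top.
  - by move=> c /(ctruthE tr kw)[-> _].
case=> [[/tok_drop[lti dr] [l [_ [lQ [wl [/eqpE el [hv tr]]]]]]]|].
  rewrite addn1 in hv; have {}hv := vars_sound (ltac:(lia) : i.+1 < Q) jQ lQ kQ hv.
  apply: (@atom_ok i j k Trans l) => //; try lia; first by rewrite el /=; lia.
    by rewrite dr hv.
  by move=> c /(ctruthE tr kw)[-> cV]; rewrite -mulnn clastE ?muln_gt0.
case=> [[/tok_drop[lti dr] [i' [_ [i'Q [x [_ [xQ [l [_ [lQ [r [_ [rQ [p [pV hr]]]]]]]]]]]]]]]|].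
  have [ii' [hb [hv [wl [/eqpE el [hp tr]]]]]] := hr.
  rewrite addn1 in hb; have {}hv := vars_sound i'Q jQ lQ kQ hv.
  have {}hb := bits_sound (ltac:(lia) : i.+1 < Q) i'Q xQ hb.
  have {}hp := powers_sound rQ pV hp.
  apply: (@atom_ok i j k (@Rel std_sig (x, r)) l kw wl) => //; try lia.
  - by rewrite /=; lia.
  - by rewrite dr hb hv.
  - by move=> c /(ctruthE tr kw)[-> cV]; rewrite hp clastE ?expn_gt0.
case=> [[/tok_drop[lti dr] [hp tr]]|].
  rewrite addn1 in hp tr.
  have [g [dg fg wg hg]] := IH i.+1 j k ltac:(lia) ltac:(lia) jQ kQ kw hp.
  exists (Neg g); split=> //; [by rewrite dr dg | by constructor | ].
  by move=> c lt; have [-> _] := ctruthE tr kw lt; rewrite /= -hg.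
have bin a (op : Prop -> Prop -> Prop) (F : formula std_sig -> formula std_sig -> formula std_sig) :
    (forall g h, encode (F g h) = a :: encode g ++ encode h) ->
    (forall g h, fluted k g -> fluted k h -> fluted k (F g h)) ->
    (forall g h, variables (F g h) = variables g ++ variables h) ->
    (forall s g h, hs decoded s (F g h) <-> op (hs decoded s g) (hs decoded s h)) ->
    (forall A1 A2 B1 B2, (A1 <-> A2) -> (B1 <-> B2) -> (op A1 B1 <-> op A2 B2)) ->
    cbin V W Q C Pt Ht a op i j k -> exists f, node_ok i j k f.
  move=> ee ef ev eh ep [/tok_drop[lti dr] [i' [_ [i'Q [ii' [h1 [h2 tr]]]]]]].
  rewrite addn1 in h1 tr.
  have [g [dg fg wg hg]] := IH i.+1 i' k ltac:(lia) ltac:(lia) i'Q kQ kw h1.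
  have [h [dh fh wh hh]] := IH i' j k ltac:(lia) i'Q jQ kQ kw h2.
  exists (F g h); split.
  - by rewrite ee dr dg dh /= catA.
  - exact: ef.
  - by rewrite /in_window ev all_cat; apply/andP.
  - move=> c lt; have [-> _] := ctruthE tr kw lt; rewrite eh.
    by apply: ep; [exact: hg | exact: hh].
case=> [/(bin tAnd and (@And _)) H1|].
  by apply: H1 => //; [by constructor | tauto].
case=> [/(bin tOr or (@Or _)) H1|].
  by apply: H1 => //; [by constructor | tauto].
case=> [/(bin tImp (fun A B => A -> B) (@Imp _)) H1|].
  by apply: H1 => //; [by constructor | tauto].
case=> [/(bin tIff iffp (@Iff _)) H1|].
  by apply: H1 => //; [by constructor | rewrite /iffp; tauto].
have quant a (q : (nat -> Prop) -> Prop) (F : nat -> formula std_sig -> formula std_sig) :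
    (forall x g, encode (F x g) = a :: enc_var x ++ encode g) ->
    (forall g, fluted k.+1 g -> fluted k (F k.+1 g)) ->
    (forall x g, variables (F x g) = x :: variables g) ->
    (forall s x g, hs decoded s (F x g) <->
       q (fun d => hs decoded ((inord d : 'I_N) :: s) g)) ->
    (forall P R : nat -> Prop, (forall d, d < N -> P d <-> R d) -> q P <-> q R) ->
    cquant V m W Q N C Bt Pt Ht win a q i j k -> exists f, node_ok i j k f.
  move=> ee ef ev eh ep [/tok_drop[lti dr] [/tok_drop[lti1 dr1] [kwm [i' [_ [i'Q
    [ii' [kQ1 [hb [hp tr]]]]]]]]]].
  rewrite !addn1 in lti1 dr1 kQ1 hb hp tr.
  have {}hb := bits_sound (ltac:(lia) : i.+2 < Q) i'Q kQ1 hb.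
  have [g [dg fg wg hg]] := IH i' j k.+1 ltac:(lia) i'Q jQ kQ1 ltac:(lia) hp.
  exists (F k.+1 g); split.
  - by rewrite ee dr dr1 hb dg /= catA.
  - exact: ef.
  - by rewrite /in_window ev /= -/(in_window win (win + m) g) wg andbT; lia.
  - move=> c lt; have [-> _] := ctruthE tr kw lt; rewrite eh.
    apply: ep => d dN; rewrite hg; last by rewrite subSn ?expnS; [nia | lia].
    by rewrite subSn ?digs_push //; lia.
case=> [/(quant tEx _ (@Ex _)) H1|/(quant tAll _ (@All _)) H1].
  apply: H1 => //.
  - by move=> g; constructor.
  - move=> s x g; split=> [[d h]|[d [_ [_ h]]]]; last by exists (inord d).
    exists d; split; first by apply: leq_trans NV; apply: ltnW.
    by split=> //; rewrite inord_val.
  - by move=> P R PR; split=> -[d [dV [dN h]]]; exists d; split=> //; split=> //; apply/PR.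
apply: H1 => //.
- by move=> g; constructor.
- move=> s x g; split=> [h d _ _|h d]; first exact: h.
  have := h d _ (ltn_ord d); rewrite inord_val; apply.
  by apply: leq_trans NV; apply: ltnW.
- by move=> P R PR; split=> h d dV dN; apply/PR => //; apply: h.
Qed.

Lemma cert_sound : FL1T_sat m w.
Proof.
have [nQ [_ [_ [_ [_ [_ [_ [_ [_ H]]]]]]]]] := body.
case: H => k [_ [kQ [r [_ [rQ [p [pV [c [cV [/eqpE ek [/lep_leq rm [hp [cp [ht hh]]]]]]]]]]]]]].
have {}hp := powers_sound rQ pV hp.
have kw : win <= k <= win + m by lia.
have [f [dr fl wf hf]] := parse_sound (ltac:(lia) : 0 < Q) nQ kQ kw ht.
have kr : k - win = r by lia.
exists f; split.
- exact: FL_of_window fl wf.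
- have hs0 : hs decoded (env (k - win) c) f by apply/hf => //; rewrite kr -hp.
  have [v ev] := recent_onto (inord 0 : 'I_N) (s := env (k - win) c) (k := k)
    ltac:(by rewrite size_digs; lia).
  exists 'I_N, decoded, v; split; first exact: decoded_trans.
  apply/(holds_hs _ _ fl (a := win)); last by rewrite size_digs in ev; rewrite ev.
    by apply: sub_all wf => x /andP[].
  by lia.
- by move: dr; rewrite drop0 drop_size cats0.
Qed.

End Soundness.

(** * Completeness of certificates *)

Section PrefixFree.

Definition is_arg (b : token) : bool :=
  match b with tVar | tBit _ => true | _ => false end.
Definition is_bit (b : token) : bool := if b is tBit _ then true else false.
(** Arities are not written down: an atom ends where no further variable follows. Unique readability
    therefore needs to know that the rest of the word cannot prolong a list of variables. *)
Definition no_arg (r : seq token) := if r is b :: _ then ~~ is_arg b else true.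
Definition no_bit (r : seq token) := if r is b :: _ then ~~ is_bit b else true.

Lemma no_arg_bit r : no_arg r -> no_bit r.
Proof. by case: r => // -[]. Qed.

Lemma map_bit_inj b b' r r' : no_bit r -> no_bit r' ->
  map tBit b ++ r = map tBit b' ++ r' -> b = b' /\ r = r'.
Proof.
move=> nr nr'; elim: b b' => [|x b IH] [|y b'] //=.
- by move=> e; rewrite e in nr.
- by move=> e; rewrite -e in nr'.
- by move=> [-> /IH[-> ->]].
Qed.

Lemma pos_bits_inj p q : pos_bits p = pos_bits q -> p = q.
Proof.
have nz r : pos_bits r <> [::] by case: r.
elim: p q => [p IH|p IH|] [q|q|] //= [].
- by move/IH ->.
- by move/nz.
- by move/IH ->.
- by move/esym/nz.
Qed.

Lemma bits_prefix x y r r' : no_bit r -> no_bit r' -> bits x ++ r = bits y ++ r' ->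
  x = y /\ r = r'.
Proof.
move=> nr nr'; rewrite /bits => /(map_bit_inj nr nr')[e ->]; split=> //.
rewrite -[x]bin_of_natK -[y]bin_of_natK; congr nat_of_bin.
case: (bin_of_nat x) (bin_of_nat y) e => [|p] [|q] //.
- by case: q.
- by case: p.
- by move/pos_bits_inj ->.
Qed.

Lemma vars_prefix xs ys r r' : no_arg r -> no_arg r' ->
  flatten (map enc_var xs) ++ r = flatten (map enc_var ys) ++ r' -> xs = ys /\ r = r'.
Proof.
move=> nr nr'; elim: xs ys => [|x xs IH] [|y ys] //=.
- by move=> e; rewrite e in nr.
- by move=> e; rewrite -e in nr'.
have nb zs t : no_arg t -> no_bit (flatten (map enc_var zs) ++ t).
  by case: zs => //=; exact: no_arg_bit.
by rewrite -!catA => -[/bits_prefix[]]; rewrite ?nb // => -> /IH[-> ->].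
Qed.

Lemma encode_head f : exists b u, encode f = b :: u /\ ~~ is_arg b.
Proof.
case: f => [|| [|R] xs | g | g h | g h | g h | g h | x g | x g] /=; by eexists; eexists; split.
Qed.

Lemma no_arg_encode f r : no_arg (encode f ++ r).
Proof. by have [b [u [-> nb]]] := encode_head f. Qed.

Lemma encode_prefix f g r r' : no_arg r -> no_arg r' ->
  encode f ++ r = encode g ++ r' -> f = g /\ r = r'.
Proof.
elim: f g r r' => [|| [|[i k]] xs | f1 IH | f1 IH f2 IH2 | f1 IH f2 IH2
  | f1 IH f2 IH2 | f1 IH f2 IH2 | x f1 IH | x f1 IH]
  [|| [|[i' k']] ys | g1 | g1 g2 | g1 g2 | g1 g2 | g1 g2 | y g1 | y g1] r r' nr nr' //=.
1,2: by move=> [->].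
- move=> [/(vars_prefix nr nr')[/val_inj -> ->]] //.
- rewrite -!catA => -[/bits_prefix[]] => [||-> /(vars_prefix nr nr')[e ->]].
  + by case: (val xs) => //=; exact: no_arg_bit.
  + by case: (val ys) => //=; exact: no_arg_bit.
  split=> //; move: xs ys e => xs ys e.
  (* The arities must be identified before the two tuples have the same type. *)
  have ek : k = k' by have := congr1 size e; rewrite !size_tuple.
  by case: k' / ek ys e => ys /val_inj ->.
- by move=> [/(IH _ _ _ nr nr')[-> ->]].
1-4: by move=> []; rewrite -!catA => /IH[|| -> /(IH2 _ _ _ nr nr')[-> ->]];
  rewrite ?no_arg_encode.
1-2: move=> []; rewrite -!catA => /bits_prefix[|| -> /(IH _ _ _ nr nr')[-> ->]] //;
  exact: no_arg_bit (no_arg_encode _ _).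
Qed.

End PrefixFree.

Section Segments.

Variable w : seq token.

(** The equation for [j] does not follow from the other one, since all suffixes past the end of [w]
    are empty. *)
Definition seg i u j := j = i + size u /\ drop i w = u ++ drop j w.

Lemma seg_cons i b u j : seg i (b :: u) j -> [/\ onth w i = Some b, i < size w & seg i.+1 u j].
Proof.
move=> [ej e]; have ei : onth w i = Some b.
  by rewrite -[w](cat_take_drop i) e onth_cat size_takel ?ltnn ?subnn //; 
    case: (leqP i (size w)) => // /ltnW/drop_oversize di; rewrite di in e.
have ltn : i < size w by have := onthTE w i; rewrite ei => <-.
split=> //; split; first by rewrite ej /= addnS.
by move: e; rewrite (onth_drop ei) => -[].
Qed.

Lemma seg_cat i u u' j : seg i (u ++ u') j -> seg i u (i + size u) /\ seg (i + size u) u' j.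
Proof.
rewrite /seg size_cat => -[-> e].
have e' : drop (i + size u) w = u' ++ drop (i + (size u + size u')) w.
  by rewrite addnC -drop_drop e -catA drop_size_cat.
by rewrite e' addnA in e *; split; split=> //; rewrite catA.
Qed.

Lemma seg_le i u j : i <= size w -> seg i u j -> j <= size w.
Proof.
move=> iw [-> /(congr1 size)]; rewrite size_cat !size_drop; lia.
Qed.

End Segments.

Lemma set_code_le (P : nat -> Prop) M : (forall x, P x -> x < M) ->
  exists2 c, c <= 2 ^ M & forall x, bit c x <-> P x.
Proof.
move=> PM; have [c lt H] := set_code P M; exists c => [|x]; first exact: ltnW.
case: (ltnP x M) => [/H //|le]; rewrite (bit_small lt le).
by split=> // /PM; lia.
Qed.

Section TupleCodes.

Variable Q : nat.

Lemma t2_inj a b a' b' : a < Q -> a' < Q -> t2 Q a b = t2 Q a' b' -> a = a' /\ b = b'.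
Proof.
rewrite /t2 => lt lt' e; have Q0 : 0 < Q by lia.
have e1 : a = a'.
  move/(congr1 (modn^~ Q)): e; rewrite ![_ + Q * _]addnC ![Q * _]mulnC !modnMDl.
  by rewrite !modn_small.
by split=> //; move: e; rewrite e1 => /addnI/eqP; rewrite eqn_pmul2l // => /eqP.
Qed.

Lemma t3_inj a b c a' b' c' : a < Q -> a' < Q -> b < Q -> b' < Q ->
  t3 Q a b c = t3 Q a' b' c' -> [/\ a = a', b = b' & c = c'].
Proof. by move=> ? ? ? ? /t2_inj[] // -> /t2_inj[] // -> ->. Qed.

Lemma t4_inj a b c d a' b' c' d' : a < Q -> a' < Q -> b < Q -> b' < Q -> c < Q -> c' < Q ->
  t4 Q a b c d = t4 Q a' b' c' d' -> [/\ a = a', b = b', c = c' & d = d'].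
Proof. by move=> ? ? ? ? ? ? /t2_inj[] // -> /t3_inj[] // -> -> ->. Qed.

Lemma t2_lt a b B : a < Q -> b < B -> t2 Q a b < Q * B.
Proof. rewrite /t2; nia. Qed.

Lemma t3_lt a b c B : a < Q -> b < Q -> c < B -> t3 Q a b c < Q * (Q * B).
Proof. by move=> ? ? ?; do !apply: t2_lt. Qed.

Lemma t4_lt a b c d B : a < Q -> b < Q -> c < Q -> d < B -> t4 Q a b c d < Q * (Q * (Q * B)).
Proof. by move=> ? ? ? ?; do !apply: t2_lt. Qed.

End TupleCodes.

Lemma bits_lt x : x < 2 ^ size (bits x).
Proof.
rewrite -{1}[x]bin_of_natK /bits size_map; case: (bin_of_nat x) => //=.
by elim=> //= p IH; rewrite natTrecE expnS -addnn; lia.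
Qed.

Inductive binop : token -> (formula std_sig -> formula std_sig -> formula std_sig) -> Prop :=
| binop_and : binop tAnd (@And _)
| binop_or : binop tOr (@Or _)
| binop_imp : binop tImp (@Imp _)
| binop_iff : binop tIff (@Iff _).

Inductive quantop : token -> (nat -> formula std_sig -> formula std_sig) -> Prop :=
| quantop_ex : quantop tEx (@Ex _)
| quantop_all : quantop tAll (@All _).

(* [node f0 k0 g i k]: an occurrence of the subformula [g] of [f0], of level [k],
   whose code starts at position [i] of the code of [f0]. *)
Inductive node (f0 : formula std_sig) (k0 : nat) : formula std_sig -> nat -> nat -> Prop :=
| node_root : node f0 k0 f0 0 k0
| node_neg g i k of node f0 k0 (Neg g) i k : node f0 k0 g i.+1 k
| node_binl a F g h i k of binop a F & node f0 k0 (F g h) i k : node f0 k0 g i.+1 k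
| node_binr a F g h i k of binop a F & node f0 k0 (F g h) i k :
    node f0 k0 h (i.+1 + size (encode g)) k
| node_quant a F x g i k of quantop a F & node f0 k0 (F x g) i k :
    node f0 k0 g (i.+1 + size (enc_var x)) k.+1.

Section Nodes.

Variables (m a k0 : nat) (f0 : formula std_sig).
Hypotheses (fl0 : fluted k0 f0) (win0 : in_window a (a + m) f0) (ak0 : a <= k0 <= a + m).

Local Notation w := (encode f0).

Lemma binop_encode b F g h : binop b F -> encode (F g h) = b :: encode g ++ encode h.
Proof. by case. Qed.

Lemma quantop_encode b F x g : quantop b F -> encode (F x g) = b :: enc_var x ++ encode g.
Proof. by case. Qed.

Lemma binop_fluted b F g h k : binop b F -> fluted k (F g h) -> fluted k g /\ fluted k h.
Proof. by case=> fl; inversion fl. Qed.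

Lemma quantop_fluted b F x g k : quantop b F -> fluted k (F x g) -> x = k.+1 /\ fluted k.+1 g.
Proof. by case=> fl; inversion fl. Qed.

Lemma node_inv g i k : node f0 k0 g i k ->
  [/\ fluted k g, in_window a (a + m) g & a <= k <= a + m] /\
  [/\ seg w i (encode g) (i + size (encode g)), i <= size w
     & no_arg (drop (i + size (encode g)) w)].
Proof.
elim=> {g i k}.
- by split=> //; rewrite /seg add0n drop0 drop_size cats0.
- move=> g i k _ [[fl wi ak] [sg iw na]]; split; first by inversion fl.
  have [_ lt sg'] := seg_cons sg.
  by split=> //; rewrite addSnnS.
- move=> b F g h i k bF _ [[fl wi ak] [sg iw na]].
  have [fg fh] := binop_fluted bF fl.
  have wgh : in_window a (a + m) g && in_window a (a + m) h.
    by move: wi; rewrite /in_window -all_cat; case: bF.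
  have [wg wh] := andP wgh.
  move: sg na; rewrite (binop_encode _ _ bF) => sg na.
  have [_ lt /seg_cat[sg1 sg2]] := seg_cons sg.
  split=> //; split=> //; have [_ ->] := sg2; exact: no_arg_encode.
- move=> b F g h i k bF _ [[fl wi ak] [sg iw na]].
  have [fg fh] := binop_fluted bF fl.
  have wgh : in_window a (a + m) g && in_window a (a + m) h.
    by move: wi; rewrite /in_window -all_cat; case: bF.
  have [wg wh] := andP wgh.
  move: sg na; rewrite (binop_encode _ _ bF) => sg na.
  have ej : i.+1 + size (encode g) + size (encode h) = i + size (b :: encode g ++ encode h).
    by rewrite /= size_cat; lia.
  have [_ lt /seg_cat[sg1 sg2]] := seg_cons sg.
  by split=> //; rewrite ej; split=> //; apply: seg_le sg1.
- move=> b F x g i k qF _ [[fl wi ak] [sg iw na]].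
  have [ex fg] := quantop_fluted qF fl.
  have [wx wg] : (a < x <= a + m) /\ in_window a (a + m) g.
    by apply/andP; move: wi; rewrite /in_window; case: qF.
  move: sg na; rewrite (quantop_encode _ _ qF) => sg na.
  have ej : i.+1 + size (enc_var x) + size (encode g) = i + size (b :: enc_var x ++ encode g).
    by rewrite /= size_cat /=; lia.
  have [_ lt /seg_cat[sg1 sg2]] := seg_cons sg.
  split; first by split=> //; lia.
  by rewrite ej; split=> //; apply: seg_le sg1.
Qed.

(** Unique readability makes the truth table, which is indexed by positions instead of subformulas,
    well defined. *)
Lemma node_unique g g' i k k' : node f0 k0 g i k -> node f0 k0 g' i k' -> g = g'.
Proof.
move=> /node_inv[_ [[_ e] _ na]] /node_inv[_ [[_ e'] _ na']].
by rewrite e in e'; have [] := encode_prefix na na' e'.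
Qed.

End Nodes.

Lemma fluted_atomP (S : signature) k (P : predicate S) (xs : (arity P).-tuple nat) :
  fluted k (Atom xs) -> exists l, [/\ 0 < l, l <= k.+1 & val xs = iota l (k.+1 - l)].
Proof.
have inv f : fluted k f -> match f with
    | Atom _ ys => exists2 l, 0 < l & val ys = iota l (k.+1 - l)
    | _ => True
    end.
  by case=> // k' l P' ys l0 e; exists l.
move=> /inv[l l0 e]; case: (leqP l k.+1) => [lk|kl]; first by exists l.
by exists k.+1; split=> //; rewrite e subnn (_ : k.+1 - l = 0) //; lia.
Qed.

Section Completeness.

Variables (m a k0 : nat) (f0 : formula std_sig) (D : finType) (A : structure std_sig D).
Variables (d0 : D) (s0 : seq D) (W : token -> nat) (V Q : nat).
Hypotheses (m0 : 0 < m) (fl0 : fluted k0 f0) (win0 : in_window a (a + m) f0)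
  (ak0 : a <= k0 <= a + m) (trA : trans_interp A) (hs0 : hs A s0 f0) (sz0 : size s0 = k0 - a).

Local Notation w := (encode f0).
Local Notation n := (size w).
Local Notation N := #|D|.
Local Notation C := (N ^ m).
Local Notation B := (Q + N * C).
Local Notation M := (Q * (Q * (Q * B))).

Hypothesis W_w : forall b i, bit (W b) i = (onth w i == Some b).
(** [Q] exceeds all positions, levels and, thanks to [2 ^ n], all numbers written in the input. [M]
    bounds the codes of all tuples, so a set of tuples is a number up to [2 ^ M]. *)
Hypotheses (nQ : 2 ^ n <= Q) (aQ : a + m + 2 < Q) (MV : 2 ^ M <= V).

Definition nu x := nth d0 (enum D) x.
Local Notation env j c := (digs nu N j c).
Local Notation nd := (node f0 k0).

Lemma N_gt0 : 0 < N.
Proof. by apply/card_gt0P; exists d0. Qed.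

Lemma C_gt0 : 0 < C. Proof. by rewrite expn_gt0 N_gt0. Qed.

Lemma n_ltQ : n < Q.
Proof. by apply: leq_trans nQ; exact: ltn_expl. Qed.

Lemma M_ge x : x <= Q * (Q * B) -> x <= M.
Proof. by move=> le; apply: leq_trans le _; rewrite leq_pmull //; lia. Qed.

Lemma B_le_M : B <= M.
Proof. by apply: M_ge; rewrite mulnA leq_pmull // muln_gt0; lia. Qed.

Lemma M_le_V : M < V.
Proof. by apply: leq_trans MV; exact: ltn_expl. Qed.

Lemma nu_onto d : exists2 x, x < N & nu x = d.
Proof.
exists (index d (enum D)); first by rewrite cardE index_mem mem_enum.
by rewrite /nu nth_index // mem_enum.
Qed.

Lemma exq_intro P x : x < Q -> P x -> exq V Q P.
Proof.
move=> xQ Px; exists x; split=> //.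
by have := M_le_V; have := B_le_M; lia.
Qed.

Lemma env_atom P j c : arity P <= j ->
  AL A P (rev (take (arity P) (env j c))) <-> AL A P (rev (env (arity P) (c %% N ^ arity P))).
Proof. by move=> le; rewrite take_digs // digs_mod // N_gt0. Qed.

Lemma bits_Q i x j : i <= n -> seg w i (bits x) j -> x < Q.
Proof.
move=> iw sg; apply: leq_trans (bits_lt x) _; apply: leq_trans nQ.
by rewrite leq_exp2l //; have := seg_le iw sg; have [-> _] := sg; lia.
Qed.

Lemma seg_bits i x j : seg w i (bits x) j ->
  i = j /\ x = 0 \/ exists y (b : bool), [/\ x = y + y + b :> nat, 0 < x,
    onth w i = Some (tBit b) & seg w i.+1 (bits y) j].
Proof.
case: (posnP x) => [->|x0].
  by rewrite bits0 => -[-> _]; rewrite addn0; left.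
move=> sg; right; exists x./2, (odd x).
have ex : x = x./2 + x./2 + odd x by rewrite addnn addnC odd_double_half.
have eb : bits x = tBit (odd x) :: bits x./2.
  case ox: (odd x) ex => /= ex; first by rewrite {1}ex bits_doubleS.
  by rewrite {1}ex addn0 bits_double //; lia.
by move: sg; rewrite eb => /seg_cons[].
Qed.

Lemma cert_complete : cert V n m W.
Proof.
have N0 := N_gt0; have C0 := C_gt0; have nQ' := n_ltQ; have BM := B_le_M; have MV' := M_le_V.
have NC : N <= C by rewrite -{1}(expn1 N) leq_pexp2l.
have CNC : C <= N * C by rewrite leq_pmull.
have V2 x : x <= 2 ^ M -> x <= V by move=> le; apply: leq_trans MV.
have [|At lAt AtE] := @set_code_le (fun y => exists x z,
    [/\ x < N, z < N, y = z + N * x & AL A Trans [:: nu x; nu z]]) M.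
  move=> y [x [z [xN zN -> _]]]; have : N * N <= N * C by rewrite leq_mul2l NC orbT.
  by nia.
have [|As lAs AsE] := @set_code_le (fun y => exists x r e,
    [/\ x < Q, r < Q, e < C & y = t3 Q x r e /\ AL A (@Rel std_sig (x, r)) (rev (env r e))]) M.
  move=> y [x [r [e [xQ rQ eC [-> _]]]]].
  by apply: leq_trans (t3_lt xQ rQ (ltac:(lia) : e < B)) _; apply: M_ge.
have [|Bt lBt BtE] := @set_code_le (fun y => exists i j x,
    [/\ i < Q, j < Q, x < Q & y = t3 Q i j x /\ seg w i (bits x) j]) M.
  move=> y [i [j [x [iQ jQ xQ [-> _]]]]].
  by apply: leq_trans (t3_lt iQ jQ (ltac:(lia) : x < B)) _; apply: M_ge.
have [|Vt lVt VtE] := @set_code_le (fun y => exists i j l k,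
    [/\ i < Q, j < Q, l < Q, k.+1 < Q & [/\ l <= k.+1, y = t4 Q i j l k &
       seg w i (flatten (map enc_var (iota l (k.+1 - l)))) j]]) M.
  move=> y [i [j [l [k [iQ jQ lQ kQ [_ -> _]]]]]].
  by apply: t4_lt; lia.
have [|Pt lPt PtE] := @set_code_le (fun y => exists i j k,
    [/\ i < Q, j < Q, k < Q, y = t3 Q i j k &
       exists2 g, nd g i k & j = i + size (encode g)]) M.
  move=> y [i [j [k [iQ jQ kQ -> _]]]].
  by apply: leq_trans (t3_lt iQ jQ (ltac:(lia) : k < B)) _; apply: M_ge.
(* Environments up to [N * C] are tabulated, since a quantifier adds a digit to one below [C].
   Digits beyond the level [k - a] have no influence. *)
have [|Ht lHt HtE] := @set_code_le (fun y => exists i j k c,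
    [/\ i < Q, j < Q, k < Q, c < N * C & y = t4 Q i j k c /\
       exists g, [/\ nd g i k, j = i + size (encode g) & hs A (env (k - a) c) g]]) M.
  move=> y [i [j [k [c [iQ jQ kQ cC [-> _]]]]]].
  by apply: t4_lt; lia.
have [|Pw lPw PwE] := @set_code_le (fun y => exists2 r, r <= m & y = t2 Q r (N ^ r)) M.
  move=> y [r rm ->]; have : N ^ r <= C by rewrite leq_pexp2l.
  move=> le; apply: leq_trans (t2_lt (ltac:(lia) : r < Q) (ltac:(lia) : N ^ r < B)) _.
  by apply: M_ge; rewrite leq_pmull //; lia.
have AtP x z : x < N -> z < N -> bit At (z + N * x) <-> AL A Trans [:: nu x; nu z].
  move=> xN zN; rewrite AtE; split=> [[x' [z' [x'N z'N e h]]]|h]; last by exists x, z.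
  have [-> ->] : z = z' /\ x = x' by apply: t2_inj e.
  by [].
have AsP x r e : x < Q -> r < Q -> e < C ->
    bit As (t3 Q x r e) <-> AL A (@Rel std_sig (x, r)) (rev (env r e)).
  move=> xQ rQ eC; rewrite AsE; split=> [[x' [r' [e' [x'Q r'Q _ [eq h]]]]]|h]; last by exists x, r, e.
  by have [-> -> ->] := t3_inj xQ x'Q rQ r'Q eq.
have BtP i j x : i < Q -> j < Q -> x < Q -> bit Bt (t3 Q i j x) <-> seg w i (bits x) j.
  move=> iQ jQ xQ; rewrite BtE; split=> [[i' [j' [x' [i'Q j'Q _ [e h]]]]]|h]; last by exists i, j, x.
  by have [-> -> ->] := t3_inj iQ i'Q jQ j'Q e.
have VtP i j l k : i < Q -> j < Q -> l < Q -> k < Q -> bit Vt (t4 Q i j l k) <->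
    [/\ k.+1 < Q, l <= k.+1 & seg w i (flatten (map enc_var (iota l (k.+1 - l)))) j].
  move=> iQ jQ lQ kQ; rewrite VtE; split.
    move=> [i' [j' [l' [k' [i'Q j'Q l'Q k'Q [lk e h]]]]]].
    have [-> -> -> ->] := t4_inj iQ i'Q jQ j'Q lQ l'Q e; split=> //.
  by move=> [k1 lk h]; exists i, j, l, k.
have PtP i j k : i < Q -> j < Q -> k < Q -> bit Pt (t3 Q i j k) <->
    exists2 g, nd g i k & j = i + size (encode g).
  move=> iQ jQ kQ; rewrite PtE; split=> [[i' [j' [k' [i'Q j'Q _ e h]]]]|h]; last by exists i, j, k.
  by have [-> -> ->] := t3_inj iQ i'Q jQ j'Q e.
have nodeQ g i k : nd g i k -> [/\ i < Q, i + size (encode g) < Q & k < Q].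
  move=> /(node_inv fl0 win0 ak0)[[_ _ ?] [sg iw _]].
  by have := seg_le iw sg; split; lia.
have HtP g i k c : nd g i k -> c < N * C ->
    bit Ht (t4 Q i (i + size (encode g)) k c) <-> hs A (env (k - a) c) g.
  move=> ndg cC; have [iQ jQ kQ] := nodeQ _ _ _ ndg; rewrite HtE; split; last first.
    by move=> h; exists i, (i + size (encode g)), k, c; split=> //; split=> //; exists g.
  move=> [i' [j' [k' [c' [i'Q j'Q k'Q _ [e [g' [nd' ej h]]]]]]]].
  have [ei ej' ek ec] := t4_inj iQ i'Q jQ j'Q kQ k'Q e.
  rewrite -ei -ek -ec in nd' h.
  by rewrite (node_unique fl0 win0 ak0 ndg nd').
have PwP r : r <= m -> bit Pw (t2 Q r (N ^ r)) by move=> rm; rewrite PwE; exists r.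
have PwPr r p : r < Q -> bit Pw (t2 Q r p) -> r <= m /\ p = N ^ r.
  move=> rQ; rewrite PwE => -[r' r'm e].
  by have [-> ->] := t2_inj rQ (ltac:(lia) : r' < Q) e.
have tokP b i : onth w i = Some b -> tok W b i by rewrite /tok W_w => ->; rewrite eqxx.
have powV r : r <= m -> N ^ r <= V.
  by move=> rm; apply: leq_trans (_ : C <= V); [rewrite leq_pexp2l | lia].
exists Q; split; first by lia.
exists N; split; first by lia.
exists C; split; first by lia.
exists At; split; first exact: V2.
exists As; split; first exact: V2.
exists Bt; split; first exact: V2.
exists Vt; split; first exact: V2.
exists Pt; split; first exact: V2.
exists Ht; split; first exact: V2.
exists Pw; split; first exact: V2.
exists a; split; first by lia.
split; first exact: nQ'.
split; first exact: N0.
split; first by lia.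
split; first exact: PwP.
split.
  move=> r _ rQ p _ /(PwPr _ _ rQ)[rm ->].
  case: r rm rQ => [|r] rm rQ; first by left; split; apply/eqpE.
  right; apply: (@exq_intro _ r); first by lia.
  exists (N ^ r); split; first by apply: powV; lia.
  by split; [apply/eqpE; lia | split; [apply/eqpE; rewrite expnSr | apply: PwP; lia]].
split.
  move=> x _ y _ z _ xN yN zN; rewrite !AtP // -/(related A _ _) -/(related A _ _) -/(related A _ _).
  exact: related_trans.
split.
  move=> i _ iQ j _ jQ x _ xQ; rewrite BtP // => /seg_bits[[-> ->]|[y [b [ex x0 ti sg]]]].
    by left; split; apply/eqpE.
  have lti : i < n by have := onthTE w i; rewrite ti => <-.
  have yQ : y < Q by apply: (bits_Q _ sg).
  right; apply: (exq_intro yQ); split; last first.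
    by split=> //; rewrite addn1 BtP //; lia.
  case: b ex ti => ex ti; [right | left]; split; try exact: tokP; apply/eqpE; lia.
split.
  move=> i _ iQ j _ jQ l _ lQ k _ kQ; rewrite VtP // => -[k1 lk].
  case: (ltnP k l) => [kl|{}lk].
    have -> : k.+1 - l = 0 by lia.
    by move=> [-> _]; left; split; apply/eqpE; rewrite ?addn0 //; lia.
  rewrite subSn //= => /seg_cons[ti lti /seg_cat[sb sv]]; right.
  set i' := i.+1 + size (bits l) in sb sv.
  have i'n : i' <= n by apply: seg_le sb.
  split; first by apply/lepE.
  split; first exact: tokP.
  apply: (@exq_intro _ i'); first by lia.
  split; first by rewrite /i'; lia.
  split; first by lia.
  split; first by rewrite addn1 BtP //; lia.
  by rewrite addn1 VtP //; try lia; split=> //; rewrite subSS.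
split; last first.
  apply: (@exq_intro _ k0); first by lia.
  apply: (@exq_intro _ (k0 - a)); first by lia.
  have pm : k0 - a <= m by lia.
  have [c ltc ec] := digs_onto N0 s0 nu_onto; rewrite sz0 in ltc ec.
  have root := node_root f0 k0.
  have pV := powV _ pm.
  exists (N ^ (k0 - a)); split=> //; exists c; split; first by lia.
  split; first by apply/eqpE; lia.
  split; first by apply/lepE.
  split; first exact: PwP.
  split=> //.
  split; first by rewrite PtP //; try lia; exists f0.
  have -> : n = 0 + n by [].
  rewrite HtP //; first by rewrite ec.
  have : N ^ (k0 - a) <= C by rewrite leq_pexp2l.
  by lia.
have truth g i k P : nd g i k -> (forall c, c < C -> c <= V -> hs A (env (k - a) c) g <-> P c) ->
    ctruth V Q C Ht i (i + size (encode g)) k P.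
  move=> ndg HP c cV cC; have h1 := HP c cC cV.
  have h2 := HtP g i k c ndg (ltac:(lia) : c < N * C).
  by split=> h; [apply/h1/h2 | apply/h2/h1].
have bin b F op g h i k : binop b F -> nd (F g h) i k ->
    (forall s, hs A s (F g h) <-> op (hs A s g) (hs A s h)) ->
    (forall A1 A2 B1 B2, (A1 <-> A2) -> (B1 <-> B2) -> (op A1 B1 <-> op A2 B2)) ->
    cbin V W Q C Pt Ht b op i (i + size (encode (F g h))) k.
  move=> bF ndF hF ext; have [[_ _ _] [sg iw _]] := node_inv fl0 win0 ak0 ndF.
  have ndg := node_binl bF ndF; have ndh := node_binr bF ndF.
  have [iQ jQ kQ] := nodeQ _ _ _ ndF; have [iQ1 i'Q _] := nodeQ _ _ _ ndg.
  have tr := truth _ _ _ _ ndF; move: sg jQ tr; rewrite (binop_encode _ _ bF).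
  move=> /seg_cons[ti lti sg] jQ tr.
  have ej : i + size (b :: encode g ++ encode h) = i.+1 + size (encode g) + size (encode h).
    by rewrite /= size_cat; lia.
  split; first exact: tokP.
  apply: (exq_intro i'Q); rewrite addn1; split; first by lia.
  split; first by rewrite PtP //; exists g.
  split; first by rewrite ej PtP //; [exists h | lia].
  apply: tr => c cC _; rewrite hF; apply: ext; apply: iff_sym.
    by apply: HtP => //; lia.
  by rewrite ej; apply: HtP => //; lia.
have quant b F (q : (nat -> Prop) -> Prop) x g i k : quantop b F -> nd (F x g) i k ->
    (forall s, hs A s (F x g) <-> q (fun d => hs A (nu d :: s) g)) ->
    (forall P R : nat -> Prop, (forall d, d < N -> P d <-> R d) -> q P <-> q R) ->
    cquant V m W Q N C Bt Pt Ht a b q i (i + size (encode (F x g))) k.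
  move=> qF ndF hF ext; have [[fl wi akk] [sg iw _]] := node_inv fl0 win0 ak0 ndF.
  have [ex _] := quantop_fluted qF fl; subst x.
  have [wx _] : (a < k.+1 <= a + m) /\ in_window a (a + m) g.
    by apply/andP; move: wi; rewrite /in_window; case: qF.
  have kwm : k < a + m by lia.
  have ndg := node_quant qF ndF.
  have [iQ jQ kQ] := nodeQ _ _ _ ndF; have [i'Q _ kQ1] := nodeQ _ _ _ ndg.
  have tr := truth _ _ _ _ ndF; move: sg jQ tr; rewrite (quantop_encode _ _ qF).
  move=> /seg_cons[ti lti /seg_cons[ti1 lti1 sg]] jQ tr.
  have [sb sgg] := seg_cat sg.
  have ei' : i.+1 + size (enc_var k.+1) = i.+2 + size (bits k.+1).
    by rewrite -[size (enc_var _)]/(size (bits k.+1)).+1 addnS.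
  have ej : i + size (b :: enc_var k.+1 ++ encode g) =
      i.+1 + size (enc_var k.+1) + size (encode g).
    by rewrite /= size_cat; lia.
  split; first exact: tokP.
  split; first by rewrite addn1; apply: tokP.
  split=> //; apply: (exq_intro i'Q); rewrite !addn1; split; first by lia.
  split=> //.
  split; first by rewrite BtP // ?ei' //; lia.
  split; first by rewrite ej PtP //; [exists g | lia].
  apply: tr => c cC _; rewrite hF; apply: ext => d dN; rewrite ej HtP //; last by nia.
  by rewrite subSn ?digs_push //; lia.
move=> i _ iQ j _ jQ k _ kQ; rewrite PtP // => -[g ndg ->] {j jQ}.
have [[flg wig akk] [sg iw na]] := node_inv fl0 win0 ak0 ndg.
have [_ jQ _] := nodeQ _ _ _ ndg.
rewrite /cnode; case: g ndg flg wig sg na jQ => [|| P xs | g | g h | g h | g h | g h | x g | x g]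
  ndg flg wig sg na jQ.
- left; have [ti _ _] := seg_cons sg; split; first exact: tokP.
  by split; [apply/eqpE | apply: truth].
- right; left; have [ti _ _] := seg_cons sg; split; first exact: tokP.
  by split; [apply/eqpE | apply: truth].
- right; right; have [l [l0 lk exs]] := fluted_atomP flg.
  have ar : k.+1 - l = arity P by rewrite -(size_tuple xs) exs size_iota.
  have al : a < l.
    case: (posnP (k.+1 - l)) => [?|pos]; first by lia.
    have := allP wig l; rewrite /= exs mem_iota => h; have := h ltac:(lia); lia.
  have hsE c : hs A (env (k - a) c) (Atom xs) <-> AL A P (rev (env (arity P) (c %% N ^ arity P))).
    have le : arity P <= k - a by rewrite -ar; clear -al akk lk; lia.
    exact: (env_atom c le).
  case: P xs ndg flg wig sg na jQ exs ar hsE => [|[x r]] xs ndg flg wig sg na jQ exs ar hsE.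
    left; have [ti lti sv] := seg_cons sg; split; first exact: tokP.
    have {}ar : k.+1 - l = 2 by exact: ar.
    have kl : k = l.+1 by lia.
    apply: (@exq_intro _ l); first by lia.
    split=> //; split; first by apply/eqpE; rewrite addn1.
    split; first by rewrite addn1 VtP //; [split=> //; [lia | rewrite -exs] | lia | lia].
    apply: truth => // c cC cV; rewrite hsE clastE ?muln_gt0 ?N0 // mulnn.
    set e := c %% _; have eN : e < N ^ 2 by rewrite ltn_pmod // expn_gt0 N0.
    have eN' : e %/ N < N by rewrite ltn_divLR // mulnn.
    rewrite {2}(divn_eq e N) addnC mulnC AtP ?ltn_pmod //.
    by rewrite /= (modn_small eN').
  right; left; have [ti lti /seg_cat[sb sv]] := seg_cons sg; split; first exact: tokP.
  set i' := i.+1 + size (bits x) in sb sv.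
  have i'n : i' <= n by apply: seg_le sb.
  have xQ : x < Q by apply: bits_Q sb.
  have i'Q : i' < Q by clear -i'n nQ'; lia.
  have i1Q : i.+1 < Q by clear -lti nQ'; lia.
  have lQ : l < Q by clear -lk akk aQ; lia.
  apply: (exq_intro i'Q); apply: (exq_intro xQ); apply: (exq_intro lQ).
  rewrite /= in ar; have rm : r <= m by lia.
  apply: (@exq_intro _ r); first by lia.
  exists (N ^ r); split; first exact: powV.
  split; first by rewrite /i'; lia.
  split; first by rewrite addn1 BtP.
  split; first by rewrite VtP //; split=> //; [lia | rewrite -exs].
  split=> //; split; first by apply/eqpE; lia.
  split; first exact: PwP.
  apply: truth => // c cC cV; rewrite hsE clastE ?expn_gt0 ?N0 //; apply: iff_sym; apply: AsP => //; first by lia.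
  apply: leq_trans (ltn_pmod _ _) _; first by rewrite expn_gt0 N0.
  by rewrite leq_pexp2l.
- do 4!right; left; have [ti lti _] := seg_cons sg; have ndg' := node_neg ndg.
  have ej : i + size (encode (Neg g)) = i.+1 + size (encode g) by rewrite addSnnS.
  split; first exact: tokP.
  split; first by rewrite addn1 ej PtP //; [exists g | lia | rewrite -ej].
  apply: truth => // c cC _; rewrite addn1 ej /= HtP //; lia.
- do 5!right; left; apply: (bin _ _ _ _ _ _ _ binop_and ndg) => //; tauto.
- do 6!right; left; apply: (bin _ _ _ _ _ _ _ binop_or ndg) => //; tauto.
- do 7!right; left; apply: (bin _ _ _ _ _ _ _ binop_imp ndg) => //; tauto.
- do 8!right; left; apply: (bin _ _ _ _ _ _ _ binop_iff ndg) => //; rewrite /iffp; tauto.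
- do 9!right; left; apply: (quant _ _ _ _ _ _ _ quantop_ex ndg).
    move=> s; split=> [[d]|[x' [_ [_ h]]]]; last by exists (nu x').
    have [x' x'N <-] := nu_onto d => h; exists x'; split; [lia | by split].
  by move=> P R PR; split=> -[d [dV [dN h]]]; exists d; split=> //; split=> //; apply/PR.
- do 10!right; apply: (quant _ _ _ _ _ _ _ quantop_all ndg).
    move=> s; split=> [h d _ _|h d]; first exact: h.
    by have [x' x'N <-] := nu_onto d; apply: h => //; lia.
  by move=> P R PR; split=> h d dV dN; apply/PR => //; apply: h.
Qed.

End Completeness.

(** * The theorem *)

Lemma fsize_encode (f : formula std_sig) : fsize f <= size (encode f).
Proof.
have vs (s : seq nat) : size s <= size (flatten (map enc_var s)).
  elim: s => //= x s IH; rewrite size_cat; lia.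
elim: f => //= [P xs|g IHg h IHh|g IHg h IHh|g IHg h IHh|g IHg h IHh|x g IH|x g IH];
  rewrite ?size_cat //; try lia.
have := vs xs; rewrite size_tuple; case: P xs => [|R] xs /=; lia.
Qed.

Lemma variable_bound (f : formula std_sig) x : x \in variables f -> x < 2 ^ size (encode f).
Proof.
have vs (s : seq nat) : x \in s -> size (bits x) <= size (flatten (map enc_var s)).
  elim: s => //= y s IH; rewrite inE size_cat => /orP[/eqP <-|/IH]; lia.
move=> xf; apply: leq_trans (bits_lt x) _; rewrite leq_exp2l //.
elim: f xf => //= [P xs|g IH|g IHg h IHh|g IHg h IHh|g IHg h IHh|g IHg h IHh|y g IH|y g IH].
- by move=> /vs; rewrite size_cat; lia.
- by move=> /IH; lia.
1-4: by rewrite mem_cat size_cat => /orP[/IHg|/IHh]; lia.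
1-2: by rewrite inE size_cat => /orP[/eqP <-|/IH]; lia.
Qed.

(** [e] is chosen so that [X = tower m (e * (n + 2))] dominates both the model size and [Q]. Tuple
    codes are then below [X ^ (m + 5)]: three factors [Q], and [X ^ (m + 2)] for the last
    component. *)
Lemma cert_iff m w V W : 2 <= m -> (forall b i, bit (W b) i = (onth w i == Some b)) ->
  let e := (m + 3) * m + m + 5 in
  2 ^ tower m ((m + 5) * (e * (size w + 2))) <= V ->
  FL1T_sat m w <-> cert V (size w) m W.
Proof.
move=> m2 Ww e leV; split; last first.
  move=> [Q [QV [[|N'] [NV [C [CV [At [_ [As [_ [Bt [_ [Vt [_ [Pt [_ [Ht [_ [Pw [_ [win [_ body]]]]]]]]]]]]]]]]]]]]]].
    by have [_ []] := body.
  exact: (cert_sound Ww QV CV NV body).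
move=> [f [flf satf ew]]; have [k [a [fl wi ak kv]]] := FL_window flf.
have [D [cD [A [v [trA hv]]]]] := small_model m2 flf satf.
have ka : a <= k by lia.
have wa : all (fun x => a < x) (variables f) by apply: sub_all wi => x /andP[].
have hsA := proj1 (holds_hs A v fl wa ka) hv.
have szr : size (recent v k (k - a)) = k - a by rewrite size_map size_iota.
rewrite ew in Ww leV *; set n := size (encode f) in leV *.
(* The level is not part of the input, but it is 0, or it or its successor is a variable written
   there in binary. *)
have kn : k <= 2 ^ n.
  by case: kv => [->//|[]/variable_bound]; rewrite -/n; lia.
pose y := e * (n + 2); pose X := tower m y.
pose Q := 2 ^ n + (a + m + 3).
have N0 : 0 < #|D| by apply/card_gt0P; exists (v 0).
have NX : #|D| <= X.
  apply: leq_trans cD _; apply: tower_mono; rewrite /y /e.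
  by have := fsize_encode f; rewrite -/n => le; rewrite leq_mul //; lia.
have QX : Q <= X.
  apply: leq_trans (_ : tower 1 (n + 1 + (m + 3)) <= _).
    rewrite [tower 1 _]/= expnD [2 ^ (n + 1)]expnD expn1.
    have := ltn_expl (m + 3) (ltnSn 1); have : 0 < 2 ^ n by rewrite expn_gt0.
    rewrite /Q; nia.
  apply: leq_trans (tower_mono_l _ (ltac:(lia) : 1 <= m)); apply: tower_mono.
  by rewrite /y /e; nia.
have MX : Q * (Q * (Q * (Q + #|D| * #|D| ^ m))) <= tower m ((m + 5) * y).
  have y0 : 0 < y by rewrite /y /e muln_gt0 /=; lia.
  apply: leq_trans (_ : X ^ (m + 5) <= _); last first.
    by rewrite /X; case: (m) m2 => // m' _; apply: tower_exp; rewrite ?addn5.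
  rewrite -[m + 5]/(m + (1 + 4)) addnA addn1 expnD.
  have X2 : 2 <= X by apply: leq_trans QX; rewrite /Q; lia.
  have h : Q + #|D| * #|D| ^ m <= X ^ m.+1 * X.
    have h1 : #|D| * #|D| ^ m <= X ^ m.+1 by rewrite -expnS leq_exp2r.
    have h2 : X <= X ^ m.+1 by rewrite -{1}(expn1 X) leq_pexp2l //; lia.
    nia.
  have -> : X ^ m.+1 * X ^ 4 = X * (X * (X * (X ^ m.+1 * X))).
    by rewrite (expnS X 3) (expnS X 2) (expnS X 1) expn1; lia.
  by do 3!apply: leq_mul => //.
have q1 : 2 ^ n <= Q by rewrite leq_addr.
have q2 : a + m + 2 < Q by rewrite /Q; lia.
have q3 : 2 ^ (Q * (Q * (Q * (Q + #|D| * #|D| ^ m)))) <= V.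
  by apply: leq_trans leV; rewrite leq_exp2l.
exact: (cert_complete (v 0) (ltnW m2) fl wi ak trA hsA szr Ww q1 q2 q3).
Qed.

Theorem theorem12 (m : nat) (hm : 2 <= m) :
  (exists p : {poly nat}, forall (S : signature) (phi : formula S),
      FL m phi -> satisfiable phi ->
      has_model_of_size_le phi (tower m.+1 p.[fsize phi]%R)) /\
  in_kNExpTime m.+1 (FL1T_sat m).
Proof.
split.
  exists (((m + 3) * m)%N%:P * ('X + 1%:P))%R => S phi flp satp.
  have [D [cD mD]] := small_model hm flp satp; exists D; split=> //.
  rewrite (_ : _.[_]%R = (m + 3) * m * (fsize phi).+1).
    (* The model has size of tower height [m] only; the further exponential is spent in the decision
       procedure. *)
    exact: leq_trans cD (tower_leS _ _).
  by rewrite hornerM hornerD hornerX !hornerC -[(fsize phi).+1]addn1.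
pose e := (m + 3) * m + m + 5.
have [wf16 below41] := (andP (FCert_wf m), FCert_below m); have [wfm b16] := wf16.
(* All variables of [FCert] are below 41. As [size w + 2 >= 2], its power with exponent
   [(m + 5) * e] exceeds that constant, and one more factor gives the required bottom argument. *)
apply: (@decided_by_formula (FCert m) 41 ((m + 5) * e).+1 m.+1) => // w.
have [s16 s1 sW sO] := record_inv w.
set V := tower _ _; rewrite den_FCert.
have -> : input_store w V 0 = V by [].
have -> : input_store w V 1 = size w by rewrite /input_store; regs.
apply: cert_iff => // [b i|].
  have ? := wreg_bound b; have [_ <-] := sW b.
  by congr bit; rewrite /input_store; regs.
rewrite /V towerS leq_exp2l //; apply: tower_mono.
rewrite -/e mulnA expnS mulnC leq_mul //.
apply: leq_trans (ltnW (ltn_expl _ (ltnSn 1))) _; rewrite leq_exp2r //; first by lia.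
by rewrite muln_gt0 /e; lia.
Qed.
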